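(* Let $G$ be a triconed graph. Then the $h$-vector of the graphic matroid of $G$ is a pure $\mathcal{O}$-sequence.
   Context: Graphs are finite and may have loops and parallel edges (distinct edges joining the same two distinct vertices). A graph $G$ is a triconed graph if one can choose three distinct vertices, named $0,1,2$, such that: $1$ and $2$ are both adjacent to $0$; there are no parallel edges having $0$, $1$ or $2$ as an endpoint; and every other vertex is adjacent to at least one of $0,1,2$. The graphic matroid of $G$ is the matroid on the edge set $E$ of $G$ whose bases are the edge sets of the spanning trees of $G$; its rank $r$ is the number of edges of a spanning tree. Fix any total order on $E$. An element $i$ of a base $B$ is (internally) active if $(B\setminus\{i\})\cup\{j\}$ is not a base for any $j<i$ (with $j \in E\setminus B$); otherwise it is (internally) passive. The $h$-vector of the matroid is $(h_0,\dots,h_r)$, where $h_i$ is the number of bases with exactly $i$ passive elements (this does not depend on the chosen order). An order ideal is a finite collection $X$ of monomials such that whenever $M\in X$ and $N$ divides $M$, also $N\in X$. It is pure if all monomials of $X$ that are maximal under divisibility have the same degree. A sequence is a pure $\mathcal{O}$-sequence if it is the degree sequence of some pure order ideal $X$, i.e. its $i$-th entry is the number of monomials of degree $i$ in $X$ for every $i$ (trailing zeros being allowed). *)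

(* Defs.v *)
From mathcomp Require Import all_boot all_order.
From mathcomp Require Import finmap.
From mathcomp Require Import mpoly.

Set Implicit Arguments.
Unset Strict Implicit.
Unset Printing Implicit Defensive.

(* Finite multigraphs: [ends e] is the unordered set of endpoints of the edge
   [e], so a loop is an edge with a single endpoint. *)
Record multigraph (V E : finType) := Multigraph {
  ends :> E -> {set V};
  ends_card : forall e, 0 < #|ends e| <= 2
}.

Section Graphs.
Variables (V E : finType) (G : multigraph V E).

Definition adjacent (x y : V) : bool := [exists e, G e == [set x; y]].

Definition parallel (e f : E) : bool :=
  [&& e != f, G e == G f & #|G e| == 2].

Definition triconed : Prop :=
  exists v0 v1 v2 : V,
    [/\ uniq [:: v0; v1; v2],
        adjacent v1 v0 /\ adjacent v2 v0,
        forall e f, parallel e f -> forall v, v \in [:: v0; v1; v2] -> v \notin G e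
      & forall v, v \notin [:: v0; v1; v2] ->
          exists2 u, u \in [:: v0; v1; v2] & adjacent v u].

(* [vs] and [es] list the distinct vertices and the distinct edges met when
   going once around a cycle; the cases [size vs = 1] and [size vs = 2] are
   loops and pairs of parallel edges. *)
Definition cycle_along (vs : seq V) (es : seq E) : bool :=
  [&& 0 < size vs, uniq vs, uniq es
    & [seq G e | e <- es] == [seq [set x; next vs x] | x <- vs]].

(* Bounding the length by [#|V|] only serves to stay in [bool]: see
   [acyclicP]. *)
Definition acyclic (F : {set E}) : bool :=
  [forall k : 'I_#|V|.+1, forall vs : k.-tuple V, forall es : k.-tuple E,
     cycle_along vs es ==> ~~ all (mem F) es].

Lemma acyclicP (F : {set E}) :
  reflect (forall vs es, cycle_along vs es -> ~~ all (mem F) es) (acyclic F).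
Proof.
apply: (iffP idP) => [acF vs es cyc|acF]; last first.
  apply/forallP => k; apply/forallP => vs; apply/forallP => es.
  by apply/implyP; apply: acF.
have /and4P[_ uvs _ /eqP/(congr1 size)] := cyc; rewrite !size_map => sz_es.
have lt_k : size vs < #|V|.+1 by rewrite ltnS -(card_uniqP uvs) max_card.
have /forallP/(_ (Ordinal lt_k))/forallP/(_ (in_tuple vs)) := acF.
by move=> /forallP/(_ (Tuple (introT eqP sz_es)))/implyP; apply.
Qed.

Definition connected (F : {set E}) : bool :=
  [forall x, forall y, connect [rel u v | [exists e in F, G e == [set u; v]]] x y].

Definition spanning_tree (F : {set E}) : bool := connected F && acyclic F.

(* A matroid on [E] is represented by its set of bases. *)
Definition graphic_matroid : {set {set E}} := [set F | spanning_tree F].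

End Graphs.

Section HVector.
Variables (disp : Order.disp_t) (E : finOrderType disp).
Variable Bs : {set {set E}}.

Definition active (B : {set E}) (i : E) : bool :=
  (i \in B) && [forall j : E, (j < i)%O && (j \notin B) ==> (j |: (B :\ i) \notin Bs)].

Definition passive (B : {set E}) : {set E} := [set i in B | ~~ active B i].

(* The bases of a matroid have the same size, so the maximum is that size. *)
Definition matroid_rank : nat := \max_(B in Bs) #|B|.

Definition h_vector : seq nat :=
  mkseq (fun i => #|[set B in Bs | #|passive B| == i]|) matroid_rank.+1.

End HVector.

Section OSequences.
Local Open Scope fset_scope.

(* On ['X_{1..n}], [(m1 <= m2)%MM] is divisibility of monomials. *)
Definition order_ideal n (X : {fset 'X_{1..n}}) : Prop :=
  forall m m' : 'X_{1..n}, m \in X -> (m' <= m)%MM -> m' \in X.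

Definition maximal_monomial n (X : {fset 'X_{1..n}}) (m : 'X_{1..n}) : Prop :=
  m \in X /\ forall m' : 'X_{1..n}, m' \in X -> (m <= m')%MM -> m' = m.

Definition pure n (X : {fset 'X_{1..n}}) : Prop :=
  forall m m' : 'X_{1..n},
    maximal_monomial X m -> maximal_monomial X m' -> mdeg m = mdeg m'.

(* [nth 0 s i] is [0] for [i >= size s]: no monomial of [X] may have a degree
   beyond the length of the sequence. *)
Definition pure_O_sequence (s : seq nat) : Prop :=
  exists n (X : {fset 'X_{1..n}}),
    [/\ order_ideal X, pure X
      & forall i, nth 0 s i = #|` [fset m in X | mdeg m == i]|].

End OSequences.

(* Main.v *)
Require Import Defs.
From HB Require Import structures.
From mathcomp Require Import all_boot all_order.
From mathcomp Require Import zify.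

(** The proof compares two generating functions and then exhibits the order ideal.

Let r be the rank. The intervals between the passive part of a base and the base
partition the forests of a graph, so that for every q the sum of q^(r - |I|) over the
forests I is the sum of (q + 1)^(r - p) over the bases, p being the number of passive
elements ([indep_sum]). A family of monomials for which the sum of
(q + 1)^(r - degree) has the same values therefore has the h-vector as its degree
sequence ([digits_eq]). So it is enough to find a pure order ideal with the right sum.

Forests of a triconed graph. Let F0 be a forest avoiding the three cone vertices,
whose colours are 0, 1 and 2. A set J of further edges makes a forest together with
F0 when, in each component of F0, the edges of J that attach it to cone vertices have
distinct colours, and when the connections thus made between the cone vertices
contain no cycle. A component with at most one edge of J makes no connection; one
with two or three connects the cone vertices of their colours. Connections are
elements of a monoid of seven classes ([cls], [mulc]), and F0 with J is a forest
when the product over the components is not [Bad] ([forest_jcls]).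

Marked forests. The order ideal consists of forests with marks on their edges. A
component with n vertices has n - 1 edges, and the number of ways to choose nothing,
with weight q, or one of n vertices is the number of ways to choose no mark, with
weight q + 1, or a mark on one of n - 1 edges. Two vertices of different colours are
replaced by two marks, at the first and the last edge of the path between them;
three vertices of different colours by three marks. The latter are chosen such that
removing a mark always leaves the marks of two vertices ([big_mark_sub]) and that no
information is lost ([mark2_inj], [mark3p_inj], [mark3t_inj]). So marked forests are
closed under removing marks and unmarked edges ([inX_sub], [inX_del]). As vertices
of the components one takes the cone edges, which a star at each vertex joins
together; the edges of the stars are divided out at the end, by taking a link.

The edges between the cone vertices. The edges from the cone vertex 0 to the two
others, which exist by assumption, multiply a product of classes of a given kind by
(q + 1)^2, q + 1, q + 2 or 1, the factor q + 2 occurring for connections between the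
vertices 1 and 2. On the side of marked forests the factor is a power of q + 1, and
q + 2 = (q + 1) + 1 is obtained by introducing one more state, of class [Star], for
each state of class [L12]. This is compatible with products ([gsum_matched]), whence
the equality of the two sums, forest by forest ([local_matched], [sums_agree]). An
edge between the vertices 1 and 2, if there is one, is treated as an additional
component ([apex_matched]).

Purity. In a maximal marked forest every component with an edge is marked, so that
the degree is the number of vertices which are not isolated, plus the rank of the
product of the classes ([max_deg]). A marked forest of rank zero or one can be
enlarged whenever the graph has an edge joining the right colours, by adding a mark
or an edge ([max_rk0], [max_rk1]); so the rank is the same for all maximal ones
([maximal_deg]). *)

Set Implicit Arguments.
Unset Strict Implicit.
Unset Printing Implicit Defensive.

(** * Colours and the monoid of classes *)

(** The three cone vertices. *)
Inductive color := Col0 | Col1 | Col2.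

Definition color_eq a b :=
  match a, b with
  | Col0, Col0 | Col1, Col1 | Col2, Col2 => true
  | _, _ => false
  end.
Lemma color_eqP : Equality.axiom color_eq.
Proof. by do 2!case; constructor. Qed.
HB.instance Definition _ := hasDecEq.Build color color_eqP.

Definition clt a b :=
  match a, b with
  | Col0, Col1 | Col0, Col2 | Col1, Col2 => true
  | _, _ => false
  end.

(** How a component of a forest, or a set of them, connects the three cone
vertices: not at all, one pair, or all three; [Bad] is a cycle. The class [Star]
is never a connection: it is the class of additional states of rank two, one for
each pair of vertices of colours 1 and 2 in a component. *)
Inductive cls := Free | L01 | L02 | L12 | Star | Full | Bad.

Definition cls_code x : 'I_7 :=
  inord (match x with Free => 0 | L01 => 1 | L02 => 2 | L12 => 3 | Star => 4
    | Full => 5 | Bad => 6 end).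
Definition cls_decode (i : 'I_7) := nth Bad [:: Free; L01; L02; L12; Star; Full; Bad] i.
Lemma cls_codeK : cancel cls_code cls_decode.
Proof. by case; rewrite /cls_decode /cls_code inordK. Qed.

Definition cls_eq x y :=
  match x, y with
  | Free, Free | L01, L01 | L02, L02 | L12, L12 | Star, Star | Full, Full
  | Bad, Bad => true
  | _, _ => false
  end.
Lemma cls_eqP : Equality.axiom cls_eq.
Proof. by do 2!case; constructor. Qed.
HB.instance Definition _ := hasDecEq.Build cls cls_eqP.
HB.instance Definition _ : isCountable cls := CanIsCountable cls_codeK.
HB.instance Definition _ : isFinite cls := CanIsFinite cls_codeK.

(** Putting two connections side by side: two distinct pairs connect everything,
and any further connection closes a cycle. *)
Definition mulc x y :=
  match x, y with
  | Free, z | z, Free => z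
  | L01, L02 | L02, L01 | L01, L12 | L12, L01 | L02, L12 | L12, L02 => Full
  | _, _ => Bad
  end.

Lemma mulcA : associative mulc. Proof. by do 3!case. Qed.
Lemma mulcC : commutative mulc. Proof. by do 2!case. Qed.
Lemma mul1c : left_id Free mulc. Proof. by case. Qed.
HB.instance Definition _ := Monoid.isComLaw.Build cls Free mulc mulcA mulcC mul1c.

Definition link a b :=
  match a, b with
  | Col0, Col1 | Col1, Col0 => L01
  | Col0, Col2 | Col2, Col0 => L02
  | Col1, Col2 | Col2, Col1 => L12
  | _, _ => Bad
  end.

Lemma linkC a b : link a b = link b a. Proof. by case: a b => -[]. Qed.

Lemma clt_neq a b : clt a b -> a != b. Proof. by case: a b => -[]. Qed.
Lemma clt_total a b : a != b -> clt a b || clt b a. Proof. by case: a b => -[]. Qed.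

(** * Multisets of edges *)

(** Systems of marks are multisets of edges, that is, exponent vectors. *)
Section Multisets.
Variable E : finType.
Implicit Types (N M : {ffun E -> nat}) (l : seq E).

Definition deg N := \sum_e N e.
Definition mset l : {ffun E -> nat} := [ffun x => count_mem x l].

Lemma deg_mset l : deg (mset l) = size l.
Proof.
elim: l => [|x l IH] /=.
  by rewrite /deg big1 // => e _; rewrite ffunE.
rewrite /deg (eq_bigr (fun e => (x == e) + mset l e)); last by move=> e _; rewrite !ffunE.
rewrite big_split /= -/(deg _) IH (bigD1 x) //= eqxx big1 ?addn0 // => y.
by rewrite eq_sym => /negbTE->.
Qed.

Lemma mset_perm l l' : (mset l == mset l') = perm_eq l l'.
Proof.
apply/eqP/idP => [/ffunP eq|/permP eq]; last first.
  by apply/ffunP => x; rewrite !ffunE; apply: eq.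
by apply/allP => x _ /=; have := eq x; rewrite !ffunE => ->.
Qed.

Lemma deg0 N : deg N = 0 -> N = mset [::].
Proof.
move=> /eqP; rewrite sum_nat_eq0 => /forall_inP h.
by apply/ffunP => x; rewrite !ffunE; apply/eqP/h.
Qed.

Lemma mset_exists N : exists l, N = mset l.
Proof.
have [k] := ubnP (deg N); elim: k N => // k IH N.
rewrite ltnS => le; have [/deg0->|] := posnP (deg N); first by exists [::].
rewrite lt0n sum_nat_eq0 => /forall_inPn[x _ nx].
pose N' := [ffun y => N y - (y == x)].
have dN : deg N = (deg N').+1.
  rewrite /deg (bigD1 x) // [in RHS](bigD1 x) //= ffunE eqxx.
  rewrite (eq_bigr N') => [|y /negbTE yx]; first by move: nx => /=; case: (N x) => // n _; rewrite subn1.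
  by rewrite ffunE yx subn0.
have [|l defl] := IH N'; first by rewrite -ltnS -dN; lia.
exists (x :: l); apply/ffunP => y; rewrite ffunE /=.
have := congr1 (fun f : {ffun E -> nat} => f y) defl; rewrite !ffunE => <-.
rewrite [x == y]eq_sym; case: eqP => [->|_]; last by rewrite subn0.
by move: nx => /=; case: (N x) => // n _; rewrite subn1.
Qed.

Lemma mset_in l x : (0 < mset l x) = (x \in l).
Proof. by rewrite ffunE -has_count has_pred1. Qed.

Lemma sub_mult3 N a b d : deg N = 2 -> (forall x, N x <= mset [:: a; b; d] x) ->
  [\/ N = mset [:: a; b], N = mset [:: a; d] | N = mset [:: b; d]].
Proof.
have [l ->] := mset_exists N; rewrite deg_mset.
case: l => [|x [|y []]] //= _ le.
have X : x \in [:: a; b; d] by rewrite -mset_in; apply: leq_trans (le x); rewrite mset_in inE eqxx.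
have Y : y \in [:: a; b; d] by rewrite -mset_in; apply: leq_trans (le y); rewrite mset_in !inE eqxx orbT.
have lx := le x; have ly := le y.
have key l1 l2 : perm_eq l1 l2 -> mset l1 = mset l2 by rewrite -mset_perm => /eqP.
rewrite !ffunE /= in lx ly.
move: X Y; rewrite !inE => /or3P[] /eqP ? /or3P[] /eqP ?; subst x y.
all: try by [constructor 1 | constructor 2 | constructor 3 |
  constructor 1; apply: key; rewrite (perm_catC [:: _] [:: _])|
  constructor 2; apply: key; rewrite (perm_catC [:: _] [:: _])|
  constructor 3; apply: key; rewrite (perm_catC [:: _] [:: _])].
- move: lx; rewrite !eqxx; case: eqP => [->|_]; first by constructor 1.
  by case: eqP => [->|_]; first by constructor 2.
- move: lx; rewrite !eqxx; case: eqP => [->|_]; first by constructor 1.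
  by case: eqP => [->|_]; first by constructor 3.
- move: lx; rewrite !eqxx; case: eqP => [->|_]; first by constructor 2.
  by case: eqP => [->|_]; first by constructor 3.
Qed.

End Multisets.

(** The number of independent connections between the cone vertices, outside
[Bad]. *)
Definition rk x := match x with Free => 0 | L01 | L02 | L12 => 1 | Star | Full => 2 | Bad => 3 end.

(** The comparison of classes that holds when marks are removed: a class of rank
two, [Star] included, may drop to any pair. It is compatible with products, and its
main use is that what lies below a class other than [Bad] is not [Bad]. *)
Definition ple x y := [|| x == Free, x == y, y == Bad | (rk x == 1) && (rk y == 2)].

Lemma ple_mul x x' y y' : ple x x' -> ple y y' -> ple (mulc x y) (mulc x' y').
Proof. by case: x x' y y' => -[] [] []. Qed.

Lemma ple_refl x : ple x x. Proof. by case: x. Qed.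

Lemma ple_Bad x y : ple x y -> y != Bad -> x != Bad. Proof. by case: x y => -[]. Qed.

Lemma rk_mul x y : mulc x y != Bad -> rk (mulc x y) = rk x + rk y.
Proof. by case: x y => -[]. Qed.

Lemma mulc_Bad x y : mulc x y != Bad -> x != Bad /\ y != Bad.
Proof. by case: x y => -[]. Qed.

Section Swap.
Variable E : finType.
Implicit Types a b d : E.

Lemma mset_swap12 a b d : mset [:: a; b; d] = mset [:: b; a; d].
Proof. by apply/ffunP => x; rewrite !ffunE /= addnCA. Qed.

Lemma mset_swap23 a b d : mset [:: a; b; d] = mset [:: a; d; b].
Proof. by apply/ffunP => x; rewrite !ffunE /=; congr addn; rewrite addnCA. Qed.

End Swap.

(** * Assembling local states *)

Lemma sum_cls (f : cls -> nat) :
  \sum_x f x = f Free + (f L01 + (f L02 + (f L12 + (f Star + (f Full + f Bad))))).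
Proof.
rewrite (bigD1 Free) // (bigD1 L01) // (bigD1 L02) // (bigD1 L12) // (bigD1 Star) //.
rewrite (bigD1 Full) // (bigD1 Bad) //= [X in _ + (_ + (_ + (_ + (_ + (_ + (_ + X))))))]big1 ?addn0 //.
by case.
Qed.

(** A global state [m] is cut into its restrictions to the fibres of [ka], one for
each component [r]. Local states carry a class [g] and a weight [w]; both are
multiplicative. The value [b0] stands for the absence of data, so that a state of
the components [A] is one that vanishes elsewhere. *)
Section Assembly.
Variables (X B K : finType) (b0 : B) (ka : X -> K).
Variables (g : K -> {ffun X -> B} -> cls) (w : K -> {ffun X -> B} -> nat).
Implicit Types (m n : {ffun X -> B}) (A : {set K}) (r : K).

Definition sup A m := [forall x, (m x != b0) ==> (ka x \in A)].
Definition cut m r : {ffun X -> B} := [ffun x => if ka x == r then m x else b0].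

Definition gsum A x :=
  \sum_(m | sup A m && (\big[mulc/Free]_(r in A) g r (cut m r) == x)) \prod_(r in A) w r (cut m r).

Definition lsum r x := \sum_(m | sup [set r] m && (g r m == x)) w r m.

Definition conv (a b : cls -> nat) x := \sum_y \sum_(z | mulc y z == x) a y * b z.

Lemma supP A m : reflect (forall x, ka x \notin A -> m x = b0) (sup A m).
Proof.
apply: (iffP forallP) => h x.
  by move=> nA; apply/eqP; apply: contraNT nA => ne; apply: (implyP (h x)).
by apply/implyP; apply: contraR => /h/eqP.
Qed.

Definition merge r (p : {ffun X -> B} * {ffun X -> B}) : {ffun X -> B} :=
  [ffun x => if ka x == r then p.2 x else p.1 x].
Definition unmerge r m : {ffun X -> B} * {ffun X -> B} :=
  ([ffun x => if ka x == r then b0 else m x], cut m r).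

(** A state over [r |: A] is a pair of a state over [A] and one over [r]. *)
Lemma gsumU r A x : r \notin A -> gsum (r |: A) x = conv (gsum A) (lsum r) x.
Proof.
move=> rA; rewrite /conv.
pose G (p : {ffun X -> B} * {ffun X -> B}) :=
  mulc (\big[mulc/Free]_(i in A) g i (cut p.1 i)) (g r p.2).
have -> : \sum_y \sum_(z | mulc y z == x) gsum A y * lsum r z =
    \sum_(p : {ffun X -> B} * {ffun X -> B} | [&& sup A p.1, sup [set r] p.2 & G p == x])
      (\prod_(i in A) w i (cut p.1 i)) * w r p.2.
  rewrite (partition_big (fun p : {ffun X -> B} * {ffun X -> B} =>
    (\big[mulc/Free]_(i in A) g i (cut p.1 i), g r p.2)) (fun yz => mulc yz.1 yz.2 == x)) /=; last first.
    by move=> p /and3P[].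
  rewrite pair_big_dep /=; apply: eq_bigr => -[y z] /= /eqP yz.
  rewrite /gsum /lsum big_distrlr /= pair_big_dep /=; apply: eq_bigl => -[m n] /=.
  rewrite xpair_eqE /G /=.
  case: (sup A m); case: (sup [set r] n) => //=; rewrite ?andbF //.
  case: eqP => [->|_]; rewrite ?andbF //=; case: eqP => [->|_]; rewrite ?andbF //.
  by rewrite yz eqxx.
rewrite /gsum (reindex_onto (merge r) (unmerge r)); last first.
  move=> m _; apply/ffunP => y; rewrite !ffunE /=; by case: (ka y == r).
have mk p : sup A p.1 -> sup [set r] p.2 ->
    (forall i, i \in A -> cut (merge r p) i = cut p.1 i) /\ cut (merge r p) r = p.2.
  move=> /supP s1 /supP s2; split=> [i iA|].
    apply/ffunP => y; rewrite !ffunE; case: eqP => // eqi.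
    by case: eqP => // eqr; rewrite -eqi eqr in iA; rewrite iA in rA.
  apply/ffunP => y; rewrite !ffunE; case: eqP => // ne.
  by rewrite s2 // inE; apply/eqP.
have eqP1 p : sup (r |: A) (merge r p) && (unmerge r (merge r p) == p) =
    sup A p.1 && sup [set r] p.2.
  case: p => m n /=; apply/andP/andP => [[/supP s /eqP[em en]]|[s1 s2]].
    split; apply/supP => y yA.
      rewrite -em !ffunE /=; case: eqP => // ne; have := s y; rewrite !ffunE /=.
      by case: eqP => // _; apply; rewrite !inE negb_or yA andbT; apply/eqP.
    by rewrite -en ffunE; case: eqP yA => // ->; rewrite inE eqxx.
  split.
    apply/supP => y; rewrite !inE negb_or => /andP[ne yA]; rewrite ffunE (negbTE ne) /=.
    by move/supP: s1; apply.
  have [_ e2] := mk (m, n) s1 s2; apply/eqP; rewrite /unmerge e2; congr pair.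
  apply/ffunP => y; rewrite !ffunE /=; case: eqP => // er.
  by move/supP: s1 => -> //; rewrite er.
rewrite [LHS]big_mkcond [RHS]big_mkcond; apply: eq_bigr => p _.
have := eqP1 p; case: (sup (r |: A) _) => /=; last first.
  by rewrite andbA => <-.
case: (unmerge _ _ == p) => /=; rewrite ?andbT ?andbF; last by rewrite andbA => <-.
move=> /esym/andP[s1 s2]; rewrite s1 s2 /=; have [e1 e2] := mk p s1 s2.
have gA : \big[mulc/Free]_(i in A) g i (cut (merge r p) i) = \big[mulc/Free]_(i in A) g i (cut p.1 i).
  by apply: eq_bigr => i /e1 ->.
have wA : \prod_(i in A) w i (cut (merge r p) i) = \prod_(i in A) w i (cut p.1 i).
  by apply: eq_bigr => i /e1 ->.
by rewrite big_setU1 //= big_setU1 //= e2 gA wA /G mulcC [w r _ * _]mulnC.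
Qed.

Lemma gsum0 x : gsum set0 x = (x == Free).
Proof.
rewrite /gsum; case: eqVneq => [->|ne]; last first.
  by apply: big1 => m; rewrite big_set0 eq_sym (negbTE ne) andbF.
rewrite (bigD1 [ffun=> b0]) /=; last first.
  by rewrite big_set0 eqxx andbT; apply/supP => y; rewrite ffunE.
rewrite big_set0 big1 // => m /andP[/andP[/supP s _]] /eqP[]; apply/ffunP => y.
by rewrite ffunE s // inE.
Qed.

End Assembly.

(** How the counts on the side of edges compare to those on the side of marks, where
[Star] is an additional copy of [L12]. *)
Definition matched (a b : cls -> nat) :=
  [/\ a Free = b Free, a L01 = b L01, a L02 = b L02, a L12 = b L12 & a Full = b Full]
  /\ (a Star = 0 /\ b Star = a L12).

Lemma convE a b : [/\ conv a b Free = a Free * b Free,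
  conv a b L01 = a Free * b L01 + a L01 * b Free,
  conv a b L02 = a Free * b L02 + a L02 * b Free,
  conv a b L12 = a Free * b L12 + a L12 * b Free &
  conv a b Star = a Free * b Star + a Star * b Free] /\
  conv a b Full = a Free * b Full + a Full * b Free + a L01 * b L02 + a L02 * b L01
    + a L01 * b L12 + a L12 * b L01 + a L02 * b L12 + a L12 * b L02.
Proof.
rewrite /conv; split; [split|]; rewrite sum_cls;
do 7!(rewrite big_mkcond sum_cls /=); rewrite ?add0n ?addn0 //; lia.
Qed.

(** The relation survives convolution because [Star] is only obtained by combining
[Star] with free states, exactly as [L12] is obtained from [L12]; all other products
of [Star] are [Bad]. *)
Lemma matched_conv a a' b b' : matched a a' -> matched b b' -> matched (conv a b) (conv a' b').
Proof.
case=> -[a1 a2 a3 a4 a5] [a6 a7] [[b1 b2 b3 b4 b5] [b6 b7]].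
have [[c1 c2 c3 c4 c5] c6] := convE a b; have [[d1 d2 d3 d4 d5] d6] := convE a' b'.
split; [split|split].
- by rewrite c1 d1 a1 b1.
- by rewrite c2 d2 a1 b1 a2 b2.
- by rewrite c3 d3 a1 b1 a3 b3.
- by rewrite c4 d4 a1 b1 a4 b4.
- by rewrite c6 d6 a1 a2 a3 a4 a5 b1 b2 b3 b4 b5.
- by rewrite c5 a6 b6 muln0.
by rewrite d5 c4 a7 b7 -a1 -b1.
Qed.

Lemma gsum_matched (X B X' B' K : finType) (b0 : B) (b0' : B') (ka : X -> K) (ka' : X' -> K)
    g w g' w' (A : {set K}) :
  (forall r, r \in A -> matched (lsum b0 ka g w r) (lsum b0' ka' g' w' r)) ->
  matched (gsum b0 ka g w A) (gsum b0' ka' g' w' A).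
Proof.
have [k] := ubnP #|A|; elim: k A => // k IH A; rewrite ltnS => le h.
have [->|/set0Pn[r rA]] := eqVneq A set0; first by rewrite /matched !gsum0.
have eA : A = r |: (A :\ r) by rewrite setD1K.
have rA' : r \notin A :\ r by rewrite !inE eqxx.
have mA : matched (gsum b0 ka g w (A :\ r)) (gsum b0' ka' g' w' (A :\ r)).
  apply: IH; first by rewrite (cardsD1 r) rA in le.
  by move=> i; rewrite inE => /andP[_ /h].
have mr := matched_conv mA (h r rA).
rewrite eA; case: mr => -[m1 m2 m3 m4 m5] [m6 m7].
by split; [split|split]; rewrite !gsumU.
Qed.

(** The class of a set of vertices of distinct colours, given the colours present. *)
Definition hued b0 b1 b2 :=
  match b0, b1, b2 with
  | true, true, true => Full
  | true, true, false => L01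
  | true, false, true => L02
  | false, true, true => L12
  | _, _, _ => Free
  end.

Section Hued.
Variable H : color -> bool.
Let b := hued (H Col0) (H Col1) (H Col2).

Lemma hued_small : (forall k l, k != l -> H k -> H l = false) -> b = Free.
Proof.
rewrite /b => no; case h0: (H Col0); first by rewrite (no Col0 Col1) ?(no Col0 Col2).
by case h1: (H Col1); first by rewrite (no Col1 Col2).
Qed.

Lemma hued_Free k l : b = Free -> H k -> H l -> k = l.
Proof. by rewrite /b; case: k; case: l; case: (H Col0); case: (H Col1); case: (H Col2). Qed.

Lemma hued_old k l : H k -> H l -> mulc b (link k l) = Bad.
Proof. by rewrite /b; case: k; case: l; case: (H Col0); case: (H Col1); case: (H Col2). Qed.

Lemma hued_new k l : H k -> ~~ H l ->
  hued ((l == Col0) || H Col0) ((l == Col1) || H Col1) ((l == Col2) || H Col2) = mulc b (link k l).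
Proof. by rewrite /b; case: k; case: l => //=; case: (H Col0); case: (H Col1); case: (H Col2). Qed.

Lemma hued_link : rk b = 1 -> exists k l m, [/\ H k, H l, clt k l /\ link k l = b
  & H m = false /\ forall x, [|| x == k, x == l | x == m]].
Proof.
rewrite /b; case h0: (H Col0); case h1: (H Col1); case h2: (H Col2) => // _.
- by exists Col0, Col1, Col2; split=> //; split=> // -[].
- by exists Col0, Col2, Col1; split=> //; split=> // -[].
- by exists Col1, Col2, Col0; split=> //; split=> // -[].
Qed.

Lemma hued_full : b = Full -> forall k, H k.
Proof.
by rewrite /b; case h0: (H Col0); case h1: (H Col1); case h2: (H Col2) => // _ [].
Qed.

Lemma hued_star : b != Star.
Proof. by rewrite /b; case: (H Col0); case: (H Col1); case: (H Col2). Qed.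

End Hued.

(** The form in which states of a given class are counted: their weight is one on
the image of an injective parametrisation, and zero elsewhere. *)
Lemma sum_image (T1 T2 : finType) (P : pred T2) (w : T2 -> nat) (D : {set T1}) (h : T1 -> T2) :
  {in D &, injective h} -> (forall x, x \in D -> P (h x)) ->
  (forall y, P y -> w y = (y \in h @: D)) -> \sum_(y | P y) w y = #|D|.
Proof.
move=> inj hP wE; rewrite (eq_bigr (fun y => (y \in h @: D) : nat)) //.
rewrite -(card_in_imset inj) -sum1_card big_mkcond [RHS]big_mkcond; apply: eq_bigr => y _.
case: ifP => [_|nP]; first by case: (y \in _).
by case: imsetP => // -[x xD yE]; rewrite yE hP in nP.
Qed.

(** * Forests and their paths *)

(** A multigraph with oriented edges and coloured vertices; the orientation only
serves to name the ends of an edge. *)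
Section ColouredGraph.
Variables (V E : finType) (src tgt : E -> V) (col : V -> color).
Implicit Types (M N : {ffun E -> nat}) (I J F : {set E}) (e f : E) (u v w s t : V) (U : {set V}).

Definition adj I : rel V := fun x y =>
  [exists e in I, ((src e == x) && (tgt e == y)) || ((src e == y) && (tgt e == x))].

Definition conn I := connect (adj I).

Lemma adj_sym I : symmetric (adj I).
Proof. by move=> x y; apply: eq_existsb => e; rewrite orbC. Qed.

Lemma conn_sym I : symmetric (conn I).
Proof. exact/sym_connect_sym/adj_sym. Qed.

Lemma conn_refl I x : conn I x x. Proof. exact: connect0. Qed.
Hint Resolve conn_refl : core.

Lemma conn_trans I y x z : conn I x y -> conn I y z -> conn I x z.
Proof. exact: connect_trans. Qed.

Lemma conn_edge I e : e \in I -> conn I (src e) (tgt e).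
Proof. by move=> eI; apply/connect1/existsP; exists e; rewrite eI !eqxx. Qed.

(** To transport a property along a connection, it is enough that the ends of each
edge agree on it. *)
Lemma conn_ind I (P : V -> Prop) x y :
  (forall e, e \in I -> P (src e) <-> P (tgt e)) -> conn I x y -> P x -> P y.
Proof.
move=> clP /connectP[p pth ->]; elim: p x pth => //= z p IH x /andP[xz pth] Px.
apply: (IH _ pth); have /existsP[e /andP[eI]] := xz.
by case/orP=> /andP[/eqP eq1 /eqP eq2]; move: Px; rewrite -eq1 -eq2;
  case: (clP e eI).
Qed.

Lemma conn_sub I J x y : I \subset J -> conn I x y -> conn J x y.
Proof.
move=> /subsetP sIJ cxy; apply: (conn_ind (P := conn J x)) cxy _ => // e /sIJ eJ.
have ce := conn_edge eJ.
by split => cx; apply: conn_trans cx _; rewrite // conn_sym.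
Qed.

Lemma conn_add I e x y : conn (e |: I) x y ->
  [\/ conn I x y, conn I x (src e) /\ conn I (tgt e) y
    | conn I x (tgt e) /\ conn I (src e) y].
Proof.
move=> c; apply: (conn_ind (P := fun y => [\/ conn I x y,
  conn I x (src e) /\ conn I (tgt e) y | conn I x (tgt e) /\ conn I (src e) y]))
  c _; last by constructor 1.
move=> f; rewrite !inE => /orP[/eqP->|fI].
  split=> -[c|[c1 c2]|[c1 c2]].
  - by constructor 2.
  - by constructor 2.
  - by constructor 1.
  - by constructor 3.
  - by constructor 1.
  - by constructor 3.
have cf := conn_edge fI; have cf' : conn I (tgt f) (src f) by rewrite conn_sym.
split=> -[c|[c1 c2]|[c1 c2]];
  by [constructor 1; apply: conn_trans c _ |
      constructor 2; split=> //; apply: conn_trans c2 _ |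
      constructor 3; split=> //; apply: conn_trans c2 _].
Qed.

(** A set of edges is a forest when each of its edges is a bridge; unlike the
absence of cycles, this involves no walk. *)
Definition forest I := [forall e in I, ~~ conn (I :\ e) (src e) (tgt e)].

Lemma forestP I :
  reflect (forall e, e \in I -> ~~ conn (I :\ e) (src e) (tgt e)) (forest I).
Proof. exact: forall_inP. Qed.

Lemma forest_sub I J : I \subset J -> forest J -> forest I.
Proof.
move=> sIJ /forestP fJ; apply/forestP => e eI.
apply: contra (fJ e (subsetP sIJ _ eI)); apply: conn_sub; exact: setSD.
Qed.

Lemma forest0 : forest set0.
Proof. by apply/forestP => e; rewrite inE. Qed.

Lemma forest_nconn I e : forest (e |: I) -> e \notin I -> ~~ conn I (src e) (tgt e).
Proof. by move=> /forestP/(_ e (setU11 _ _)) + eI; rewrite setU1K. Qed.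

Lemma forest_add I e : forest I -> ~~ conn I (src e) (tgt e) -> forest (e |: I).
Proof.
move=> fI nc; have eI : e \notin I by apply: contra nc; apply: conn_edge.
apply/forestP => f; rewrite !inE => /orP[/eqP->|fIn]; first by rewrite setU1K.
have nef : e != f by apply: contraNneq eI => ->.
have -> : (e |: I) :\ f = e |: (I :\ f).
  by apply/setP => g; rewrite !inE; case: (eqVneq g e) => // ->; rewrite nef.
have sub : forall x y, conn (I :\ f) x y -> conn I x y.
  by move=> x y; apply: conn_sub; apply: subD1set.
apply/negP => /conn_add[c|[c1 c2]|[c1 c2]].
- by move/forestP: fI => /(_ f fIn); rewrite c.
- case/negP: nc; apply: (conn_trans (y := src f)); first by rewrite conn_sym sub.
  apply: (conn_trans (conn_edge fIn)); rewrite conn_sym; exact: sub.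
- case/negP: nc; apply: (conn_trans (sub _ _ c2)); rewrite conn_sym.
  apply: (conn_trans (y := src f)); last exact: conn_edge.
  by rewrite conn_sym sub.
Qed.

Lemma forest_addE I e : e \notin I ->
  forest (e |: I) = forest I && ~~ conn I (src e) (tgt e).
Proof.
move=> eI; apply/idP/andP => [fI|[fI nc]]; last exact: forest_add.
by split; [apply: forest_sub fI; apply: subsetUr|apply: forest_nconn].
Qed.

Definition rt I x := root (adj I) x.

Lemma rt_eq I x y : (rt I x == rt I y) = conn I x y.
Proof. exact/root_connect/conn_sym. Qed.

Lemma conn_rt I x : conn I x (rt I x). Proof. exact: connect_root. Qed.

Lemma rt_id I x : rt I (rt I x) = rt I x.
Proof. by apply/eqP; rewrite rt_eq conn_sym conn_rt. Qed.

Lemma rtP I x y : conn I x y -> rt I x = rt I y.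
Proof. by move=> c; apply/eqP; rewrite rt_eq. Qed.

Section Tree.
Variable F : {set E}.
Hypothesis fF : forest F.

(** The edges of the path of [F] joining [u] to [w], that is, those whose
removal disconnects [u] from [w]. *)
Definition sep I e u w := conn I u w && ~~ conn (I :\ e) u w.

Lemma sep_sym I e u w : sep I e u w = sep I e w u.
Proof. by rewrite /sep conn_sym (conn_sym (_ :\ _)). Qed.

Lemma sep_conn I e u w : sep I e u w -> conn I u w. Proof. by case/andP. Qed.

Lemma sep_in I e u w : sep I e u w -> e \in I.
Proof. by case/andP=> c; apply: contraNT => eI; rewrite (setDidPl _) // disjoint_sym disjoints1. Qed.

Lemma sep_refl I e u : sep I e u u = false.
Proof. by rewrite /sep !conn_refl. Qed.

Lemma sep_neq I e u w : sep I e u w -> u != w.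
Proof. by apply: contraTneq => ->; rewrite sep_refl. Qed.

Lemma side e u : e \in F -> conn F u (src e) ->
  conn (F :\ e) u (src e) != conn (F :\ e) u (tgt e).
Proof.
move=> eF; have /forestP/(_ e eF) nc := fF.
rewrite -{1}(setD1K eF) => /conn_add.
case cs: (conn _ u (src e)); case ct: (conn _ u (tgt e)) => //.
  by case/negP: nc; apply: (conn_trans (y := u)) ct; rewrite conn_sym.
by case=> [|[]|[]].
Qed.

Lemma conn_tgt I e u : e \in I -> conn I u (tgt e) = conn I u (src e).
Proof.
move=> eI; apply/idP/idP => c; apply: conn_trans c _; last exact: conn_edge.
by rewrite conn_sym conn_edge.
Qed.

Lemma sep_conn_src I e u w : sep I e u w -> conn I u (src e).
Proof.
move=> s; have eI := sep_in s; case/andP: s => + nc.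
rewrite -{1}(setD1K eI) => /conn_add[c|[c _]|[c _]].
- by rewrite c in nc.
- exact: conn_sub (subD1set _ _) c.
- rewrite -conn_tgt //; exact: conn_sub (subD1set _ _) c.
Qed.

Lemma conn_nsep I e u w : conn I u w -> conn (I :\ e) u w = ~~ sep I e u w.
Proof. by rewrite /sep => ->; rewrite negbK. Qed.

(** An edge cuts a component in two parts only, so that separation by [e] is a sum
modulo two along the way. *)
Lemma sep_xor e u v w : conn F u v -> conn F v w ->
  sep F e u w = sep F e u v (+) sep F e v w.
Proof.
move=> cuv cvw; have cuw := conn_trans cuv cvw.
rewrite -[sep F e u w]negbK -[sep F e u v]negbK -[sep F e v w]negbK.
rewrite -!conn_nsep //.
case cuv': (conn (F :\ e) u v); case cvw': (conn (F :\ e) v w) => /=.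
- by apply/negbTE; rewrite negbK; apply: conn_trans cvw'.
- apply/negP => c; move/negP: cvw'; apply; apply: conn_trans c.
  by rewrite conn_sym.
- apply/negP => c; move/negP: cuv'; apply; apply: conn_trans c _.
  by rewrite conn_sym.
have suv : sep F e u v by rewrite /sep cuv cuv'.
have cs := sep_conn_src suv.
have cs' : conn F v (src e) by apply: (conn_trans (y := u)); rewrite // conn_sym.
have cs'' : conn F w (src e) by apply: (conn_trans (y := v)); rewrite // conn_sym.
have eF := sep_in suv.
have := side eF cs; have := side eF cs'; have := side eF cs''.
have tr a b z : conn (F :\ e) b a -> conn (F :\ e) z a -> conn (F :\ e) b z.
  by move=> c1 c2; apply: conn_trans c1 _; rewrite conn_sym.
case us: (conn _ u (src e)); case ut: (conn _ u (tgt e)) => //;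
case vs: (conn _ v (src e)); case vt: (conn _ v (tgt e)) => //;
case ws: (conn _ w (src e)); case wt: (conn _ w (tgt e)) => //= _ _ _;
first [ by move: cuv'; rewrite (tr _ _ _ us vs)
  | by move: cuv'; rewrite (tr _ _ _ ut vt)
  | by move: cvw'; rewrite (tr _ _ _ vs ws)
  | by move: cvw'; rewrite (tr _ _ _ vt wt)
  | by rewrite (tr _ _ _ us ws) | by rewrite (tr _ _ _ ut wt)].
Qed.

Lemma sep_edge e f : e \in F -> sep F f (src e) (tgt e) = (f == e).
Proof.
move=> eF; rewrite /sep conn_edge //=; case: eqVneq => [->|ne].
  exact: (forestP _ fF).
by apply/negbTE; rewrite negbK; apply: conn_edge; rewrite !inE eq_sym ne.
Qed.

End Tree.

(** If [e] separated [u] from [w] in [I] but not in [J], the ends of [e] would be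
connected in [J] without it. *)
Lemma sep_stable I J e u w : forest J -> I \subset J -> conn I u w ->
  sep I e u w = sep J e u w.
Proof.
move=> fJ sIJ c; have cJ := conn_sub sIJ c; rewrite /sep c cJ /=; congr (~~ _).
apply/idP/idP; first exact/conn_sub/setSD.
apply: contraLR => nc; have s : sep I e u w by rewrite /sep c.
have eI := sep_in s; have eJ := subsetP sIJ _ eI.
have fI := forest_sub sIJ fJ.
have cs := sep_conn_src s.
have cs' : conn I w (src e) by apply: (conn_trans (y := u)); rewrite // conn_sym.
have sub x y : conn (I :\ e) x y -> conn (J :\ e) x y by apply/conn_sub/setSD.
apply: contraL (forestP _ fJ e eJ) => cuw; rewrite negbK.
have /negP nc' := nc.
case: (boolP (conn (I :\ e) u (src e))) (side fI eI cs) => [us _|us ut];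
  case: (boolP (conn (I :\ e) w (src e))) (side fI eI cs') => [ws _|ws wt].
- by case: nc'; apply: conn_trans us _; rewrite conn_sym.
- rewrite eq_sym eqbF_neg negbK in wt.
  apply: (conn_trans (y := w)); last exact: sub.
  by apply: conn_trans cuw; rewrite conn_sym sub.
- rewrite eq_sym eqbF_neg negbK in ut.
  apply: (conn_trans (y := u)); last exact: sub.
  by rewrite conn_sym in cuw; apply: conn_trans cuw; rewrite conn_sym sub.
rewrite eq_sym eqbF_neg negbK in ut; rewrite eq_sym eqbF_neg negbK in wt.
by case: nc'; apply: conn_trans ut _; rewrite conn_sym.
Qed.

Definition inc e v := (v == src e) || (v == tgt e).

(** The ends of [e] as seen from [u]. *)
Definition near F u e := if sep F e u (src e) then tgt e else src e.
Definition far F u e := if sep F e u (src e) then src e else tgt e.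

Definition first F u w e := sep F e u w && inc e u.

(** Paths are handled through the edges that separate, so that no walk has to be
chosen. *)
Definition onpath F u w v :=
  conn F u v && [forall e, sep F e u v ==> sep F e u w].

Lemma inc_near F u e : inc e (near F u e).
Proof. by rewrite /inc /near; case: ifP; rewrite eqxx ?orbT. Qed.

Lemma inc_far F u e : inc e (far F u e).
Proof. by rewrite /inc /far; case: ifP; rewrite eqxx ?orbT. Qed.

Lemma inc_case F u e v : inc e v -> v = near F u e \/ v = far F u e.
Proof. by rewrite /inc /near /far; case: ifP => _ /orP[/eqP->|/eqP->]; auto. Qed.

Section OneForest.
Variable F : {set E}.
Hypothesis fF : forest F.
Local Notation near := (near F).
Local Notation far := (far F).
Local Notation first := (first F).
Local Notation onpath := (onpath F).

Lemma inc_conn e u v : e \in F -> inc e v -> conn F u v = conn F u (src e).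
Proof. by move=> eF /orP[/eqP->|/eqP->] //; rewrite conn_tgt. Qed.

Lemma sep_inc_conn e u w v : sep F e u w -> inc e v -> conn F u v.
Proof. by move=> s i; rewrite (inc_conn _ (sep_in s) i); apply: sep_conn_src s. Qed.

Lemma nfP e u : e \in F -> conn F u (src e) ->
  sep F e u (near u e) = false /\ sep F e u (far u e).
Proof.
move=> eF cs; rewrite /near /far; case s: (sep F e u (src e)) => //.
  by rewrite (sep_xor fF e cs (conn_edge eF)) s sep_edge // eqxx.
by rewrite (sep_xor fF e cs (conn_edge eF)) s sep_edge // eqxx.
Qed.

Lemma sep_ends e f u : e \in F -> sep F f (near u e) (far u e) = (f == e).
Proof.
move=> eF; rewrite /near /far; case: ifP => _; first by rewrite sep_sym sep_edge.
exact: sep_edge.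
Qed.

Lemma sep_near e u w : sep F e u w -> sep F e u (near u e) = false.
Proof. by move=> s; case: (nfP (sep_in s) (sep_conn_src s)). Qed.

Lemma sep_far e u w : sep F e u w -> sep F e u (far u e).
Proof. by move=> s; case: (nfP (sep_in s) (sep_conn_src s)). Qed.

Lemma nearE e u v : inc e v -> e \in F -> conn F u v -> sep F e u v = false ->
  v = near u e.
Proof.
move=> i eF; rewrite (inc_conn _ eF i) => c; case: (inc_case F u i) => // -> s.
by case: (nfP eF c); rewrite s.
Qed.

Lemma farE e u v : inc e v -> sep F e u v -> v = far u e.
Proof.
move=> i s; case: (inc_case F u i) => // v_near.
by move: (s); rewrite v_near (sep_near s).
Qed.

(** Reversing a path exchanges the two ends of each of its edges. *)
Lemma far_sym e u w : sep F e u w -> far w e = near u e.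
Proof.
move=> s; apply/esym/farE; first exact: inc_near.
rewrite (sep_xor fF _ (v := u)) ?(sep_near s) ?addbF; first by rewrite sep_sym.
  by rewrite conn_sym (sep_conn s).
exact: sep_inc_conn s (inc_near _ _ _).
Qed.

Lemma near_move e u w : conn F u w -> e \in F -> conn F u (src e) ->
  ~~ sep F e u w -> near w e = near u e.
Proof.
move=> c eF cs ns; apply/esym/nearE => //; first exact: inc_near.
  apply: (conn_trans (y := u)); first by rewrite conn_sym.
  by rewrite (inc_conn _ eF) // inc_near.
rewrite (sep_xor fF _ (v := u)); last first.
- by rewrite (inc_conn _ eF) // inc_near.
- by rewrite conn_sym.
by rewrite sep_sym (negbTE ns); case: (nfP eF cs).
Qed.

(** Cutting a path at one of its edges. The parts are disjoint because each survives
the removal of [e], on either side of it. *)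
Lemma sep_cut e f u w : sep F e u w ->
  sep F f u w = [|| sep F f u (near u e), f == e | sep F f (far u e) w]
  /\ ~~ (sep F f u (near u e) && sep F f (far u e) w).
Proof.
move=> s; have eF := sep_in s; have cs := sep_conn_src s.
have cn : conn F u (near u e) by rewrite (inc_conn _ eF) ?inc_near.
have cf : conn F u (far u e) by rewrite (inc_conn _ eF) ?inc_far.
have cfw : conn F (far u e) w.
  by apply: (conn_trans (y := u)); [rewrite conn_sym | apply: sep_conn s].
have cnf : conn F (near u e) (far u e).
  by apply: (conn_trans (y := u)); rewrite // conn_sym.
have sn := sep_near s; have sf := sep_far s.
have sfw : sep F e (far u e) w = false.
  by have := sep_xor fF e cf cfw; rewrite s sf; case: (sep _ _ _ w).
have excl g : ~~ (sep F g u (near u e) && sep F g (far u e) w).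
  apply/negP => /andP[s1 s2].
  have c1 : conn (F :\ e) u (near u e) by rewrite conn_nsep // sn.
  have c2 : conn (F :\ e) (far u e) w by rewrite conn_nsep // sfw.
  rewrite -(sep_stable _ fF (subD1set _ _) c1) in s1.
  rewrite -(sep_stable _ fF (subD1set _ _) c2) in s2.
  have c3 := sep_conn_src s1; have c4 := sep_conn_src s2.
  case/andP: sf => _ /negP[]; apply: conn_trans c3 _.
  by rewrite conn_sym.
split; last exact: excl.
rewrite (sep_xor fF _ cn (conn_trans cnf cfw)) (sep_xor fF _ cnf cfw) sep_ends //.
case: eqVneq (excl f) => [->|_]; first by rewrite sn sfw.
by case: (sep F f u _); case: (sep F f _ w).
Qed.

Lemma sep_far_w e u w : sep F e u w -> sep F e (far u e) w = false.
Proof.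
move=> s; have c := sep_inc_conn s (inc_far F u e).
have c' : conn F (far u e) w.
  by apply: (conn_trans (y := u)); [rewrite conn_sym | apply: sep_conn s].
by have := sep_xor fF e c c'; rewrite s (sep_far s); case: (sep F e _ w).
Qed.

Lemma onpath_near e u w : sep F e u w -> onpath u w (near u e).
Proof.
move=> s; rewrite /onpath (sep_inc_conn s) ?inc_near //=.
by apply/forallP => f; apply/implyP => sf; case: (sep_cut f s) => ->; rewrite sf.
Qed.

Lemma onpath_far e u w : sep F e u w -> onpath u w (far u e).
Proof.
move=> s; rewrite /onpath (sep_inc_conn s) ?inc_far //=.
apply/forallP => f; apply/implyP => sf.
have cn := sep_inc_conn s (inc_near F u e); have cf := sep_inc_conn s (inc_far F u e).
case: (sep_cut f s) => ->; move: sf.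
rewrite (sep_xor fF _ cn); last by apply: (conn_trans (y := u)); rewrite // conn_sym.
by rewrite sep_ends ?(sep_in s) //; case: (sep F f u _) => //= ->; rewrite ?orbT.
Qed.

Lemma onpath_inc e u w v : sep F e u w -> inc e v -> onpath u w v.
Proof.
by move=> s /(inc_case F u)[->|->]; [apply: onpath_near|apply: onpath_far].
Qed.

Lemma onpathP u w v e : onpath u w v -> sep F e u v -> sep F e u w.
Proof. by case/andP=> _ /forallP/(_ e)/implyP. Qed.

Lemma onpath_sym u w v : conn F u w -> onpath u w v = onpath w u v.
Proof.
move=> c; wlog suff: u w c / onpath u w v -> onpath w u v.
  by move=> h; apply/idP/idP; apply: h; rewrite // conn_sym.
move=> o; case/andP: (o) => cuv _.
have cvw : conn F v w by apply: (conn_trans (y := u)); rewrite // conn_sym.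
rewrite /onpath conn_sym cvw; apply/forallP => e; apply/implyP => s.
have := sep_xor fF e cuv cvw; rewrite [sep F e v w]sep_sym s.
by rewrite [sep F e w u]sep_sym; case suv: (sep _ _ u v) => // _; exact: onpathP o suv.
Qed.

Lemma onpathP' u w v e : conn F u w -> onpath u w v -> sep F e v w -> sep F e u w.
Proof.
move=> c; rewrite onpath_sym // => o s; rewrite sep_sym.
by apply: (onpathP o); rewrite sep_sym.
Qed.

Lemma onpath_excl u w v e : conn F u w -> onpath u w v ->
  sep F e u w = sep F e u v || sep F e v w /\ ~~ (sep F e u v && sep F e v w).
Proof.
move=> c o; have cuv := proj1 (andP o).
have cvw : conn F v w by apply: (conn_trans (y := u)); rewrite // conn_sym.
have := @onpathP _ _ _ e o; have := @onpathP' _ _ _ e c o.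
rewrite (sep_xor fF e cuv cvw).
by case: (sep F e u v); case: (sep F e v w) => //= h1 h2; have := h1 isT.
Qed.

(** A walk without repeated vertices leaves [u] by an edge that it does not use
again; in a forest that edge is a separating one. *)
Lemma first_ex u w : conn F u w -> u != w -> exists e, first u w e.
Proof.
move=> /connectP[p0 pth0 ->]; case/shortenP: pth0 => p pth up _ {p0}.
case: p pth up => [|x p] /=; first by rewrite eqxx.
case/andP=> /existsP[e /andP[eF ends]] pth /andP[up _] _; exists e.
have ie : inc e u by rewrite /inc; case/orP: ends => /andP[/eqP-> /eqP->]; rewrite eqxx ?orbT.
have cx : conn (F :\ e) x (last x p).
  apply/connectP; exists p => //; elim: p x pth up {ends} => //= y p IH x.
  case/andP=> /existsP[f /andP[fF' endsf]] pth.
  rewrite !inE !negb_or => /and3P[ux uy up].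
  rewrite IH ?inE ?negb_or ?uy // andbT; apply/existsP; exists f.
  rewrite !inE fF' endsf !andbT; apply/negP => /eqP fe; rewrite fe in endsf.
  by move: ie; rewrite /inc; case/orP: endsf => /andP[/eqP-> /eqP->];
    rewrite ?(negbTE ux) ?(negbTE uy).
have cux : conn F u x by apply: connect1; apply/existsP; exists e; rewrite eF.
rewrite /first ie andbT /sep (conn_trans cux) ?(conn_sub (subD1set _ _) cx) //=.
apply/negP => c; have := forestP _ fF e eF; case/negP.
have c' : conn (F :\ e) u x by apply: conn_trans c _; rewrite conn_sym.
by case/orP: ends => /andP[/eqP-> /eqP->]; rewrite // conn_sym.
Qed.

Lemma first_near u w e : first u w e -> near u e = u.
Proof. by case/andP=> s i; apply/esym/nearE; rewrite ?sep_refl ?conn_refl // (sep_in s). Qed.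

Lemma first_uniq u w e f : first u w e -> first u w f -> e = f.
Proof.
move=> fe ff; apply/eqP; case: eqVneq => // ne.
have [se ie] := andP fe; have [sf i_f] := andP ff.
have [] := sep_cut e sf; rewrite (first_near ff) sep_refl se (negbTE ne) /= => /esym s1 _.
have [] := sep_cut f se; rewrite (first_near fe) sep_refl sf eq_sym (negbTE ne) /= => /esym s2 _.
have [] := sep_cut e s2.
have c1 : conn F (far u f) u.
  by rewrite conn_sym; apply: sep_inc_conn sf (inc_far F u f).
have := sep_far_w se; have [] := sep_cut f s1.
(* on the path from the far end of [f], the edge [e] is entered from [u] *)
have nu : near (far u f) e = u.
  apply/esym/nearE; rewrite ?(sep_in se) //.
  have := sep_ends e u (sep_in sf); rewrite (first_near ff) (negbTE ne) => <-.
  by rewrite sep_sym.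
rewrite nu.
have -> : sep F f (far u f) u by rewrite sep_sym; apply: sep_far sf.
by rewrite /= => /esym h; rewrite (sep_far_w sf) in h.
Qed.

Lemma first_onpath u w v e : onpath u w v -> first u v e -> first u w e.
Proof. by move=> o /andP[s i]; rewrite /first (onpathP o s). Qed.

Lemma first_far e u w : sep F e u w -> first (far u e) u e.
Proof. by move=> s; rewrite /first inc_far sep_sym (sep_far s). Qed.

Lemma far_inj e f u w w' : sep F e u w -> sep F f u w' -> far u e = far u f -> e = f.
Proof. by move=> se sf eq; apply: first_uniq (first_far se) _; rewrite eq; apply: first_far sf. Qed.

(** After [e], the path to [v] stays on one side of [e], and the path to [w] on the
other. *)
Lemma branch u v w e f : conn F u w -> first u v e -> ~~ sep F e u w ->
  ~~ (sep F f u v && sep F f u w).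
Proof.
move=> cw fe ns; apply/negP => /andP[sv sw].
have [se ie] := andP fe; have [] := sep_cut f se.
rewrite (first_near fe) sep_refl sv; case: eqVneq => [fe'|_] /=.
  by rewrite -fe' sw in ns.
move=> /esym s1 _.
have c1 : conn (F :\ e) (far u e) v by rewrite conn_nsep ?(sep_far_w se) // (sep_conn s1).
have c2 : conn (F :\ e) u w by rewrite conn_nsep.
rewrite -(sep_stable _ fF (subD1set _ _) c1) in s1.
rewrite -(sep_stable _ fF (subD1set _ _) c2) in sw.
have c3 := sep_conn_src s1; have c4 := sep_conn_src sw.
case/andP: (sep_far se) => _ /negP[]; apply: conn_trans c4 _.
by rewrite conn_sym.
Qed.

End OneForest.

(** * Marks

On a component of a forest with one edge less than vertices, the marks encode
sets of vertices of distinct colours. A pair of vertices is recorded by the first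
and the last edge of its path. For three vertices a third edge is needed: when
they span a tripod, the first edges of its three legs; when one of them, [v],
lies between [s] and [t], the last edge from [s] to [v] whose beginning does not
have the colour of [t], for then removing any of the three edges leaves the mark
of a pair. *)

Definition last_before F s v y e :=
  [&& sep F e s v, col (near F s e) != y
    & [forall f, sep F f (far F s e) v ==> (col (near F s f) == y)]].

Definition mark2 F s t : {ffun E -> nat} := [ffun e => first F s t e + first F t s e].

Definition mark3p F s t v : {ffun E -> nat} :=
  [ffun e => first F s t e + first F t s e + last_before F s v (col t) e].

Definition mark3t F u v w : {ffun E -> nat} :=
  [ffun e => first F u v e + first F v w e + first F w u e].

(** Ordering the ends by colour makes the unordered pair [s], [t] recoverable. *)
Definition pair_data F s t := clt (col s) (col t) && conn F s t.

(** The case [v = t], for colours 1 and 2, yields the marks of class [Star]. *)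
Definition path_data F s t v := [&& pair_data F s t, onpath F s t v &
  if v == t then link (col s) (col t) == L12 else (col v != col s) && (col v != col t)].

Definition tripod_data F u v w :=
  [&& [&& col u == Col0, col v == Col1 & col w == Col2], conn F u v, conn F u w,
      ~~ onpath F v w u, ~~ onpath F u w v & ~~ onpath F u v w].

(** The class of a multiset of edges of one component; the marks that encode
something are pairwise distinct, so that no choice is involved. *)
Definition cl F (N : {ffun E -> nat}) : cls :=
  if deg N <= 1 then Free
  else if [pick p : V * V | pair_data F p.1 p.2 && (N == mark2 F p.1 p.2)] is Some p
    then link (col p.1) (col p.2)
  else if [pick p : V * V * V | path_data F p.1.1 p.1.2 p.2
             && (N == mark3p F p.1.1 p.1.2 p.2)] is Some p
    then if p.2 == p.1.2 then Star else Full
  else if [exists p : V * V * V, tripod_data F p.1.1 p.1.2 p.2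
             && (N == mark3t F p.1.1 p.1.2 p.2)] then Full
  else Bad.

Variant cl_spec F N : cls -> Prop :=
| ClFree of deg N <= 1 : cl_spec F N Free
| ClPair s t of pair_data F s t & N = mark2 F s t : cl_spec F N (link (col s) (col t))
| ClPath s t v of path_data F s t v & N = mark3p F s t v :
    cl_spec F N (if v == t then Star else Full)
| ClTripod u v w of tripod_data F u v w & N = mark3t F u v w : cl_spec F N Full
| ClBad : cl_spec F N Bad.

Lemma clP F N : cl_spec F N (cl F N).
Proof.
rewrite /cl; case: ifP => [le|_]; first exact: ClFree.
case: pickP => [[s t] /= /andP[d /eqP eq]|_]; first exact: ClPair d eq.
case: pickP => [[[s t] v] /= /andP[d /eqP eq]|_]; first exact: ClPath d eq.
case: existsP => [[[[u v] w] /= /andP[d /eqP eq]]|_]; last exact: ClBad.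
exact: ClTripod d eq.
Qed.

Section OneForest.
Variable F : {set E}.
Hypothesis fF : forest F.

Lemma onpath_trans s t v x : onpath F s t v -> onpath F s v x -> onpath F s t x.
Proof.
move=> o1 o2; rewrite /onpath (proj1 (andP o2)) /=; apply/forallP => e.
by apply/implyP => /(onpathP o2)/(onpathP o1).
Qed.

(** The edges of a path are linearly ordered: [e] comes before [f] when it separates
the start from the beginning of [f]. *)
Lemma path_order e f s v : sep F e s v -> sep F f s v ->
  sep F f (far F s e) v = sep F e s (near F s f).
Proof.
move=> se sf; have [eqf excl] := sep_cut fF f se.
have cfs : conn F s (far F s e) := sep_inc_conn se (inc_far _ _ _).
apply/idP/idP => [h|h].
  have nsf : ~~ sep F f s (far F s e).
    apply/negP => h2; case/negP: excl; rewrite h andbT; move: h2.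
    have cn := sep_inc_conn se (inc_near F s e).
    rewrite (sep_xor fF f cn (conn_trans (_ : conn F _ s) cfs)) ?(conn_sym _ _ s) //.
    rewrite sep_ends ?(sep_in se) //; case: eqP h => [->|_]; last by rewrite addbF.
    by rewrite (sep_far_w fF se).
  have := near_move fF cfs (sep_in sf) (sep_conn_src sf) nsf => eqn.
  have o := onpath_near fF h; rewrite eqn in o.
  have ne : sep F e (far F s e) (near F s f) = false.
    by apply: contraFF (sep_far_w fF se); apply: onpathP o.
  rewrite (sep_xor fF e cfs (proj1 (andP o))) ne addbF; exact: sep_far se.
move: sf; rewrite eqf => /or3P[h2|/eqP fe|//].
  have := onpathP (onpath_near fF h2) h.
  by rewrite (sep_near fF se).
by rewrite fe (sep_near fF se) in h.
Qed.

Lemma path_total e f s v : sep F e s v -> sep F f s v ->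
  [|| e == f, sep F f (far F s e) v | sep F e (far F s f) v].
Proof.
move=> se sf; rewrite (path_order sf se).
have [eqf _] := sep_cut fF f se; move: sf; rewrite eqf => /or3P[->|fe|->];
  by rewrite ?orbT // eq_sym fe.
Qed.

Lemma onpath_total s t a b : onpath F s t a -> onpath F s t b ->
  onpath F s a b || onpath F s b a.
Proof.
move=> oa ob; rewrite /onpath (proj1 (andP oa)) (proj1 (andP ob)) /=.
apply/norP => -[]; rewrite !negb_forall => /existsP[e].
rewrite negb_imply => /andP[eb ea] /existsP[f]; rewrite negb_imply => /andP[fa fb].
have et := onpathP ob eb; have ft := onpathP oa fa.
case/or3P: (path_total et ft) => [/eqP ef|h|h]; first by rewrite ef fa in ea.
  case/negP: ea; rewrite (path_order et ft) in h; exact: onpathP (onpath_near fF fa) h.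
case/negP: fb; rewrite (path_order ft et) in h; exact: onpathP (onpath_near fF eb) h.
Qed.

Lemma sep_end s t : conn F s t -> (forall e, ~~ sep F e s t) -> s = t.
Proof.
move=> cst h; apply/eqP; case: eqVneq => // ne.
by have [e /andP[se _]] := first_ex fF cst ne; case/negP: (h e).
Qed.

Lemma onpath_antisym s a b : onpath F s a b -> onpath F s b a -> a = b.
Proof.
move=> ab ba; have ca := proj1 (andP ba); have cb := proj1 (andP ab).
have cab : conn F a b by apply: (conn_trans (y := s)); rewrite // conn_sym.
apply: (sep_end cab) => e; rewrite (sep_xor fF e _ cb) 1?conn_sym //.
rewrite sep_sym; case sa: (sep F e s a); case sb: (sep F e s b) => //=.
  by rewrite (onpathP ba sa) in sb.
by rewrite (onpathP ab sb) in sa.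
Qed.

Lemma last_ex s v y : conn F s v -> s != v -> col s != y ->
  exists e, last_before F s v y e.
Proof.
move=> csv ne csy; have [e0 fe0] := first_ex fF csv ne.
have P0 : sep F e0 s v && (col (near F s e0) != y).
  by rewrite (first_near fF fe0) csy andbT; case/andP: fe0.
pose h e := #|[set g | sep F g s (near F s e)]|.
case: (@arg_maxnP _ e0 (fun e => sep F e s v && (col (near F s e) != y)) h P0) => e /andP[se ne_y] maxe; exists e.
rewrite /last_before se ne_y /=; apply/forallP => f; apply/implyP => sf.
apply/eqP/eqP; apply: contraT => nfy.
have sfv : sep F f s v by rewrite (sep_cut fF f se).1 sf !orbT.
have /= := maxe f; rewrite sfv nfy => /(_ isT); rewrite leqNgt => /negP[].
have eb : sep F e s (near F s f) by rewrite -(path_order se sfv).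
apply/proper_card/properP; split; last first.
  by exists e; rewrite !inE // (sep_near fF se).
apply/subsetP => g; rewrite !inE => sg.
exact: onpathP (onpath_near fF eb) sg.
Qed.

Lemma last_uniq s v y e f : last_before F s v y e -> last_before F s v y f -> e = f.
Proof.
case/and3P=> se ne /forallP ae /and3P[sf nf /forallP af].
case/or3P: (path_total se sf) => [/eqP//|h|h].
  by have := implyP (ae f) h; rewrite (negbTE nf).
by have := implyP (af e) h; rewrite (negbTE ne).
Qed.

Lemma path_data_neq s t v : path_data F s t v -> s != v.
Proof.
case/and3P=> /andP[lt _] _; have := clt_neq lt; case: (v =P t) => [->|_].
  by move=> ne _; apply: contraNneq ne => ->.
by move=> _ /andP[ne _]; apply: contraNneq ne => ->.
Qed.

(** Beyond the edge chosen for [v], the path starts at a vertex with the colour of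
[t], or at [v] itself; neither has the colour of [s]. *)
Lemma last_far s t v e : path_data F s t v -> last_before F s v (col t) e ->
  col (far F s e) != col s.
Proof.
move=> d /and3P[se _ /forallP ae]; case/and3P: (d) => /andP[lt cst] _ colv.
have [<-|ne] := eqVneq v (far F s e).
  move: colv; case: eqP => [->|_]; first by move=> _; rewrite eq_sym clt_neq ?lt.
  by case/andP.
have cfv : conn F (far F s e) v.
  apply: (conn_trans (y := s)); last exact: sep_conn se.
  by rewrite conn_sym (sep_inc_conn se) ?inc_far.
rewrite eq_sym in ne; have [f ff] := first_ex fF cfv ne.
have [sf _] := andP ff; have /eqP := implyP (ae f) sf.
have -> : near F s f = far F s e.
  rewrite -(first_near fF ff); apply/esym/near_move => //.
  - by rewrite (sep_inc_conn se) ?inc_far.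
  - exact: sep_in sf.
  - apply: sep_conn_src (_ : sep F f s v).
    by rewrite (sep_cut fF f se).1 sf !orbT.
  - apply/negP => h; have := onpath_excl fF f (sep_conn se) (onpath_far fF se).
    by rewrite h sf => -[].
by move->; rewrite eq_sym clt_neq.
Qed.

(** The vertex [v] can be recovered from the third edge: between two candidates all
edges would begin with the colour of [t], but [v] has another colour. *)
Lemma last_inj s t v v' e : path_data F s t v -> path_data F s t v' ->
  last_before F s v (col t) e -> last_before F s v' (col t) e -> v = v'.
Proof.
move=> d d' l l'.
wlog o : v v' d d' l l' / onpath F s v' v.
  move=> h; case/orP: (onpath_total (proj1 (andP (proj2 (andP d))))
    (proj1 (andP (proj2 (andP d'))))) => o; last exact: h.
  by apply/esym/h.
apply/eqP; case: eqVneq => // ne.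
case/and3P: (l) => se _ _; case/and3P: (l') => se' _ /forallP ae'.
case/and3P: d => pd o1 colv; case/and3P: d' => _ o2 colv'.
have cvv' : conn F v v'.
  by apply: conn_trans (sep_conn se'); rewrite conn_sym (sep_conn se).
have [f ff] := first_ex fF cvv' ne; have [sf inf] := andP ff.
have csv := sep_conn se; have csv' := sep_conn se'.
have sfv' : sep F f s v' by apply: (onpathP' fF csv' o).
have nsf : ~~ sep F f s v.
  by case: (onpath_excl fF f csv' o) => _; rewrite sf andbT.
have nf : near F s f = v.
  by apply/esym/nearE => //; [exact: sep_in sf | exact: negbTE].
have /eqP cv : col (near F s f) == col t.
  by apply: (implyP (ae' f)); rewrite (path_order se' sfv') nf.
rewrite nf in cv; move: colv; rewrite cv eqxx andbF.
case: eqP => // vt _.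
by rewrite vt in o ne *; case/eqP: ne; apply: onpath_antisym o2 o.
Qed.

Lemma boolsum1 (P : pred E) e : P e -> (forall f, P f -> f = e) ->
  forall x : E, (P x : nat) = (e == x).
Proof.
move=> Pe u x; case: (eqVneq e x) => [<-|ne]; first by rewrite Pe.
by case Px: (P x) => //; case/eqP: ne; apply/esym/u.
Qed.

Lemma mark2E s t e f : first F s t e -> first F t s f -> mark2 F s t = mset [:: e; f].
Proof.
move=> fe ff; apply/ffunP => x; rewrite !ffunE /=.
rewrite (boolsum1 fe); last by move=> g fg; apply: first_uniq fg fe.
by rewrite (boolsum1 ff) ?addn0 // => g fg; apply: first_uniq fg ff.
Qed.

Lemma mark3pE s t v e f k : first F s t e -> first F t s f ->
  last_before F s v (col t) k -> mark3p F s t v = mset [:: e; f; k].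
Proof.
move=> fe ff lk; apply/ffunP => x; rewrite !ffunE /=.
rewrite (boolsum1 fe); last by move=> g fg; apply: first_uniq fg fe.
rewrite (boolsum1 ff); last by move=> g fg; apply: first_uniq fg ff.
by rewrite (boolsum1 lk) ?addn0 ?addnA // => g fg; apply: last_uniq fg lk.
Qed.

Lemma mark3tE u v w e f g : first F u v e -> first F v w f -> first F w u g ->
  mark3t F u v w = mset [:: e; f; g].
Proof.
move=> fe ff fg; apply/ffunP => x; rewrite !ffunE /=.
rewrite (boolsum1 fe); last by move=> h fh; apply: first_uniq fh fe.
rewrite (boolsum1 ff); last by move=> h fh; apply: first_uniq fh ff.
by rewrite (boolsum1 fg) ?addn0 ?addnA // => h fh; apply: first_uniq fh fg.
Qed.

Lemma mark2C s t : mark2 F s t = mark2 F t s.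
Proof. by apply/ffunP => x; rewrite !ffunE addnC. Qed.

Lemma pair_ex s t : pair_data F s t -> exists e f,
  [/\ first F s t e, first F t s f & mark2 F s t = mset [:: e; f]].
Proof.
case/andP=> lt cst; have ne : s != t by apply: contraTneq (clt_neq lt) => ->; rewrite eqxx.
have [e fe] := first_ex fF cst ne; have [f ff] : exists f, first F t s f.
  by apply: first_ex => //; rewrite 1?conn_sym 1?eq_sym.
by exists e, f; split=> //; apply: mark2E.
Qed.

Lemma path_ex s t v : path_data F s t v -> exists e f k,
  [/\ first F s t e, first F t s f, last_before F s v (col t) k
    & mark3p F s t v = mset [:: e; f; k]].
Proof.
move=> d; case/and3P: (d) => pd o _; have [e [f [fe ff _]]] := pair_ex pd.
have [k lk] : exists k, last_before F s v (col t) k.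
  apply: last_ex; [by case/andP: o | exact: path_data_neq d|].
  by case/andP: pd => /clt_neq.
by exists e, f, k; split=> //; apply: mark3pE.
Qed.

Lemma deg_mark2 s t : pair_data F s t -> deg (mark2 F s t) = 2.
Proof. by case/pair_ex=> e [f [_ _ ->]]; rewrite deg_mset. Qed.

Lemma deg_mark3p s t v : path_data F s t v -> deg (mark3p F s t v) = 3.
Proof. by case/path_ex=> e [f [k [_ _ _ ->]]]; rewrite deg_mset. Qed.

End OneForest.

Section OneForest.
Variable F : {set E}.
Hypothesis fF : forest F.

(** * Marks determine what they encode *)

Lemma other_side s t e f v : first F s t e -> sep F f s t -> f != e -> inc f v ->
  sep F e s v.
Proof.
move=> fe sf ne iv; have [se ie] := andP fe.
have := (sep_cut fF f se).1; rewrite (first_near fF fe) sep_refl sf (negbTE ne) /=.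
move=> /esym sf'; have o := onpath_inc fF sf' iv.
have cf := sep_inc_conn se (inc_far F s e).
rewrite (sep_xor fF e cf (proj1 (andP o))) (sep_far fF se).
case h: (sep F e (far F s e) v) => //.
by have := onpathP o h; rewrite (sep_far_w fF se).
Qed.

Lemma endE s t e f x : first F s t e -> sep F f s t -> inc f x -> ~~ sep F e s x -> x = s.
Proof.
move=> fe sf ix ns; have [se _] := andP fe.
have [fe'|ne] := eqVneq f e; last by rewrite (other_side fe sf ne ix) in ns.
rewrite fe' in ix; rewrite -(first_near fF fe); apply: nearE => //.
- exact: sep_in se.
- exact: sep_inc_conn se ix.
- exact: negbTE.
Qed.

(** The edges [e'] and [f'] put [s'] and [t'] on the path from [s] to [t]; its first
and last edges can then only separate [s'] from [t'] if these are its ends. *)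
Lemma hull_ends s t e f s' t' e' f' :
  first F s t e -> first F t s f -> first F s' t' e' -> first F t' s' f' ->
  sep F e' s t -> sep F f' s t -> sep F e s' t' -> sep F f s' t' ->
  (s = s' /\ t = t') \/ (s = t' /\ t = s').
Proof.
move=> fe ff fe' ff' e's f's es' fs'.
have [se _] := andP fe; have [sf _] := andP ff.
have [_ ie'] := andP fe'; have [_ if'] := andP ff'.
have css' := sep_inc_conn e's ie'; have cst' := sep_inc_conn f's if'.
have cts : conn F t s by rewrite conn_sym (sep_conn se).
have e't : sep F e' t s by rewrite sep_sym.
have f't : sep F f' t s by rewrite sep_sym.
have cs's : conn F s' s by rewrite conn_sym.
have cs't : conn F s' t by apply: conn_trans cs's (sep_conn se).
have := es'; rewrite (sep_xor fF e cs's cst') sep_sym.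
have := fs'; rewrite (sep_xor fF f cs't (conn_trans cts cst')) sep_sym.
case h1: (sep F f t s'); case h2: (sep F f t t') => // _;
case h3: (sep F e s s'); case h4: (sep F e s t') => // _.
- have eqs := endE fe f's if' (negbT h4); have eqt := endE ff f't if' (negbT h2).
  by move: se; rewrite -eqs -eqt sep_refl.
- left; split; apply/esym; [exact: endE fe e's ie' (negbT h3) | exact: endE ff f't if' (negbT h2)].
- right; split; apply/esym; [exact: endE fe f's if' (negbT h4) | exact: endE ff e't ie' (negbT h1)].
- have eqs := endE fe e's ie' (negbT h3); have eqt := endE ff e't ie' (negbT h1).
  by move: se; rewrite -eqs -eqt sep_refl.
Qed.

Lemma mset_mem (l l' : seq E) e : mset l = mset l' -> e \in l -> e \in l'.
Proof. by rewrite -!mset_in => ->. Qed.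

Lemma clt_asym a b : clt a b -> clt b a = false. Proof. by case: a b => -[]. Qed.

Lemma mark2_inj s t s' t' : pair_data F s t -> pair_data F s' t' ->
  mark2 F s t = mark2 F s' t' -> s = s' /\ t = t'.
Proof.
move=> d d'; have [e [f [fe ff ->]]] := pair_ex fF d.
have [e' [f' [fe' ff' ->]]] := pair_ex fF d' => eqm.
have sub s0 t0 e0 f0 g : first F s0 t0 e0 -> first F t0 s0 f0 -> g \in [:: e0; f0] -> sep F g s0 t0.
  by move=> /andP[h1 _] /andP[h2 _]; rewrite !inE => /orP[]/eqP-> //; rewrite sep_sym.
have [] // := hull_ends fe ff fe' ff'.
- by apply: (sub _ _ _ _ _ fe ff); apply: mset_mem (esym eqm) _; rewrite inE eqxx.
- by apply: (sub _ _ _ _ _ fe ff); apply: mset_mem (esym eqm) _; rewrite !inE eqxx orbT.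
- by apply: (sub _ _ _ _ _ fe' ff'); apply: mset_mem eqm _; rewrite inE eqxx.
- by apply: (sub _ _ _ _ _ fe' ff'); apply: mset_mem eqm _; rewrite !inE eqxx orbT.
case=> eqs eqt; case/andP: d; rewrite eqs eqt => /clt_asym.
by case/andP: d' => ->.
Qed.

Lemma path_sub s t v e f k g : path_data F s t v ->
  first F s t e -> first F t s f -> last_before F s v (col t) k ->
  g \in [:: e; f; k] -> sep F g s t.
Proof.
case/and3P=> _ o _ /andP[h1 _] /andP[h2 _] /and3P[h3 _ _].
rewrite !inE => /or3P[]/eqP-> //; first by rewrite sep_sym.
exact: onpathP o h3.
Qed.

Lemma mark3p_inj s t v s' t' v' : path_data F s t v -> path_data F s' t' v' ->
  mark3p F s t v = mark3p F s' t' v' -> [/\ s = s', t = t' & v = v'].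
Proof.
move=> d d'; have [e [f [k [fe ff lk ->]]]] := path_ex fF d.
have [e' [f' [k' [fe' ff' lk' ->]]]] := path_ex fF d' => eqm.
have [] // := hull_ends fe ff fe' ff'.
- by apply: (path_sub d fe ff lk); apply: mset_mem (esym eqm) _; rewrite inE eqxx.
- by apply: (path_sub d fe ff lk); apply: mset_mem (esym eqm) _; rewrite !inE eqxx orbT.
- by apply: (path_sub d' fe' ff' lk'); apply: mset_mem eqm _; rewrite inE eqxx.
- by apply: (path_sub d' fe' ff' lk'); apply: mset_mem eqm _; rewrite !inE eqxx orbT.
- case=> eqs eqt; subst s' t'; split=> //.
  have ee := first_uniq fF fe fe'; have ef := first_uniq fF ff ff'; subst e' f'.
  move/eqP: eqm; rewrite mset_perm !perm_cons => /perm_mem/(_ k).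
  rewrite !inE eqxx => /esym/eqP kk; subst k'; exact: last_inj fF _ _ _ _ _ d d' lk lk'.
case=> eqs eqt; case/and3P: d => /andP[+ _] _ _; rewrite eqs eqt => /clt_asym.
by case/and3P: d' => /andP[->].
Qed.

(** Paths from [u] to [v] and to [w] that part at [u] would have [u] between [v]
and [w]; so when it is not, they leave by the same edge. *)
Lemma not_onpath u v w e : conn F u w -> first F u v e -> ~~ onpath F v w u -> first F u w e.
Proof.
move=> cw fe; rewrite /first; have [se ->] := andP fe; rewrite andbT.
apply: contraR => ns; rewrite /onpath conn_sym (sep_conn se) /=.
apply/forallP => h; apply/implyP => sh.
have := branch fF h cw fe ns; rewrite sep_sym sh /= => /negbTE nh.
by rewrite (sep_xor fF h _ cw) ?sh ?nh // conn_sym (sep_conn se).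
Qed.

(** In a tripod, the leg ending at [a] starts with the edge [x], and the first edges
[y], [z] of the two other legs lie entirely beyond [x]. *)
Definition leaf a x y z := [/\ x \in F, inc x a, (forall p, inc y p -> sep F x a p)
  & (forall p, inc z p -> sep F x a p)].

Lemma leaf_end a b x y z y' z' : leaf a x y z -> leaf b x y' z' ->
  y' \in [:: y; z] -> a = b.
Proof.
case=> xF ia sy sz [_ ib sy' _] yin.
have iy : inc y' (src y') by rewrite /inc eqxx.
have sa : sep F x a (src y').
  by move: yin; rewrite !inE => /orP[]/eqP eqy; [apply: sy|apply: sz]; rewrite -eqy.
have sb := sy' _ iy.
have cab : conn F a b.
  by apply: (conn_trans (sep_conn sa)); rewrite conn_sym (sep_conn sb).
have nab : ~~ sep F x a b.
  by rewrite (sep_xor fF x (sep_conn sa) (_ : conn F _ b)) 1?conn_sym 1?(sep_conn sb) //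
    sa sep_sym sb.
have caa : conn F a a by rewrite conn_refl.
rewrite (nearE fF ia xF caa (sep_refl _ _ _)) -(nearE fF ib xF cab) //; exact: negbTE.
Qed.

Lemma tripod_ex u v w : tripod_data F u v w -> exists e f g,
  [/\ [/\ first F u v e, first F v w f & first F w u g],
      [/\ first F u w e, first F v u f & first F w v g],
      [/\ e != f, f != g & g != e],
      [/\ leaf u e f g, leaf v f g e & leaf w g e f]
    & mark3t F u v w = mset [:: e; f; g]].
Proof.
case/and5P=> /and3P[/eqP c0 /eqP c1 /eqP c2] cuv cuw nu /andP[nv nw].
have uv : u != v by apply/eqP => h; rewrite h c1 in c0.
have uw : u != w by apply/eqP => h; rewrite h c2 in c0.
have vw : v != w by apply/eqP => h; rewrite h c2 in c1.
have cvw : conn F v w by apply: (conn_trans (y := u)); rewrite // conn_sym.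
have cvu : conn F v u by rewrite conn_sym.
have cwu : conn F w u by rewrite conn_sym.
have cwv : conn F w v by rewrite conn_sym.
have [e e1] := first_ex fF cuv uv; have e2 := not_onpath cuw e1 nu.
have [f f1] := first_ex fF cvw vw.
have f2 : first F v u f by apply: not_onpath f1 _ => //; rewrite onpath_sym.
have [|g g1] := first_ex fF cwu; first by rewrite eq_sym.
have g2 := not_onpath cwv g1 nw.
have neq a b x p q : conn F a b -> conn F b x -> first F a b p -> first F a x p ->
    first F b x q -> p != q.
  move=> cab cbx /andP[s1 _] /andP[s2 _] /andP[s3 _]; apply: contraTneq s2 => pq.
  by rewrite (sep_xor fF p cab cbx) s1 pq s3.
have ef := neq _ _ _ _ _ cuv cvw e1 e2 f1.
have fg := neq _ _ _ _ _ cvw cwu f1 f2 g1.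
have ge := neq _ _ _ _ _ cwu cuv g1 g2 e1.
exists e, f, g; split=> //; last exact: mark3tE.
have mk a b x p q r : first F a b p -> first F a x p -> first F b a q -> first F x a r ->
    p != q -> r != p -> leaf a p q r.
  move=> p1 p2 q1 r1 pq rp; split; [by case/andP: p1 => /sep_in | by case/andP: p1| |].
    move=> z; apply: (other_side p1); last by rewrite eq_sym.
    by case/andP: q1; rewrite sep_sym.
  by move=> z; apply: (other_side p2) => //; case/andP: r1; rewrite sep_sym.
by split; [apply: mk e1 e2 f2 g1 ef ge|apply: mk f1 f2 g2 e1 fg ef|apply: mk g1 g2 e2 f1 ge fg].
Qed.

Lemma deg_mark3t u v w : tripod_data F u v w -> deg (mark3t F u v w) = 3.
Proof. by case/tripod_ex=> e [f [g [_ _ _ _ ->]]]; rewrite deg_mset. Qed.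

Lemma mark3t_inj u v w u' v' w' : tripod_data F u v w -> tripod_data F u' v' w' ->
  mark3t F u v w = mark3t F u' v' w' -> [/\ u = u', v = v' & w = w'].
Proof.
move=> d d'; have [e [f [g [_ _ [ef fg ge] [l1 l2 l3] ->]]]] := tripod_ex d.
have [e' [f' [g' [_ _ [ef' fg' ge'] [l1' l2' l3'] ->]]]] := tripod_ex d' => eqm.
case/and5P: d => /and3P[/eqP c0 /eqP c1 /eqP c2] _ _ _ _.
case/and5P: d' => /and3P[/eqP c0' /eqP c1' /eqP c2'] _ _ _ _.
have meq : [:: e; f; g] =i [:: e'; f'; g'].
  by apply: perm_mem; rewrite -mset_perm eqm.
have key b x y z : leaf b x y z -> y != x -> x \in [:: e; f; g] -> y \in [:: e; f; g] ->
    [\/ b = u, b = v | b = w].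
  move=> lb ne; rewrite !inE => /or3P[]/eqP eqx; subst x.
  - rewrite (negbTE ne) => /= yi; constructor 1; apply/esym; apply: leaf_end l1 lb _.
    by rewrite !inE.
  - rewrite (negbTE ne) => /= yi; constructor 2; apply/esym; apply: leaf_end l2 lb _.
    by rewrite !inE orbC.
  - rewrite (negbTE ne) orbF => yi; constructor 3; apply/esym; apply: leaf_end l3 lb _.
    by rewrite !inE.
split.
- have [|||->|h|h] // := key _ _ _ _ l1'; rewrite ?meq ?inE ?eqxx ?orbT // 1?eq_sym //.
    by rewrite h c1 in c0'.
  by rewrite h c2 in c0'.
- have [|||h|->|h] // := key _ _ _ _ l2'; rewrite ?meq ?inE ?eqxx ?orbT // 1?eq_sym //.
    by rewrite h c0 in c1'.
  by rewrite h c2 in c1'.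
- have [|||h|h|->] // := key _ _ _ _ l3'; rewrite ?meq ?inE ?eqxx ?orbT // 1?eq_sym //.
    by rewrite h c0 in c2'.
  by rewrite h c1 in c2'.
Qed.

(** No vertex is on the near side of two legs. *)
Lemma leaf_disjoint a b x y p q z : leaf a x y p -> leaf b y q x -> conn F a b ->
  conn F a z -> sep F y b a -> ~~ (~~ sep F x a z && ~~ sep F y b z).
Proof.
case=> xF ia sy _ [yF ib _ sx] cab caz sba; apply/negP => /andP[n1 n2].
have cba : conn F b a by rewrite conn_sym.
have saz : sep F y a z.
  by move: n2; rewrite (sep_xor fF y cba caz) sba; case: (sep F y a z).
have ny : inc y (src y) by rewrite /inc eqxx.
have := onpathP (onpath_inc fF saz ny) (sy _ ny).
by rewrite (negbTE n1).
Qed.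

(** The edges of a tripod do not lie on one path: each of the three would separate
the two ends, hence have one of them on its near side, but two ends cannot be on
the near sides of three legs. *)
Lemma mark3t_mark3p u v w s t x : tripod_data F u v w -> path_data F s t x ->
  mark3t F u v w <> mark3p F s t x.
Proof.
move=> d d'; have [e [f [g [[e1 f1 g1] [e2 f2 g2] _ [l1 l2 l3] ->]]]] := tripod_ex d.
have [e' [f' [k' [fe' ff' lk' ->]]]] := path_ex fF d' => eqm.
have subD h : h \in [:: e; f; g] -> sep F h s t.
  by move=> hin; apply: (path_sub d' fe' ff' lk'); apply: mset_mem eqm hin.
have se : sep F e s t by apply: subD; rewrite !inE eqxx.
have sf : sep F f s t by apply: subD; rewrite !inE eqxx orbT.
have sg : sep F g s t by apply: subD; rewrite !inE eqxx !orbT.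
case/and5P: d => _ cuv cuw _ _.
have [_ ie] := andP e1.
have cus : conn F u s by rewrite conn_sym; apply: sep_inc_conn se ie.
have cut : conn F u t by apply: conn_trans cus (sep_conn se).
have cvu : conn F v u by rewrite conn_sym.
have cwu : conn F w u by rewrite conn_sym.
have cvs := conn_trans cvu cus; have cvt := conn_trans cvu cut.
have cws := conn_trans cwu cus; have cwt := conn_trans cwu cut.
have cvw := conn_trans cvu cuw.
have d1 z (cz : conn F u z) := leaf_disjoint l1 l2 cuv cz (proj1 (andP f2)).
have d2 z (cz : conn F v z) := leaf_disjoint l2 l3 cvw cz (proj1 (andP g2)).
have d3 z (cz : conn F w z) := leaf_disjoint l3 l1 cwu cz (proj1 (andP e2)).
have := d1 s cus; have := d1 t cut; have := d2 s cvs; have := d2 t cvt.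
have := d3 s cws; have := d3 t cwt.
have su : conn F s u by rewrite conn_sym.
have sv : conn F s v by rewrite conn_sym.
have sw : conn F s w by rewrite conn_sym.
move: se sf sg; rewrite (sep_xor fF e su cut) (sep_xor fF f sv cvt) (sep_xor fF g sw cwt).
rewrite (sep_sym _ _ s u) (sep_sym _ _ s v) (sep_sym _ _ s w).
by case: (sep F e u s); case: (sep F e u t) => //;
  case: (sep F f v s); case: (sep F f v t) => //;
  case: (sep F g w s); case: (sep F g w t).
Qed.

Lemma cl_mark2 s t : pair_data F s t -> cl F (mark2 F s t) = link (col s) (col t).
Proof.
move=> d; rewrite /cl (deg_mark2 fF d) /=; case: pickP => [[s' t'] /= /andP[d' /eqP eqm]|].
  by have [-> ->] := mark2_inj d d' eqm.
by move/(_ (s, t)); rewrite /= d eqxx.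
Qed.

Lemma cl_mark3p s t v : path_data F s t v ->
  cl F (mark3p F s t v) = if v == t then Star else Full.
Proof.
move=> d; rewrite /cl (deg_mark3p fF d) /=; case: pickP => [[s' t'] /= /andP[d' /eqP eqm]|_].
  by have := deg_mark3p fF d; rewrite eqm (deg_mark2 fF d').
case: pickP => [[[s' t'] v'] /= /andP[d' /eqP eqm]|].
  by have [_ -> ->] := mark3p_inj d d' eqm.
by move/(_ (s, t, v)); rewrite /= d eqxx.
Qed.

Lemma cl_mark3t u v w : tripod_data F u v w -> cl F (mark3t F u v w) = Full.
Proof.
move=> d; rewrite /cl (deg_mark3t d) /=; case: pickP => [[s' t'] /= /andP[d' /eqP eqm]|_].
  by have := deg_mark3t d; rewrite eqm (deg_mark2 fF d').
case: pickP => [[[s' t'] v'] /= /andP[d' /eqP eqm]|_].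
  by case: (mark3t_mark3p d d').
by case: existsP => // -[]; exists (u, v, w); rewrite /= d eqxx.
Qed.

Lemma cl_small (N : {ffun E -> nat}) : deg N <= 1 -> cl F N = Free.
Proof. by rewrite /cl => ->. Qed.

Lemma first_first s t x e : onpath F s t x -> s != x -> first F s t e -> first F s x e.
Proof.
move=> o ne fe; have [g fg] := first_ex fF (proj1 (andP o)) ne.
by rewrite (first_uniq fF fe (first_onpath o fg)).
Qed.

(** The two colours need not be in increasing order to make a pair mark. *)
Lemma mark2_mset x z e f : conn F x z -> col x != col z -> first F x z e -> first F z x f ->
  exists s t, [/\ pair_data F s t, mset [:: e; f] = mark2 F s t & link (col s) (col t) = link (col x) (col z)].
Proof.
move=> cxz ne fe ff; have /orP[lt|lt] := clt_total ne.
  by exists x, z; rewrite /pair_data lt cxz (mark2E fF fe ff).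
exists z, x; rewrite /pair_data lt conn_sym cxz mark2C // (mark2E fF fe ff).
by rewrite linkC.
Qed.

Definition big_mark N := (exists s t v, path_data F s t v /\ N = mark3p F s t v) \/
  (exists u v w, tripod_data F u v w /\ N = mark3t F u v w).

(** What remains is the mark of a pair: that of the ends; or [s] with the far end of the third edge, or [t] with its near end,
which is where the condition on the colours of that edge is used; or two of the
feet of a tripod. *)
Lemma big_mark_sub N N' : big_mark N -> deg N' = 2 -> (forall e, N' e <= N e) ->
  exists s t, pair_data F s t /\ N' = mark2 F s t.
Proof.
case=> [[s [t [v [d ->]]]]|[u [v [w [d ->]]]]] dN le.
  have [e [f [k [fe ff lk eqm]]]] := path_ex fF d; rewrite eqm in le.
  case/and3P: (d) => pd o _; have [lt cst] := andP pd.
  have kst := path_sub d fe ff lk (mem_last _ _).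
  case: (sub_mult3 dN le) => ->.
  - by exists s, t; rewrite (mark2E fF fe ff).
  - have sq : s != far F s k by apply: contraNneq (last_far fF d lk) => <-.
    have o' := onpath_far fF kst.
    have fk := first_far fF kst; have fe' := first_first o' sq fe.
    have [||s' [t' [p -> _]]] := mark2_mset _ _ fe' fk; last by exists s', t'.
      by case/andP: o'.
    by rewrite eq_sym (last_far fF d lk).
  - have kts : sep F k t s by rewrite sep_sym.
    have o' := onpath_far fF kts; rewrite (far_sym fF kst) in o'.
    have np : col (near F s k) != col t by case/and3P: lk.
    have tp : t != near F s k by apply: contraNneq np => <-.
    have fk := first_far fF kts; rewrite (far_sym fF kst) in fk.
    have fe' := first_first o' tp ff.
    have [||s' [t' [p -> _]]] := mark2_mset _ _ fe' fk; last by exists s', t'.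
      by case/andP: o'.
    by rewrite eq_sym.
have [e [f [g [[e1 f1 g1] [e2 f2 g2] _ _ eqm]]]] := tripod_ex d; rewrite eqm in le.
case/and5P: d => /and3P[/eqP c0 /eqP c1 /eqP c2] cuv cuw _ _.
case: (sub_mult3 dN le) => ->.
- have [||s' [t' [p -> _]]] := mark2_mset _ _ e1 f2; rewrite ?c0 ?c1 //; by exists s', t'.
- have [||s' [t' [p -> _]]] := mark2_mset _ _ e2 g1; rewrite ?c0 ?c2 //; by exists s', t'.
- have [||s' [t' [p -> _]]] := mark2_mset _ _ f1 g2; rewrite ?c1 ?c2 //.
    by apply: conn_trans cuw; rewrite conn_sym.
  by exists s', t'.
Qed.

End OneForest.

(** * Marks in a subforest *)

Section Stable.
Variables (F' F : {set E}).
Hypotheses (fF : forest F) (sF : F' \subset F).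

Lemma first_stable s t e : conn F' s t -> first F' s t e = first F s t e.
Proof. by move=> cst; rewrite /first (sep_stable e fF sF cst). Qed.

Lemma near_stable s e : conn F' s (src e) -> near F' s e = near F s e.
Proof. by move=> cst; rewrite /near (sep_stable e fF sF cst). Qed.

Lemma far_stable s e : conn F' s (src e) -> far F' s e = far F s e.
Proof. by move=> cst; rewrite /far (sep_stable e fF sF cst). Qed.

Lemma onpath_stable s t v : conn F' s t -> conn F' s v -> onpath F' s t v = onpath F s t v.
Proof.
move=> cst csv; rewrite /onpath csv (conn_sub sF csv); apply: eq_forallb => e.
by rewrite !(sep_stable e fF sF).
Qed.

Lemma last_stable s v y e : conn F' s v -> last_before F' s v y e = last_before F s v y e.
Proof.
move=> csv; rewrite /last_before -(sep_stable e fF sF csv).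
case se: (sep F' e s v) => //=; have cs := sep_conn_src se.
have eF := sep_in se.
have cf : conn F' (far F' s e) v.
  apply: (conn_trans (y := s)) => //; rewrite conn_sym.
  exact: sep_inc_conn se (inc_far _ _ _).
rewrite near_stable // -far_stable //; congr andb; apply: eq_forallb => f.
rewrite -(sep_stable f fF sF cf); case sf: (sep F' f _ v) => //=.
rewrite near_stable //; apply: (conn_trans (y := far F' s e)).
  exact: sep_inc_conn se (inc_far _ _ _).
exact: sep_conn_src sf.
Qed.

Lemma mark2_stable s t : conn F' s t -> mark2 F' s t = mark2 F s t.
Proof.
by move=> cst; apply/ffunP => e; rewrite !ffunE !first_stable // conn_sym.
Qed.

Lemma mark3p_stable s t v : conn F' s t -> conn F' s v -> mark3p F' s t v = mark3p F s t v.
Proof.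
move=> cst csv; apply/ffunP => e; rewrite !ffunE last_stable //.
by rewrite !first_stable // conn_sym.
Qed.

Lemma mark3t_stable u v w : conn F' u v -> conn F' u w -> mark3t F' u v w = mark3t F u v w.
Proof.
move=> cuv cuw; apply/ffunP => e; rewrite !ffunE !first_stable //.
  by rewrite conn_sym.
by apply: (conn_trans (y := u)); rewrite // conn_sym.
Qed.

Lemma pair_stable s t : conn F' s t -> pair_data F' s t = pair_data F s t.
Proof. by move=> cst; rewrite /pair_data cst (conn_sub sF cst). Qed.

Lemma path_stable s t v : conn F' s t -> conn F' s v -> path_data F' s t v = path_data F s t v.
Proof. by move=> cst csv; rewrite /path_data pair_stable // onpath_stable. Qed.

Lemma tripod_stable u v w : conn F' u v -> conn F' u w -> tripod_data F' u v w = tripod_data F u v w.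
Proof.
move=> cuv cuw; have cvu : conn F' v u by rewrite conn_sym.
rewrite /tripod_data cuv (conn_sub sF cuv) cuw (conn_sub sF cuw).
by rewrite !onpath_stable // (conn_trans cvu).
Qed.

(** The edges of a mark contain the ends of the paths which it records, so that the
part of the forest which they span determines the class. *)
Lemma cl_stable (N : {ffun E -> nat}) r :
  (forall e, 0 < N e -> e \in F' /\ conn F' r (src e)) -> cl F' N = cl F N.
Proof.
move=> supp; have fF' := forest_sub sF fF.
have cN e x : 0 < N e -> inc e x -> conn F' r x.
  by move=> /supp[eF ce] ix; rewrite (inc_conn _ eF ix).
have cN2 e f x y : 0 < N e -> inc e x -> 0 < N f -> inc f y -> conn F' x y.
  move=> Ne ex Nf fy; apply: (conn_trans (y := r)); last exact: cN Nf fy.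
  by rewrite conn_sym; apply: cN Ne ex.
have Nin l e : N = mset l -> e \in l -> 0 < N e by move=> -> ?; rewrite mset_in.
have endsN l : N = mset l -> forall e f s t s' t', first F s t e -> first F s' t' f ->
    e \in l -> f \in l -> conn F' s s'.
  move=> eqN e f s t s' t' /andP[_ ie] /andP[_ jf] el fl.
  by apply: cN2 ie _ jf; apply: Nin eqN _.
case eqB: _ / (clP F N) => [le|s t d eqN|s t v d eqN|u v w d eqN|]; move: eqB.
- by rewrite !cl_small.
- move=> _; have [e [f [fe ff eqm]]] := pair_ex fF d; rewrite eqm in eqN.
  have cst : conn F' s t by apply: (endsN _ eqN) fe ff _ _; rewrite !inE eqxx ?orbT.
  by rewrite eqN -eqm -mark2_stable // cl_mark2 // pair_stable.
- move=> _; have [e [f [k [fe ff lk eqm]]]] := path_ex fF d; rewrite eqm in eqN.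
  have cst : conn F' s t by apply: (endsN _ eqN) fe ff _ _; rewrite !inE eqxx ?orbT.
  have csv : conn F' s v.
    case/and3P: (d) => _ o _; have [_ ie] := andP fe; have [-> //|nvt] := eqVneq v t.
    have eF g := sep_stable g fF sF cst.
    have cvs : conn F v s by rewrite conn_sym (proj1 (andP o)).
    have nvs : v != s by rewrite eq_sym (path_data_neq d).
    have [g /andP[sg ig]] := first_ex fF cvs nvs.
    have sgt : sep F' g s t by rewrite eF; apply: onpathP o _; rewrite sep_sym.
    exact: sep_inc_conn sgt ig.
  by rewrite eqN -eqm -mark3p_stable // cl_mark3p // path_stable.
- move=> _; have [e [f [g [[fe ff fg] _ _ _ eqm]]]] := tripod_ex fF d; rewrite eqm in eqN.
  have cuv : conn F' u v by apply: (endsN _ eqN) fe ff _ _; rewrite !inE eqxx ?orbT.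
  have cuw : conn F' u w by apply: (endsN _ eqN) fe fg _ _; rewrite !inE eqxx ?orbT.
  by rewrite eqN -eqm -mark3t_stable // cl_mark3t // tripod_stable.
move=> eqB; rewrite -eqB; case: (clP F' N) => // [le|s t d eqN|s t v d eqN|u v w d eqN].
- by rewrite cl_small.
- have cst := proj2 (andP d); rewrite pair_stable // in d.
  by rewrite eqN mark2_stable // cl_mark2.
- case/and3P: (d) => /andP[_ cst] /andP[csv _] _; rewrite path_stable // in d.
  by rewrite eqN mark3p_stable // cl_mark3p.
- case/and5P: (d) => _ cuv cuw _ _; rewrite tripod_stable // in d.
  by rewrite eqN mark3t_stable // cl_mark3t.
Qed.

End Stable.

(** * The complex of marked forests

The pair of a forest [F] and of marks [M] on its edges stands for the monomial
which is the product of the edges of [F] and of the marks; the exponent of an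
edge of [F] is one more than its multiplicity in [M], so no information is lost.
The predicate [inX] selects an order ideal. *)

Definition restr F (M : {ffun E -> nat}) r : {ffun E -> nat} :=
  [ffun e => if rt F (src e) == r then M e else 0].

Definition total_cl F M := \big[mulc/Free]_r cl F (restr F M r).

Definition inX F (M : {ffun E -> nat}) :=
  [&& forest F, [forall e, (0 < M e) ==> (e \in F)] & total_cl F M != Bad].

Lemma deg_le (N N' : {ffun E -> nat}) : (forall e, N' e <= N e) -> deg N' <= deg N.
Proof. by move=> le; apply: leq_sum => e _. Qed.

Lemma deg_eq (N N' : {ffun E -> nat}) : (forall e, N' e <= N e) -> deg N' = deg N -> N' = N.
Proof.
move=> le /eqP; rewrite /deg => eqd; apply/ffunP => e; apply/eqP.
have := leqif_sum (fun e (_ : true) => conj (le e) (erefl (N' e == N e))).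
by case=> _ /esym; rewrite eqd => /forall_inP/(_ e isT).
Qed.

(** Of a weight-three mark, whatever its class, remains a pair of two colours or
nothing. *)
Lemma cl_sub F N N' : forest F -> (forall e, N' e <= N e) -> ple (cl F N') (cl F N).
Proof.
move=> fF le; have dle := deg_le le.
have [le1|gt1] := leqP (deg N') 1; first by rewrite cl_small // /ple eqxx.
have [eqd|ned] := eqVneq (deg N') (deg N).
  by rewrite (deg_eq le eqd) ple_refl.
have lt : deg N' < deg N by rewrite ltn_neqAle ned.
have key : big_mark F N -> deg N = 3 -> rk (cl F N) = 2 -> ple (cl F N') (cl F N).
  move=> bm d3 rk2; rewrite d3 in lt.
  have [|s [t [d ->]]] := big_mark_sub fF bm _ le; first lia.
  rewrite cl_mark2 // /ple rk2 eqxx andbT; case/andP: d => /clt_neq + _.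
  by case: (col s); case: (col t) => //= _; rewrite !orbT.
case: (clP F N) key => [|s t d eqN|s t v d eqN|u v w d eqN|] //.
- by move: dle gt1 lt; lia.
- by move: gt1 lt; rewrite eqN (deg_mark2 fF d); lia.
- move=> key; apply: key; last by case: ifP.
    by left; exists s, t, v.
  by rewrite eqN (deg_mark3p fF d).
- move=> key; apply: key => //; first by right; exists u, v, w.
  by rewrite eqN (deg_mark3t fF d).
by move=> _; rewrite /ple eqxx !orbT.
Qed.

Lemma inX_sub F M M' : inX F M -> (forall e, M' e <= M e) -> inX F M'.
Proof.
case/and3P=> fF /forallP sM tM le; rewrite /inX fF /=; apply/andP; split.
  by apply/forallP => e; apply/implyP => me; apply: (implyP (sM e)); apply: leq_trans (le e).
apply: ple_Bad tM; apply: (big_ind2 ple) => [|x x' y y'|r _]; rewrite ?ple_refl //.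
  exact: ple_mul.
by apply: cl_sub => // e; rewrite !ffunE; case: ifP.
Qed.

Lemma rt_sub F' F x : F' \subset F -> rt F (rt F' x) = rt F x.
Proof. by move=> sF; apply/esym/rtP/(conn_sub sF)/conn_rt. Qed.

(** When a component falls apart, its marks are distributed among the pieces; as
there are at most three of them unless the class is [Bad], at most one piece has
more than one. *)
Lemma prod_pieces (P : pred V) (f : V -> {ffun E -> nat}) F N : forest F ->
  (forall r e, P r -> f r e <= N e) ->
  (forall r r' e, P r -> P r' -> r != r' -> f r e + f r' e <= N e) ->
  ple (\big[mulc/Free]_(r | P r) cl F (f r)) (cl F N).
Proof.
move=> fF le le2.
have [/existsP[r0 /andP[Pr0 gt1]]|] := boolP [exists r, P r && (1 < deg (f r))]; last first.
  rewrite negb_exists => /forallP h; rewrite big1; first by rewrite /ple eqxx.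
  by move=> r Pr; apply: cl_small; have := h r; rewrite Pr -leqNgt.
have key x : deg N <= 3 -> ple x (cl F N) -> 
    x = cl F (f r0) -> ple (\big[mulc/Free]_(r | P r) cl F (f r)) (cl F N).
  move=> d3 plex eqx; rewrite (bigD1 r0) //= big1; first by rewrite mulcC mul1c -eqx.
  move=> r /andP[Pr ne]; apply: cl_small.
  have : deg (f r) + deg (f r0) <= deg N.
    by rewrite /deg -big_split; apply: leq_sum => e _; apply: le2.
  lia.
have pl0 : ple (cl F (f r0)) (cl F N) by apply: cl_sub => // e; apply: le.
have d3 : cl F N <> Bad -> deg N <= 3.
  case: (clP F N) => [h|s t h ->|s t v h ->|u v w h ->|] // _.
  - exact: leq_trans h _.
  - by rewrite (deg_mark2 fF h).
  - by rewrite (deg_mark3p fF h).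
  - by rewrite (deg_mark3t fF h).
have [->|ne] := eqVneq (cl F N) Bad; first by rewrite /ple eqxx !orbT.
exact: key (d3 (elimN eqP ne)) pl0 (erefl _).
Qed.

(** The marks of each piece are part of the marks of the former component, and have
the same class there. *)
Lemma inX_del F M e : inX F M -> e \in F -> M e = 0 -> inX (F :\ e) M.
Proof.
case/and3P=> fF /forallP sM tM eF me; have sF := subD1set F e.
have sM' f : 0 < M f -> f \in F :\ e.
  move=> mf; rewrite !inE (implyP (sM f)) // andbT.
  by apply: contraTneq mf => ->; rewrite me.
rewrite /inX (forest_sub sF) //=; apply/andP; split.
  by apply/forallP => f; apply/implyP/sM'.
refine (ple_Bad _ tM); rewrite /total_cl [X in ple X _](partition_big (rt F) xpredT) /=; last by [].
apply: (big_ind2 ple) => [|x x' y y'|r _]; rewrite ?ple_refl //; first exact: ple_mul.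
rewrite (eq_bigr (fun r' => cl F (restr (F :\ e) M r'))); last first.
  move=> r' _; apply: (cl_stable fF sF (r := r')) => f; rewrite ffunE.
  case: eqP => // <- mf; split; first exact: sM'.
  by rewrite conn_sym conn_rt.
apply: prod_pieces => // [r' f /eqP rr'|r1 r2 f /eqP r1r /eqP r2r ne]; rewrite !ffunE.
  by case: eqP => // eqr; rewrite -rr' -eqr rt_sub // eqxx.
case: eqP => [e1|_]; case: eqP => [e2|_] //.
- by move: ne; rewrite -e1 -e2 eqxx.
- by rewrite addn0 -r1r -e1 rt_sub // eqxx.
by rewrite add0n -r2r -e2 rt_sub // eqxx.
Qed.

Lemma total_cl_split F M R : total_cl F M =
  mulc (cl F (restr F M R)) (\big[mulc/Free]_(r | r != R) cl F (restr F M r)).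
Proof. by rewrite /total_cl (bigD1 R). Qed.

Lemma cl_zero F N : (forall e, N e = 0) -> cl F N = Free.
Proof. by move=> h; apply: cl_small; rewrite /deg big1. Qed.

Lemma restr_nonroot F M r : rt F r != r -> forall e, restr F M r e = 0.
Proof.
by move=> nr e; rewrite ffunE; case: eqP => // eqr; move: nr; rewrite -eqr rt_id eqxx.
Qed.

(** Adding an edge only changes the component that it creates. *)
Lemma total_cl_add g F M : forest (g |: F) -> g \notin F -> (forall e, 0 < M e -> e \in F) ->
  let R := rt (g |: F) (src g) in
  total_cl (g |: F) M = mulc (cl (g |: F) (restr (g |: F) M R))
    (\big[mulc/Free]_(r | rt (g |: F) r != R) cl F (restr F M r)).
Proof.
set F' := g |: F => fF' gF sM R; have sF : F \subset F' by apply: subsetUr.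
rewrite (total_cl_split F' M R); apply: (congr1 (mulc _)).
rewrite [RHS](partition_big (rt F') (fun r => r != R)) //=; apply: eq_bigr => r neR.
have [root|nroot] := eqVneq (rt F' r) r; last first.
  rewrite cl_zero; last exact: restr_nonroot.
  rewrite big_pred0 // => r'; apply/negP => /andP[_ /eqP eqr].
  by move: nroot; rewrite -eqr rt_id eqxx.
have connE x : conn F' r x = conn F r x.
  apply/idP/idP => [cx|]; last exact: conn_sub.
  have nc : ~~ conn F' r (src g) by rewrite -rt_eq root.
  have gF' : g \in F' by apply: setU11.
  case: (conn_add cx) => // -[c1 _]; case/negP: nc; first exact: conn_sub c1.
  by rewrite -conn_tgt //; apply: conn_sub c1.
rewrite (bigD1 (rt F r)) /=; last first.
  have -> : rt F' (rt F r) = r by rewrite rt_sub.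
  by rewrite neR eqxx.
rewrite big1 => [|r' /andP[/andP[_ /eqP eqr'] ne]]; last first.
  apply: cl_zero; apply: restr_nonroot; apply: contraNneq ne => <-.
  by rewrite rt_eq conn_sym -connE -rt_eq root eqr'.
rewrite mulcC mul1c; have -> : restr F M (rt F r) = restr F' M r.
  apply/ffunP => e; rewrite !ffunE -{2}root !rt_eq.
  by rewrite conn_sym -connE conn_sym.
apply/esym/(@cl_stable F F' fF' sF _ r) => e; rewrite ffunE.
case: eqP => // eqr me; split; first exact: sM.
by rewrite -connE -rt_eq root eqr.
Qed.

Lemma total_cl_addD g F M : let R := rt (g |: F) (src g) in
  total_cl F M = mulc (\big[mulc/Free]_(r | rt (g |: F) r == R) cl F (restr F M r))
    (\big[mulc/Free]_(r | rt (g |: F) r != R) cl F (restr F M r)).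
Proof. by move=> R; rewrite /total_cl (bigID (fun r => rt (g |: F) r == R)). Qed.

Section OneForest.
Variable F : {set E}.
Hypothesis fF : forest F.

(** Each edge corresponds to its end farther from a fixed root. *)
Lemma comp_card r : rt F r = r ->
  #|[set v | rt F v == r]| = #|[set e in F | rt F (src e) == r]|.+1.
Proof.
move=> root; rewrite (cardsD1 r) inE root eqxx /= add1n; congr _.+1.
have ec e : e \in F -> rt F (src e) == r -> conn F r (src e).
  by move=> eF /eqP eqr; rewrite -rt_eq root eqr.
have se e : e \in F -> rt F (src e) == r -> sep F e r (far F r e).
  by move=> eF /(ec _ eF) ce; case: (nfP fF eF ce).
rewrite -[RHS](@card_in_imset _ _ (far F r)); last first.
  move=> e f; rewrite !inE => /andP[eF er] /andP[fF' fr].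
  by move=> eqf; apply: (far_inj fF (se _ eF er) (se _ fF' fr) eqf).
apply: eq_card => v; rewrite !inE; apply/andP/imsetP.
  case=> nvr /eqP vr; have cvr : conn F v r by rewrite -rt_eq root vr.
  have [e /andP[s i]] := first_ex fF cvr nvr; exists e.
    rewrite inE (sep_in s) /=; have := sep_conn_src s.
    by rewrite -rt_eq vr => /eqP->.
  by apply: farE; rewrite // sep_sym.
case=> e; rewrite inE => /andP[eF er] ->; have s := se _ eF er.
split; first by rewrite eq_sym (sep_neq s).
by rewrite eq_sym -{1}root rt_eq (sep_conn s).
Qed.

(** * Extending a marked forest

These are the moves showing that maximal marked forests are large. *)

(** The outer end of each edge is its far end as seen from the other one. *)
Lemma outer e1 e2 : e1 \in F -> e2 \in F -> conn F (src e1) (src e2) ->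
  exists x z, first F x z e1 /\ first F z x e2.
Proof.
move=> e1F e2F cc; have [->|ne] := eqVneq e1 e2.
  have s : sep F e2 (src e2) (tgt e2) by rewrite sep_edge.
  exists (src e2), (tgt e2); rewrite /first [sep F e2 (tgt e2) _]sep_sym s /inc !eqxx.
  by rewrite orbT.
have c21 : conn F (src e2) (src e1) by rewrite conn_sym.
set x := far F (src e2) e1; have [_ s1] := nfP fF e1F c21.
have cx2 : conn F x (src e2) by rewrite conn_sym (sep_conn s1).
have [_ s2] := nfP fF e2F cx2; set z := far F x e2 in s2.
exists x, z; rewrite /first {1}/x !inc_far !andbT sep_sym in s2 *.
rewrite sep_sym in s2; rewrite (sep_sym _ _ z) s2; split=> //.
rewrite (sep_xor fF e1 cx2); last first.
  apply: (conn_trans (y := x)); first by rewrite conn_sym.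
  exact: sep_conn s2.
rewrite sep_sym s1 /z /far; case: ifP => _; rewrite ?sep_refl //.
by rewrite sep_edge // (negbTE ne).
Qed.

(** If exactly one end of [e] has colour [k], take the other end for [w]; if both ends
or none of them have it, take for [w] a vertex of the component that differs from
them in this respect. *)
Lemma ext2 k e a b : e \in F -> conn F a (src e) -> conn F b (src e) ->
  col a = k -> col b != k ->
  exists f x w, [/\ f \in F, first F x w e, first F w x f & (col x == k) != (col w == k)].
Proof.
move=> eF ca cb cak cbk.
have ct : conn F (tgt e) (src e) by rewrite conn_sym conn_edge.
have cs : conn F (src e) (src e) by rewrite conn_refl.
have [w [cw ne]] : exists w, conn F w (src e) /\ (col (far F w e) == k) != (col w == k).
  case h1: (col (src e) == k); case h2: (col (tgt e) == k).
  - exists b; split=> //; rewrite (negbTE cbk) /far.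
    by case: ifP => _; rewrite ?h1 ?h2.
  - exists (src e); split=> //; have -> : far F (src e) e = tgt e.
      by apply/esym/farE; rewrite /inc ?eqxx ?orbT // sep_edge.
    by rewrite h1 h2.
  - exists (src e); split=> //; have -> : far F (src e) e = tgt e.
      by apply/esym/farE; rewrite /inc ?eqxx ?orbT // sep_edge.
    by rewrite h1 h2.
  - exists a; split=> //; rewrite cak eqxx /far.
    by case: ifP => _; rewrite ?h1 ?h2.
have [_ s] := nfP fF eF cw; have fx := first_far fF s.
have nwx : w != far F w e by apply: sep_neq s.
have [f ff] := first_ex fF (sep_conn s) nwx.
exists f, (far F w e), w; split=> //; by case/andP: ff => /sep_in.
Qed.

Lemma cl_big N : big_mark F N -> rk (cl F N) = 2 /\ deg N = 3.
Proof.
case=> [[s [t [v [d ->]]]]|[u [v [w [d ->]]]]].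
  by rewrite cl_mark3p // (deg_mark3p fF d); case: ifP.
by rewrite cl_mark3t // (deg_mark3t fF d).
Qed.

(** The vertex [v] provides the third edge. *)
Lemma ext3_mid s t v e f : pair_data F s t -> onpath F s t v ->
  col v != col s -> col v != col t -> first F s t e -> first F t s f ->
  exists h, h \in F /\ big_mark F (mset [:: h; e; f]).
Proof.
move=> d o cs ct fe ff.
have pd : path_data F s t v.
  rewrite /path_data d o /=; case: (v =P t) => [eqv|_]; last by rewrite cs.
  by rewrite eqv eqxx in ct.
have [e' [f' [h [fe' ff' lh eqm]]]] := path_ex fF pd.
have ee := first_uniq fF fe fe'; have ef := first_uniq fF ff ff'; subst e' f'.
exists h; split; first by case/and3P: lh => /sep_in.
left; exists s, t, v; split=> //; rewrite eqm; apply/eqP; rewrite mset_perm.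
by rewrite -cat1s perm_catC.
Qed.

Lemma last_adj s v y e : first F v s e -> col (near F s e) != y -> last_before F s v y e.
Proof.
move=> /andP[se ie] ny; have s' : sep F e s v by rewrite sep_sym.
rewrite /last_before s' ny -(farE fF ie s') /=; apply/forallP => f.
by rewrite sep_refl.
Qed.

(** When the third colour does not occur between [s] and [t], the pair mark extends
to one containing the third vertex [r]: either [t] or [s] lies on the path
between [r] and the other end, or there is a tripod. In each case the first edge
from [r] towards [s] completes the mark. *)
Lemma ext3_end s t r e f h : pair_data F s t -> link (col s) (col t) != L12 ->
  conn F s r -> col r != col s -> col r != col t ->
  (forall v, onpath F s t v -> col v != col r) ->
  first F s t e -> first F t s f -> first F r s h -> big_mark F (mset [:: h; e; f]).
Proof.
move=> d nl csr crs crt npath fe ff fh.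
have [lt cst] := andP d; have cts : conn F t s by rewrite conn_sym.
have crs' : conn F r s by rewrite conn_sym.
have ctr : conn F t r := conn_trans cts csr.
have crt' : conn F r t by rewrite conn_sym.
have c0 : col s = Col0 by move: lt nl; case: (col s); case: (col t).
have [se ie] := andP fe; have [sf jf] := andP ff; have [sh ih] := andP fh.
have npe : col (near F t e) != col r by apply/npath; rewrite onpath_sym //; apply: onpath_near; rewrite // sep_sym.
have npf : col (near F s f) != col r by apply/npath/onpath_near; rewrite // sep_sym.
have [ot|nt] := boolP (onpath F s r t).
  have pd : path_data F s r t.
    rewrite /path_data /pair_data csr ot c0 /=; have [tr|_] := eqVneq t r.
      by move: crt; rewrite tr eqxx.
    by rewrite -c0 eq_sym clt_neq //= eq_sym crt andbT; move: crs; rewrite c0; case: (col r).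
  left; exists s, r, t; split=> //.
  rewrite (mark3pE fF (first_onpath ot fe) fh (last_adj ff npf)).
  exact: mset_swap12.
have [os|ns] := boolP (onpath F t r s).
  have nsr : s != r by apply: contraNneq crs => ->.
  have ftr : first F t r f := first_onpath os ff.
  have os' : onpath F r t s by rewrite onpath_sym.
  have frt : first F r t h := first_onpath os' fh.
  case ct: (col t) => //; first by rewrite c0 ct in lt.
    have pd : path_data F t r s.
      rewrite /path_data /pair_data ctr os ct (negbTE nsr) c0 /= andbT.
      by move: crs crt; rewrite c0 ct; case: (col r).
    left; exists t, r, s; split=> //.
    rewrite (mark3pE fF ftr frt (last_adj fe npe)).
    by rewrite mset_swap23 mset_swap12 mset_swap23 mset_swap12 mset_swap23.
  have cr1 : col r = Col1 by move: crs crt; rewrite c0 ct; case: (col r).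
  (* the candidates for the third vertex: the vertices beyond [e] that are
     coloured 0, or [t] itself; take the one closest to [e] *)
  have sert : sep F e r t.
    by apply: (onpathP' fF crt' os').
  have fre : near F r e = s.
    apply/esym/nearE => //; first exact: sep_in se.
    have [_] := onpath_excl fF e crt' os'; rewrite se andbT; exact: negbTE.
  pose P x := [&& onpath F r t x, sep F e r x & (col x == Col0) || (x == t)].
  have Pt : P t.
    rewrite /P sert eqxx orbT !andbT /onpath crt' /=; apply/forallP => g; exact: implybb.
  pose m x := #|[set g | sep F g r x]|.
  case: (@arg_minnP _ t P m Pt) => v /and3P[ov sev colv] minv.
  have crv := proj1 (andP ov).
  have lv : last_before F r v (col t) e.
    rewrite /last_before sev fre c0 ct /=; apply/forallP => g; apply/implyP => sg.
    have sgv : sep F g r v by rewrite (sep_cut fF g sev).1 sg !orbT.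
    have sep_ : sep F e r (near F r g) by rewrite -(path_order fF sev sgv).
    have op : onpath F r v (near F r g) := onpath_near fF sgv.
    have opt := onpath_trans ov op.
    have n0 : col (near F r g) != Col0.
      apply/negP => col0; have := minv (near F r g); rewrite /P opt sep_ col0 /= => /(_ isT).
      rewrite leqNgt => /negP[]; apply/proper_card/properP; split.
        by apply/subsetP => x; rewrite !inE; apply: onpathP op.
      by exists g; rewrite inE // (sep_near fF sgv).
    have opst : onpath F s t (near F r g).
      have op' : onpath F t r (near F r g) by rewrite onpath_sym.
      case/orP: (onpath_total fF os op') => o.
        by rewrite onpath_sym.
      have et : sep F e t s by rewrite sep_sym.
      have etp := onpathP o et; rewrite sep_sym in etp.
      by move: sert; rewrite (sep_xor fF e (proj1 (andP op)) (sep_conn etp)) sep_ etp.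
    have := npath _ opst; rewrite cr1; move: n0; by case: (col _).
  left; exists r, t, v; split.
    rewrite /path_data /pair_data crt' ov cr1 ct /=.
    by case: (v =P t) colv => // _; rewrite orbF => /eqP->.
  rewrite (mark3pE fF frt ftr lv) mset_swap23.
  by [].
have nr : ~~ onpath F s t r by apply/negP => /npath; rewrite eqxx.
have e2 : first F s r e by apply: (not_onpath fF csr fe).
have f2 : first F t r f by apply: (not_onpath fF ctr ff).
have h2 : first F r t h by apply: (not_onpath fF crt' fh).
right; case ct: (col t); first by rewrite c0 ct in lt.
  exists s, t, r; split; last first.
    rewrite (mark3tE fF fe f2 fh) mset_swap12.
    by rewrite mset_swap23.
  rewrite /tripod_data c0 ct cst csr nr nt /=.
  have ns' : ~~ onpath F t r s by [].
  by rewrite ns' andbT; move: crs crt; rewrite c0 ct; case: (col r).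
exists s, r, t; split; last first.
  rewrite (mark3tE fF e2 h2 ff).
  exact: mset_swap12.
rewrite /tripod_data c0 ct cst csr nr nt /= onpath_sym // ns !andbT.
by move: crs crt; rewrite c0 ct; case: (col r).
Qed.

End OneForest.

(** The two pairs of colours are different, hence connect all three. *)
Lemma link_Full a b x z k : a != b -> a != k -> b != k -> (x == k) != (z == k) ->
  mulc (link a b) (link x z) = Full.
Proof. by case: a b x z k => -[] [] [] []. Qed.

(** * Maximal marked forests *)

Definition addm M e : {ffun E -> nat} := [ffun x => M x + (x == e)].

Lemma addm_mset l e : addm (mset l) e = mset (e :: l).
Proof. by apply/ffunP => x; rewrite !ffunE /= addnC eq_sym. Qed.

Lemma restr_addm F M e r : restr F (addm M e) r =
  if rt F (src e) == r then addm (restr F M r) e else restr F M r.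
Proof.
case: ifP => er; apply/ffunP => x; rewrite !ffunE;
  by have [->|ne] := eqVneq x e; rewrite ?er ?addn0.
Qed.

Lemma inX_addm F M e : inX F M -> e \in F ->
  mulc (cl F (addm (restr F M (rt F (src e))) e))
    (\big[mulc/Free]_(r | r != rt F (src e)) cl F (restr F M r)) != Bad ->
  inX F (addm M e).
Proof.
move=> /and3P[fF /forallP sM _] eF nb; rewrite /inX fF /=; apply/andP; split.
  apply/forallP => x; apply/implyP; rewrite ffunE addn_gt0 => /orP[/(implyP (sM x))//|].
  by case: eqP => // ->.
rewrite (total_cl_split _ _ (rt F (src e))) restr_addm eqxx.
rewrite (eq_bigr (fun r => cl F (restr F M r))) // => r ne.
by rewrite restr_addm eq_sym (negbTE ne).
Qed.

Lemma cl_Free F N : cl F N = Free -> deg N <= 1.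
Proof.
case: (clP F N) => // [s t /andP[/clt_neq]|s t v _ _].
  by case: (col s); case: (col t).
by case: ifP.
Qed.

(** The weight of a mark exceeds the rank of its class by one: this is why degrees
depend only on ranks. *)
Lemma deg_rk F N : forest F -> cl F N != Bad -> 0 < deg N -> deg N = (rk (cl F N)).+1.
Proof.
move=> fF; case: (clP F N) => // [le _|s t d -> _ _|s t v d -> _ _|u v w d -> _ _].
- by case: (deg N) le => // -[].
- rewrite (deg_mark2 fF d); case/andP: d => /clt_neq + _.
  by case: (col s); case: (col t).
- by rewrite (deg_mark3p fF d); case: ifP.
- by rewrite (deg_mark3t fF d).
Qed.

Lemma rk_big (I : finType) (P : pred I) (f : I -> cls) :
  \big[mulc/Free]_(i | P i) f i != Bad ->
  rk (\big[mulc/Free]_(i | P i) f i) = \sum_(i | P i) rk (f i).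
Proof.
elim/big_rec2: _ => // i n x Pi IH nb; rewrite rk_mul //.
by rewrite IH //; case: (mulc_Bad nb).
Qed.

Lemma big_rk0 (I : finType) (P : pred I) (f : I -> cls) :
  \big[mulc/Free]_(i | P i) f i = Free -> forall i, P i -> f i = Free.
Proof.
move=> eqF i Pi; have nb : \big[mulc/Free]_(i | P i) f i != Bad by rewrite eqF.
have := rk_big nb; rewrite eqF => /esym/eqP; rewrite sum_nat_eq0.
by move=> /forall_inP/(_ i Pi); case: (f i).
Qed.

Lemma big_rk1 (I : finType) (f : I -> cls) :
  rk (\big[mulc/Free]_i f i) = 1 ->
  exists2 j, f j = \big[mulc/Free]_i f i & forall i, i != j -> f i = Free.
Proof.
move=> r1; have nb : \big[mulc/Free]_i f i != Bad by case: (bigop.body _ _ _) r1.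
have := rk_big nb; rewrite r1 => sum1.
have [j nj] : exists j, f j != Free.
  apply/existsP; apply: contraPT sum1; rewrite negb_exists => /forallP h.
  by rewrite big1 // => i _; have := h i; rewrite negbK => /eqP->.
move: nb r1; rewrite (bigD1 j) //= => nb r1.
have eqF : \big[mulc/Free]_(i | i != j) f i = Free.
  move: (rk_mul nb) (nb) nj; rewrite r1.
  by case: (f j); case: (\big[_/_]_(i | _) _).
exists j; first by rewrite eqF; case: (f j).
by move=> i ne; apply: big_rk0 eqF _ ne.
Qed.

Lemma onpath_conn F' F s t v : forest F -> F' \subset F -> conn F' s t ->
  onpath F s t v -> conn F' s v.
Proof.
move=> fF sF cst o; have [->|ne] := eqVneq v s; first exact: conn_refl.
have cvs : conn F v s by rewrite conn_sym (proj1 (andP o)).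
have [g /andP[sg ig]] := first_ex fF cvs ne.
have sgt : sep F' g s t by rewrite (sep_stable _ fF sF) //; apply: onpathP o _; rewrite sep_sym.
exact: sep_inc_conn sgt ig.
Qed.

(** The vertices that no forest can touch. *)
Definition isolated x := [forall g, inc g x ==> (src g == tgt g)].

Lemma deg_restr F M : deg M = \sum_r deg (restr F M r).
Proof.
rewrite /deg exchange_big /=; apply: eq_bigr => e _.
rewrite (bigD1 (rt F (src e))) //= ffunE eqxx big1 ?addn0 // => r ne.
by rewrite ffunE eq_sym (negbTE ne).
Qed.

Lemma roots_card F : forest F -> #|V| = #|F| + #|[set r | rt F r == r]|.
Proof.
move=> fF.
have part (I : finType) (p : I -> V) (A : {set I}) : (forall i, i \in A -> rt F (p i) == p i) ->
    #|A| = \sum_(r | rt F r == r) #|[set i in A | p i == r]|.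
  move=> root; rewrite -sum1_card (partition_big p (fun r => rt F r == r)) //.
  by apply: eq_bigr => r _; rewrite -sum1_card; apply: eq_bigl => i; rewrite inE.
rewrite -cardsT (part _ (rt F)); last by move=> v _; rewrite rt_id.
rewrite [#|F|](part _ (fun e => rt F (src e))); last by move=> e _; rewrite rt_id.
rewrite -[#|[set r | _]|]sum1_card [X in _ + X](eq_bigl (fun r => rt F r == r)); last by move=> r; rewrite inE.
rewrite -big_split /=; apply: eq_bigr => r /eqP root; rewrite addn1 -comp_card //.
by apply: eq_card => v; rewrite !inE.
Qed.

(** Maximality under multiplication by a variable. *)
Definition maximalX F M := [/\ inX F M, forall g, g \notin F -> ~~ inX (g |: F) M
  & forall e, e \in F -> ~~ inX F (addm M e)].

Lemma big_nBad (I : finType) (P : pred I) (f : I -> cls) i :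
  \big[mulc/Free]_(j | P j) f j != Bad -> P i -> f i != Bad.
Proof. by move=> nb Pi; move: nb; rewrite (bigD1 i) //= => /mulc_Bad[]. Qed.

Lemma inX_le3 F M e : inX F M -> M e <= 3.
Proof.
case/and3P=> fF _ nb; set r := rt F (src e).
have -> : M e = restr F M r e by rewrite ffunE eqxx.
apply: (@leq_trans (deg (restr F M r))); first by rewrite /deg (bigD1 e) //= leq_addr.
have nbr := big_nBad nb (isT : xpredT r).
case: (posnP (deg (restr F M r))) => [->//|/(deg_rk fF nbr)->].
by case: (cl _ _) nbr.
Qed.

Lemma inX_subset F F' M : inX F M -> F' \subset F ->
  (forall e, e \in F :\: F' -> M e = 0) -> inX F' M.
Proof.
have [k] := ubnP #|F :\: F'|; elim: k F => [F|k IH F]; first by rewrite ltn0 => /notF[].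
rewrite ltnS => le X sF zero.
have [eq0|[e eD]] := set_0Vmem (F :\: F').
  by have -> : F' = F; [apply/eqP; rewrite eqEsubset sF -setD_eq0 eq0 eqxx|].
have [eF neF'] : e \in F /\ e \notin F' by move: eD; rewrite inE => /andP[].
have eqD : (F :\ e) :\: F' = (F :\: F') :\ e by rewrite !setDDl setUC.
apply: (IH (F :\ e)) => [|||f].
- by rewrite eqD; move: le; rewrite (cardsD1 e (F :\: F')) eD.
- by apply: inX_del => //; apply: zero.
- by rewrite subsetD1 sF neF'.
by rewrite eqD inE => /andP[_ /zero].
Qed.

Section Maximal.
Variables (F : {set E}) (M : {ffun E -> nat}).
Hypothesis maxM : maximalX F M.
Let X : inX F M. Proof. by case: maxM. Qed.
Let mg g : g \notin F -> ~~ inX (g |: F) M. Proof. by case: maxM => _ + _; apply. Qed.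
Let me e : e \in F -> ~~ inX F (addm M e). Proof. by case: maxM => _ _; apply. Qed.
Let fF : forest F. Proof. by case/and3P: X. Qed.
Let sM e : 0 < M e -> e \in F. Proof. by case/and3P: X => _ /forallP/(_ e)/implyP. Qed.
Let nbad : total_cl F M != Bad. Proof. by case/and3P: X. Qed.

Lemma inX_add g : g \notin F -> ~~ conn F (src g) (tgt g) ->
  mulc (cl (g |: F) (restr (g |: F) M (rt (g |: F) (src g))))
    (\big[mulc/Free]_(r | rt (g |: F) r != rt (g |: F) (src g)) cl F (restr F M r)) = Bad.
Proof.
move=> gF nc; have fF' := forest_add fF nc; apply/eqP.
have := mg gF; rewrite /inX fF' (total_cl_add fF' gF sM) /= negb_and negbK.
case/orP=> //; rewrite negb_forall => /existsP[e]; rewrite negb_imply => /andP[/sM eF].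
by rewrite in_setU eF orbT.
Qed.

(** A vertex on a non-loop is covered: otherwise that edge could be added to the
forest, the component of its other end keeping the same marks. *)
Lemma max_touch g x : inc g x -> src g != tgt g -> exists2 f, f \in F & inc f x.
Proof.
move=> ig nl; apply/exists_inP; apply: contraT; rewrite negb_exists => /forallP nf.
have nx f : f \in F -> ~~ inc f x by move=> h; have := nf f; rewrite h.
have isox z : conn F z x -> z = x.
  move=> cz; apply: (conn_ind (P := fun z => z = x)) (_ : conn F x z) _ => //; last by rewrite conn_sym.
  move=> e /nx; rewrite /inc negb_or => /andP[n1 n2].
  by split=> h; [move: n1|move: n2]; rewrite h eqxx.
have gF : g \notin F by apply/negP => /nx; rewrite ig.
have [y [neq yE]] : exists y, y != x /\ ((src g = x /\ tgt g = y) \/ (src g = y /\ tgt g = x)).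
  case/orP: ig => /eqP xg; [exists (tgt g)|exists (src g)]; split; auto; rewrite xg //.
  by rewrite eq_sym.
have nc : ~~ conn F (src g) (tgt g).
  apply/negP; case: yE => -[-> ->]; last by move=> /isox /eqP; rewrite (negbTE neq).
  by rewrite conn_sym => /isox /eqP; rewrite (negbTE neq).
have := inX_add gF nc; set F' := g |: F; set R := rt F' (src g).
have sF : F \subset F' by apply: subsetUr.
have gF' : g \in F' by apply: setU11.
have fF' := forest_add fF nc.
have cyg : conn F' y (src g).
  case: yE => -[sy ty]; last by rewrite sy conn_refl.
  by rewrite -ty conn_sym; apply: conn_edge.
have eqN : restr F' M R = restr F M (rt F y).
  apply/ffunP => e; rewrite !ffunE !rt_eq; case: (posnP (M e)) => [->|pos]; first by do 2!case: ifP.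
  congr (if _ then _ else _); have eF := sM pos.
  have nex : src e != x by have := nx _ eF; rewrite /inc negb_or eq_sym => /andP[].
  apply/idP/idP => [c1|c1]; last by apply: conn_trans (conn_sub sF c1) cyg.
  have : conn F' (src e) y by apply: conn_trans c1 _; rewrite conn_sym.
  case/conn_add=> // -[]; case: yE => -[-> ->] // /isox /eqP; by rewrite (negbTE nex).
rewrite eqN => h; case/negP: nbad; rewrite (total_cl_addD g).
rewrite (bigD1 (rt F y)) /=; last by rewrite rt_sub // rt_eq.
have -> : cl F (restr F M (rt F y)) = cl F' (restr F M (rt F y)).
  apply: (@cl_stable F F' fF' sF _ y) => e; rewrite ffunE.
  by case: eqP => // eqr /sM; split=> //; rewrite -rt_eq eqr.
by rewrite [mulc (cl _ _) _]mulcC -mulcA h; case: (bigop.body _ _ _).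
Qed.

Lemma max_mark e : e \in F -> 0 < deg (restr F M (rt F (src e))).
Proof.
move=> eF; rewrite lt0n; apply/eqP => /deg0 d0; have := me eF.
apply/negP; rewrite negbK; apply: inX_addm => //; move: nbad.
by rewrite (total_cl_split _ _ (rt F (src e))) d0 addm_mset !cl_small ?deg_mset.
Qed.

Lemma mark_at g x : inc g x -> src g != tgt g ->
  exists e, [/\ e \in F, 0 < M e & conn F x (src e)].
Proof.
move=> ig nl; have [f f_F jf] := max_touch ig nl.
have := max_mark f_F; rewrite lt0n sum_nat_eq0 => /forall_inPn[e _].
rewrite ffunE rt_eq; case: ifP => // ce; rewrite -lt0n => pos.
exists e; split; rewrite ?sM // conn_sym; apply: conn_trans ce _.
by rewrite (inc_conn _ f_F jf) conn_refl.
Qed.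

(** In a maximal marked forest every component with an edge has a mark, so its
weight is one more than its rank; the other components are the isolated vertices.
The degree is then computed from the number of components. *)
Lemma max_deg : #|F| + deg M + #|[set x | isolated x]| = #|V| + rk (total_cl F M).
Proof.
pose nt r := (rt F r == r) && [exists e in F, rt F (src e) == r].
have degE r : deg (restr F M r) = rk (cl F (restr F M r)) + nt r.
  have [/andP[_ /exists_inP[e eF /eqP eqr]]|ntr] := boolP (nt r); last first.
    have -> : restr F M r = mset [::]; last by rewrite cl_small deg_mset.
    apply/ffunP => e; rewrite !ffunE; case: eqP => // eqr; apply/eqP; rewrite -leqn0 leqNgt.
    apply: contra ntr => /sM eF; rewrite /nt -{1 2}eqr rt_id eqxx /=.
    by apply/exists_inP; exists e; rewrite ?eqr.
  rewrite addn1; apply: deg_rk => //; last by rewrite -eqr max_mark.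
  by move: nbad; rewrite (total_cl_split _ _ r) => /mulc_Bad[].
have cnt (P : pred V) : \sum_r (P r : nat) = #|[set r | P r]|.
  rewrite -sum1_card [RHS]big_mkcond; apply: eq_bigr => r _; rewrite inE.
  by case: (P r).
rewrite (deg_restr F) (eq_bigr _ (fun r _ => degE r)) big_split /= -rk_big // (roots_card fF).
rewrite cnt; have := cardsID [set r | [exists e in F, rt F (src e) == r]] [set r | rt F r == r].
have -> : [set r | rt F r == r] :&: [set r | [exists e in F, rt F (src e) == r]] = [set r | nt r].
  by apply/setP => r; rewrite !inE.
have -> : [set r | rt F r == r] :\: [set r | [exists e in F, rt F (src e) == r]] = [set x | isolated x].
  apply/setP => x; rewrite !inE; apply/andP/forallP => [[ne root] g|iso].
    apply/implyP => ig; apply: contraT => nl; have [f f_F jf] := max_touch ig nl.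
    case/negP: ne; apply/exists_inP; exists f => //; rewrite -(eqP root) rt_eq.
    by rewrite (inc_conn _ f_F jf) conn_refl.
  have nx e : e \in F -> ~~ inc e x.
    move=> eF; apply/negP => ie; have := implyP (iso e) ie => /eqP eqe.
    by move/forestP: fF => /(_ e eF); rewrite eqe conn_refl.
  have isox z : conn F x z -> z = x.
    move=> cz; apply: (conn_ind (P := fun z => z = x)) cz _ => //.
    move=> e /nx; rewrite /inc negb_or => /andP[n1 n2].
    by split=> h; [move: n1|move: n2]; rewrite h eqxx.
  split; last by apply/eqP/isox/conn_rt.
  apply/exists_inP => -[e eF /eqP eqr]; have := nx e eF; rewrite /inc.
  have <- : src e = x; last by rewrite eqxx.
  by apply: isox; rewrite -eqr conn_sym conn_rt.
rewrite /total_cl; lia.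
Qed.

Let others_Free (R : V) : (forall r, r != R -> cl F (restr F M r) = Free) ->
  \big[mulc/Free]_(r | r != R) cl F (restr F M r) = Free.
Proof. by move=> h; rewrite big1. Qed.

Lemma restr_one r e : cl F (restr F M r) = Free -> rt F (src e) = r -> 0 < M e ->
  restr F M r = mset [:: e].
Proof.
move=> /cl_Free le er pos; apply/esym/deg_eq => [x|].
  rewrite !ffunE /= addn0; case: (eqVneq e x) => [<-|//]; by rewrite er eqxx.
apply/eqP; rewrite eqn_leq deg_mset /= le andbT.
by rewrite /deg (bigD1 e) //= ffunE er eqxx ltn_addr.
Qed.

Lemma restr_join g r1 r2 : g \notin F -> ~~ conn F (src g) (tgt g) ->
  rt F (src g) = r1 -> rt F (tgt g) = r2 -> forall e,
  restr (g |: F) M (rt (g |: F) (src g)) e = restr F M r1 e + restr F M r2 e.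
Proof.
move=> gF nc <- <- e; rewrite !ffunE !rt_eq.
case: (posnP (M e)) => [->|pos]; first by do 3!case: ifP.
have -> : conn (g |: F) (src e) (src g) = conn F (src e) (src g) || conn F (src e) (tgt g).
  have gin : g \in g |: F by apply: setU11.
  apply/idP/orP => [/conn_add[->|[-> _]|[-> _]]|[|] c1]; auto.
    exact: conn_sub (subsetUr _ _) c1.
  by rewrite -conn_tgt //; apply: conn_sub (subsetUr _ _) c1.
case c1: (conn F (src e) (src g)); case c2: (conn F (src e) (tgt g)); rewrite /= ?addn0 //.
by case/negP: nc; apply: conn_trans c2; rewrite conn_sym.
Qed.

(** Without pair marks, all components have a single mark. A component with two
colours could be given a second one, and an edge joining components of different
colours could be added, the two marks becoming a pair mark. *)
Lemma max_rk0 : rk (total_cl F M) = 0 -> forall g, col (src g) = col (tgt g).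
Proof.
move=> rk0; have tF : total_cl F M = Free by case: (total_cl F M) rk0.
have allF r : cl F (restr F M r) = Free by apply: (big_rk0 tF).
have lone e : 0 < M e -> restr F M (rt F (src e)) = mset [:: e].
  by move=> pos; apply: restr_one.
have A0 a b e : e \in F -> 0 < M e -> conn F a (src e) -> conn F b (src e) -> col a = col b.
  move=> eF pos ca cb; apply/eqP; apply: contraT => ne; rewrite eq_sym in ne.
  have [f [x [w [f_F fx fw nk]]]] := ext2 fF eF ca cb (erefl _) ne.
  have nxw : col x != col w by apply: contraNneq nk => ->.
  have [s [t [d eqm _]]] := mark2_mset fF (sep_conn (proj1 (andP fx))) nxw fx fw.
  have cef : rt F (src f) = rt F (src e).
    apply/rtP; have [sx ix] := andP fx; have [sw iw] := andP fw.
    rewrite conn_sym -(inc_conn _ f_F iw).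
    by apply: conn_trans (sep_conn sx); rewrite (inc_conn _ eF ix) conn_refl.
  have := me f_F; apply: contraNT => _; apply: inX_addm => //.
  rewrite cef lone // addm_mset others_Free //.
  have -> : mset [:: f; e] = mset [:: e; f].
    by apply/ffunP => z; rewrite !ffunE /= addnCA.
  by rewrite eqm cl_mark2 //; case/andP: d => /clt_neq; case: (col s); case: (col t).
move=> g; apply/eqP; apply: contraT => ne.
have nl : src g != tgt g by apply: contraNneq ne => ->.
have ig1 : inc g (src g) by rewrite /inc eqxx.
have ig2 : inc g (tgt g) by rewrite /inc eqxx orbT.
have [e1 [e1F p1 c1]] := mark_at ig1 nl.
have [e2 [e2F p2 c2]] := mark_at ig2 nl.
have [cg|nc] := boolP (conn F (src g) (tgt g)).
  have cg' : conn F (tgt g) (src e1) by apply: conn_trans c1; rewrite conn_sym.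
  by rewrite (A0 _ _ _ e1F p1 c1 cg') eqxx in ne.
have gF : g \notin F by apply: contra nc => ?; apply: conn_edge.
have fF' := forest_add fF nc; have sF : F \subset g |: F by apply: subsetUr.
have gin : g \in g |: F by apply: setU11.
have e1F' := subsetP sF _ e1F; have e2F' := subsetP sF _ e2F.
have c12 : conn (g |: F) (src e1) (src e2).
  apply: (conn_trans (y := src g)); first by rewrite conn_sym (conn_sub sF c1).
  by apply: (conn_trans (conn_edge gin)); apply: conn_sub sF c2.
have [x [z [fx fz]]] := outer fF' e1F' e2F' c12.
have cx : col x = col (src g).
  apply: (A0 _ _ _ e1F p1 _ c1); have [_ ix] := andP fx.
  by rewrite conn_sym (inc_conn _ e1F ix) conn_refl.
have cz : col z = col (tgt g).
  apply: (A0 _ _ _ e2F p2 _ c2); have [_ iz] := andP fz.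
  by rewrite conn_sym (inc_conn _ e2F iz) conn_refl.
have nxz : col x != col z by rewrite cx cz.
have [s [t [d eqm _]]] := mark2_mset fF' (sep_conn (proj1 (andP fx))) nxz fx fz.
have eqN : restr (g |: F) M (rt (g |: F) (src g)) = mark2 (g |: F) s t.
  rewrite -eqm; apply/ffunP => e.
  by rewrite (restr_join gF nc (rtP c1) (rtP c2)) !lone // !ffunE /= !addn0.
have := inX_add gF nc; rewrite eqN cl_mark2 // big1 //.
by case/andP: d => /clt_neq; case: (col s); case: (col t).
Qed.

(** With a single pair mark, of ends [s] and [t], any edge showing a further pair of
colours can be exploited. If the colours of [s] and [t] are 1 and 2, the mark can
grow to one of class [Star]. Otherwise let [k] be a colour that occurs in such an
edge and is not that of [s] or [t]. A component containing [k] and another colour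
can receive one more mark; and if there is none, the edge joins a component
coloured [k] to another one, and adding it creates a pair mark or extends the
existing one. *)
Lemma max_rk1 : rk (total_cl F M) = 1 -> total_cl F M != L12 /\
  forall g, col (src g) = col (tgt g) \/ link (col (src g)) (col (tgt g)) = total_cl F M.
Proof.
move=> rk1; have [R0 clR0 others] := big_rk1 rk1.
rewrite -/(total_cl F M) in clR0.
have [s [t [d eqN eqp]]] : exists s t, [/\ pair_data F s t,
    restr F M R0 = mark2 F s t & total_cl F M = link (col s) (col t)].
  move: rk1; rewrite -clR0; case: (clP F (restr F M R0)) => // [s t|s t v _ _].
    by exists s, t.
  by case: ifP.
have [lt cst] := andP d.
have [e0 [f0 [fe0 ff0 eqm]]] := pair_ex fF d.
have e0F : e0 \in F by case/andP: fe0 => /sep_in.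
have cse0 : conn F s (src e0) by case/andP: fe0 => /sep_conn_src.
have M0 : 0 < restr F M R0 e0 by rewrite eqN eqm mset_in inE eqxx.
have re0 : rt F (src e0) = R0 by move: M0; rewrite ffunE; case: eqP.
have rs : rt F s = R0 by rewrite -re0; apply: rtP.
have upd h : h \in F -> rt F (src h) = R0 -> cl F (mset [:: h; e0; f0]) = Bad.
  move=> hF rh; apply/eqP; have := me hF; apply: contraNT => nb; apply: inX_addm => //.
  by rewrite rh others_Free // eqN eqm addm_mset mulcC mul1c.
have updB h : h \in F -> rt F (src h) = R0 -> ~ big_mark F (mset [:: h; e0; f0]).
  by move=> hF rh /(cl_big fF)[]; rewrite upd.
have p12 : total_cl F M != L12.
  apply/eqP => t12; have pd : path_data F s t t.
    rewrite /path_data d eqxx -eqp t12 eqxx andbT /= /onpath cst /=.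
    by apply/forallP => z; exact: implybb.
  have [e [f [k [fe ff lk eqk]]]] := path_ex fF pd.
  have ee := first_uniq fF fe0 fe; have ef := first_uniq fF ff0 ff; subst e f.
  have sk := path_sub pd fe ff lk (mem_last _ _).
  apply: (updB k); first exact: sep_in sk.
    by rewrite -rs; apply/esym/rtP/(sep_conn_src sk).
  left; exists s, t, t; split=> //; rewrite eqk.
  by rewrite mset_swap12 mset_swap23.
split=> // g.
have [->|ne] := eqVneq (col (src g)) (col (tgt g)); first by left.
right; apply/eqP; apply: contraT => nep.
have [k [ks kt kg]] : exists k, [/\ col s != k, col t != k &
    (col (src g) == k) != (col (tgt g) == k)].
  move: ne nep lt; rewrite eqp; case: (col s); case: (col t) => // ne nep _;
  by [exists Col0; split=> //; move: ne nep; case: (col _); case: (col _) |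
      exists Col1; split=> //; move: ne nep; case: (col _); case: (col _) |
      exists Col2; split=> //; move: ne nep; case: (col _); case: (col _)].
have third z : col z = k -> col z != col s /\ col z != col t by move=> ->; rewrite ![k == _]eq_sym.
have nst : col s != col t := clt_neq lt.
(* a component containing both [k] and another colour could receive a mark *)
have A1 a b e : e \in F -> 0 < M e -> conn F a (src e) -> conn F b (src e) ->
    col a = k -> col b = k.
  move=> eF pos ca cb cak; apply/eqP; apply: contraT => nk.
  have [rR|rR] := eqVneq (rt F (src e)) R0.
    have csa : conn F s a.
      by rewrite -rt_eq rs -rR eq_sym rt_eq.
    have [vs vt] := third _ cak; exfalso.
    have [/existsP[v /andP[ov /eqP cv]]|nov] := boolP [exists v, onpath F s t v && (col v == k)].
      have [vs' vt'] := third _ cv.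
      have [h [hF bm]] := ext3_mid fF d ov vs' vt' fe0 ff0.
      apply: (updB h hF _ bm); have [_ d3] := cl_big fF bm.
      case: bm => [[s1 [t1 [v1 [pd eqb]]]]|[u1 [v1 [w1 [pd eqb]]]]].
        have [e' [f [j [fe ff lj eqj]]]] := path_ex fF pd.
        have inl x : x \in [:: h; e0; f0] -> sep F x s1 t1.
          move=> xin; apply: (path_sub pd fe ff lj); apply: mset_mem xin.
          by rewrite eqb eqj.
        have s1h : sep F h s1 t1 by apply: inl; rewrite !inE eqxx.
        have s1e : sep F e0 s1 t1 by apply: inl; rewrite !inE eqxx orbT.
        rewrite -re0; apply/rtP; apply: conn_trans (sep_conn_src s1e).
        by rewrite conn_sym (sep_conn_src s1h).
      have [e' [f [j [[fe ff fj] _ _ _ eqj]]]] := tripod_ex fF pd.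
      have [_ cuv cuw _ _] := and5P pd.
      have inl x : x \in [:: h; e0; f0] -> conn F u1 (src x).
        move=> xin; have : x \in [:: e'; f; j] by apply: mset_mem xin; rewrite eqb eqj.
        move: fe ff fj => /andP[se _] /andP[sf _] /andP[sj _].
        rewrite !inE => /or3P[]/eqP->; first exact: sep_conn_src se.
          exact: conn_trans cuv (sep_conn_src sf).
        exact: conn_trans cuw (sep_conn_src sj).
      rewrite -re0; apply/rtP; apply: (conn_trans (y := u1)).
        by rewrite conn_sym inl // !inE eqxx.
      by rewrite inl // !inE eqxx orbT.
    have cas : conn F a s by rewrite conn_sym.
    have nas : a != s by apply: contraNneq vs => ->.
    have [h fh] := first_ex fF cas nas.
    apply: (updB h); first by case/andP: fh => /sep_in.
      by rewrite -rs; apply/rtP; case/andP: fh => /sep_conn_src; rewrite conn_sym => ch _; apply: conn_trans ch cas.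
    apply: (ext3_end fF d _ csa vs vt _ fe0 ff0 fh); first by rewrite -eqp.
    move=> v ov; apply: contra nov => /eqP cv; apply/existsP; exists v.
    by rewrite ov cv cak /=.
  have [f [x [w [f_F fx fw nk']]]] := ext2 fF eF ca cb cak nk.
  have nxw : col x != col w by apply: contraNneq nk' => ->.
  have [s1 [t1 [d1 eqm1 eql]]] := mark2_mset fF (sep_conn (proj1 (andP fx))) nxw fx fw.
  have cef : rt F (src f) = rt F (src e).
    apply/rtP; have [sx ix] := andP fx; have [sw iw] := andP fw.
    rewrite conn_sym -(inc_conn _ f_F iw).
    by apply: conn_trans (sep_conn sx); rewrite (inc_conn _ eF ix) conn_refl.
  have := me f_F; apply: contraNT => _; apply: inX_addm => //.
  have lone : restr F M (rt F (src e)) = mset [:: e].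
    by apply: restr_one => //; apply: others.
  rewrite cef lone addm_mset.
  have -> : mset [:: f; e] = mset [:: e; f].
    by apply/ffunP => z; rewrite !ffunE /= addnCA.
  rewrite eqm1 cl_mark2 // eql (bigD1 R0) /=; last by rewrite eq_sym.
  rewrite clR0 eqp big1 => [|r /andP[_ /others//]].
  rewrite [mulc (link (col s) _) _]mulcC mul1c mulcC.
  by rewrite (@link_Full _ _ _ _ k).
have [a [b [ia ib cak cbk gab]]] : exists a b, [/\ inc g a, inc g b, col a = k, col b != k
    & (src g = a /\ tgt g = b) \/ (src g = b /\ tgt g = a)].
  case: (eqVneq (col (src g)) k) kg => [e1|n1]; case: (eqVneq (col (tgt g)) k) => [e2|n2] // _.
    by exists (src g), (tgt g); rewrite /inc !eqxx ?orbT; split; auto.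
  by exists (tgt g), (src g); rewrite /inc !eqxx ?orbT; split; auto.
have nl : src g != tgt g by apply: contraNneq ne => ->.
have [e1 [e1F p1 c1]] := mark_at ia nl; have [e2 [e2F p2 c2]] := mark_at ib nl.
have nab : ~~ conn F a b.
  apply: contra cbk => cab; apply/eqP/(A1 _ _ _ e1F p1 c1 _ cak).
  by apply: conn_trans c1; rewrite conn_sym.
have nc : ~~ conn F (src g) (tgt g) by case: gab => -[-> ->]; rewrite // conn_sym.
have gF : g \notin F by apply: contra nc => ?; apply: conn_edge.
have kb x : conn F x b -> col x != k.
  move=> cx; apply: contra cbk => /eqP cxk; apply/eqP.
  by apply: (A1 _ _ _ e2F p2 _ c2 cxk); apply: conn_trans cx c2.
have ka x : conn F x a -> col x = k.
  by move=> cx; apply: (A1 _ _ _ e1F p1 c1 _ cak); apply: conn_trans cx c1.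
have raR : rt F a != R0.
  by rewrite -rs rt_eq conn_sym; apply: contra ks => /ka/eqP.
have re1 : rt F (src e1) = rt F a by apply/esym/rtP.
have re2 : rt F (src e2) = rt F b by apply/esym/rtP.
have fF' := forest_add fF nc; have sF : F \subset g |: F by apply: subsetUr.
have gin : g \in g |: F by apply: setU11.
have e1F' := subsetP sF _ e1F; have e2F' := subsetP sF _ e2F.
have cab' : conn (g |: F) a b.
  by case: gab => -[<- <-]; rewrite 1?conn_sym ?conn_edge // conn_sym conn_edge.
have RE : rt (g |: F) (src g) = rt (g |: F) a.
  by case: gab => -[-> _] //; apply/rtP; rewrite conn_sym.
have rab r : rt (g |: F) r == rt (g |: F) a -> rt F r = rt F a \/ rt F r = rt F b.
  rewrite rt_eq => /conn_add[/rtP->|[c3 _]|[c3 _]]; auto;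
  by case: gab c3 => -[sg tg]; rewrite ?sg ?tg => /rtP; auto.
have eqR e : restr (g |: F) M (rt (g |: F) (src g)) e = restr F M (rt F a) e + restr F M (rt F b) e.
  rewrite (restr_join gF nc (erefl _) (erefl _)).
  by case: gab => -[-> ->] //; rewrite addnC.
have := inX_add gF nc; rewrite RE in eqR *.
have la : restr F M (rt F a) = mset [:: e1] by apply: restr_one => //; apply: others.
have [rbR|rbR] := eqVneq (rt F b) R0.
  have ce1s : conn (g |: F) (src e1) s.
    apply: (conn_trans (y := a)); first by rewrite conn_sym (conn_sub sF c1).
    by apply: conn_trans cab' _; apply: conn_sub sF _; rewrite -rt_eq rbR rs.
  have cse1 : conn (g |: F) s (src e1) by rewrite conn_sym.
  have [_ se1] := nfP fF' e1F' cse1.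
  set r0 := far (g |: F) s e1 in se1.
  have fr0 : first (g |: F) r0 s e1 by apply: (first_far fF' se1).
  have cr0 : col r0 = k.
    apply: ka; apply: (conn_trans (y := src e1)); last by rewrite conn_sym.
    by rewrite conn_sym (inc_conn _ e1F (proj2 (andP fr0))) conn_refl.
  have [vs vt] := third _ cr0.
  have d' : pair_data (g |: F) s t by rewrite -(pair_stable sF cst).
  have cst' := conn_sub sF cst.
  have cts : conn F t s by rewrite conn_sym.
  have fe' : first (g |: F) s t e0 by rewrite -(first_stable fF' sF).
  have ff' : first (g |: F) t s f0 by rewrite -(first_stable fF' sF).
  have bm : big_mark (g |: F) (mset [:: e1; e0; f0]).
    apply: (ext3_end fF' d' _ (sep_conn se1) vs vt _ fe' ff' fr0); first by rewrite -eqp.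
    move=> v ov; rewrite cr0; apply: kb.
    apply: (conn_trans (y := s)); last by rewrite -rt_eq rbR rs.
    by rewrite conn_sym; apply: (onpath_conn fF' sF cst ov).
  have -> : restr (g |: F) M (rt (g |: F) a) = mset [:: e1; e0; f0].
    by apply/ffunP => e; rewrite eqR la rbR eqN eqm !ffunE /= addn0.
  rewrite big1 => [|r nr]; last first.
    apply: others; apply: contra nr => /eqP->.
    by rewrite -rbR rt_sub // rt_eq conn_sym.
  by rewrite mulcC mul1c; have [] := cl_big fF' bm; case: (cl _ _).
have lb : restr F M (rt F b) = mset [:: e2] by apply: restr_one => //; apply: others.
have c12 : conn (g |: F) (src e1) (src e2).
  apply: (conn_trans (y := a)); first by rewrite conn_sym (conn_sub sF c1).
  by apply: (conn_trans cab'); apply: conn_sub sF c2.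
have [x [z [fx fz]]] := outer fF' e1F' e2F' c12.
have cx : col x = k.
  apply: ka; apply: (conn_trans (y := src e1)); last by rewrite conn_sym.
  by rewrite conn_sym (inc_conn _ e1F (proj2 (andP fx))) conn_refl.
have cz : col z != k.
  apply: kb; apply: (conn_trans (y := src e2)); last by rewrite conn_sym.
  by rewrite conn_sym (inc_conn _ e2F (proj2 (andP fz))) conn_refl.
have nxz : col x != col z by rewrite cx eq_sym.
have [s1 [t1 [d1 eqm1 eql]]] := mark2_mset fF' (sep_conn (proj1 (andP fx))) nxz fx fz.
have -> : restr (g |: F) M (rt (g |: F) a) = mark2 (g |: F) s1 t1.
  by rewrite -eqm1; apply/ffunP => e; rewrite eqR la lb !ffunE /= !addn0.
have rR0 : rt F R0 = R0 by rewrite -rs rt_id.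
rewrite cl_mark2 // eql (bigD1 R0) /=; last first.
  apply/negP => /rab; rewrite rR0 => -[h|h]; [move: raR|move: rbR]; by rewrite h eqxx.
rewrite clR0 eqp big1 => [|r /andP[_ /others//]].
rewrite [mulc (link (col s) _) _]mulcC mul1c mulcC (@link_Full _ _ _ _ k) //.
by rewrite cx eqxx (negbTE cz).
Qed.

End Maximal.
Lemma conn_const (A : eqType) (h : V -> A) I x y : (forall e, e \in I -> h (src e) = h (tgt e)) ->
  conn I x y -> h x = h y.
Proof.
move=> he cxy; apply/eqP; apply: (conn_ind (P := fun y => h x == h y)) cxy _ => //.
by move=> e /he ->.
Qed.

(** * Purity *)

Lemma mono_rk0 F M : (forall g, col (src g) = col (tgt g)) -> inX F M -> rk (total_cl F M) = 0.
Proof.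
move=> mono /and3P[fF _ nb].
have noP s t : ~ pair_data F s t.
  by case/andP=> /clt_neq/eqP ne cst; apply: ne; apply: conn_const cst.
suff -> : total_cl F M = Free by [].
have : (total_cl F M == Free) || (total_cl F M == Bad).
  rewrite /total_cl; elim/big_rec: _ => // r x _ IH.
  case: (clP F (restr F M r)) => [_|s t /noP|s t v /and3P[/noP]|u v w|] //.
    case/and5P=> /and3P[/eqP c0 /eqP c1 _] cuv _ _ _.
    by have := conn_const (fun e _ => mono e) cuv; rewrite c0 c1.
  by case: x {IH}.
by rewrite (negbTE nb) orbF => /eqP.
Qed.

(** When all bichromatic edges are of one type, other than that of colours 1 and 2,
the third colour [k] forms components of its own, so no component has all three
colours; and distinct components cannot both contribute. *)
Lemma two_rk1 F M p : rk p = 1 -> p != L12 ->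
  (forall g, col (src g) = col (tgt g) \/ link (col (src g)) (col (tgt g)) = p) ->
  inX F M -> rk (total_cl F M) <= 1.
Proof.
move=> rp p12 hg /and3P[fF _ nb].
have [k [kp kC k3]] : exists k, [/\ forall x z, link x z = p -> (x == k) = (z == k),
    forall x z, x != z -> (x == k) = (z == k) -> link x z = p
    & forall x z w : color, x != z -> w != x -> w != z -> (x == k) = (z == k) -> (x == k) != (w == k)].
  case: p rp p12 {hg} => // _ _; [exists Col2|exists Col1]; split;
  by [case=> -[] | case=> -[] [] | do 3!case].
have cc x z : conn F x z -> (col x == k) = (col z == k).
  apply: (conn_const (h := fun x => col x == k)) => e _.
  by case: (hg e) => [->|/kp].
suff : [|| total_cl F M == Free, total_cl F M == p | total_cl F M == Bad].
  by rewrite (negbTE nb) orbF => /orP[]/eqP-> //; rewrite rp.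
rewrite /total_cl; elim/big_rec: _ => // r x _ IH.
have np s t : pair_data F s t -> link (col s) (col t) = p.
  by case/andP=> /clt_neq ne /cc; apply: kC.
case: (clP F (restr F M r)) => [_|s t /np -> _|s t v d _|u v w d _|].
- by move: IH; case: x.
- by move: IH rp; case/or3P=> /eqP->; case: p {hg np kp kC p12} => //=; rewrite ?eqxx.
- case/and3P: d => pd /andP[csv _]; have eqp := np _ _ pd.
  case: ifP => _; first by rewrite eqp (negbTE p12).
  case/andP=> ns nt; case/andP: pd => /clt_neq nst cst.
  by have := k3 _ _ _ nst ns nt (cc _ _ cst); rewrite (cc _ _ csv) eqxx.
- case/and5P: d => /and3P[/eqP c0 /eqP c1 /eqP c2] cuv cuw _ _.
  have := k3 (col u) (col v) (col w); rewrite c0 c1 c2 => /(_ isT isT isT).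
  have := cc _ _ cuv; have := cc _ _ cuw; rewrite c0 c1 c2 => h1 h2 /(_ h2).
  by rewrite h1 eqxx.
by case: x {IH}; rewrite /= eqxx !orbT.
Qed.

(** By [max_deg] it is enough that the ranks agree. Ranks zero and one are detected
by the colours on the edges of the whole graph, which do not depend on the
marked forest, and they are bounds for all other marked forests. *)
Lemma maximal_deg F M F' M' : maximalX F M -> maximalX F' M' ->
  #|F| + deg M = #|F'| + deg M'.
Proof.
move=> m m'; have := max_deg m; have := max_deg m'.
have iX : inX F M by case: m.
have iX' : inX F' M' by case: m'.
suff eqr : rk (total_cl F M) = rk (total_cl F' M').
  move=> dm' dm; apply/(@addIn #|[set x | isolated x]|).
  exact: etrans dm (etrans (congr1 (addn #|V|) eqr) (esym dm')).
have le2 F0 M0 : inX F0 M0 -> rk (total_cl F0 M0) <= 2.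
  by case/and3P=> _ _; case: (total_cl F0 M0).
have one F1 M1 F2 M2 : maximalX F1 M1 -> inX F2 M2 ->
    rk (total_cl F1 M1) = 0 -> rk (total_cl F2 M2) = 0.
  by move=> m1 i2 /(max_rk0 m1) h; apply: mono_rk0.
have two F1 M1 F2 M2 : maximalX F1 M1 -> inX F2 M2 ->
    rk (total_cl F1 M1) = 1 -> rk (total_cl F2 M2) <= 1.
  by move=> m1 i2 r1; have [n12 h] := max_rk1 m1 r1; apply: two_rk1 r1 n12 h i2.
have arith a b : a <= 2 -> b <= 2 -> (a = 0 -> b = 0) -> (b = 0 -> a = 0) ->
    (a = 1 -> b <= 1) -> (b = 1 -> a <= 1) -> a = b.
  clear; case: a b => [|[|[|a]]] [|[|[|b]]] // _ _ h1 h2 h3 h4.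
  - by have := h1 erefl.
  - by have := h1 erefl.
  - by have := h2 erefl.
  - by have := h3 erefl.
  - by have := h2 erefl.
  - by have := h4 erefl.
exact: (arith _ _ (le2 _ _ iX) (le2 _ _ iX') (one _ _ _ _ m iX') (one _ _ _ _ m' iX)
  (two _ _ _ _ m iX') (two _ _ _ _ m' iX)).
Qed.

(** * Counting the states of one component *)

Definition hasc U k := [exists x in U, col x == k].

(** The connection made when each vertex of a set [U] of one component is joined to
the cone vertex of its colour; a repeated colour makes a cycle. *)
Definition clU U :=
  if [forall x in U, forall y in U, (col x == col y) ==> (x == y)]
  then hued (hasc U Col0) (hasc U Col1) (hasc U Col2)
  else Bad.

Lemma clU_injP U : reflect {in U &, injective col} [forall x in U, forall y in U, (col x == col y) ==> (x == y)].
Proof.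
apply: (iffP forall_inP) => [h x y xU yU /eqP e|h x xU].
  by have /forall_inP/(_ y yU)/implyP/(_ e)/eqP := h x xU.
by apply/forall_inP => y yU; apply/implyP => /eqP/h/eqP; apply.
Qed.

Lemma clU_small U : #|U| <= 1 -> clU U = Free.
Proof.
move/card_le1_eqP => h; rewrite /clU; case: clU_injP => [_|[]]; last first.
  by move=> x y xU yU _; apply: h.
have no k l : k != l -> hasc U k -> hasc U l = false.
  move=> kl /exists_inP[x xU /eqP cx]; apply/negbTE/negP => /exists_inP[y yU /eqP cy].
  by move: kl; rewrite -cx -cy (h x y) ?eqxx.
exact: (hued_small (H := hasc U)).
Qed.

Lemma clU_Free U : clU U = Free -> #|U| <= 1.
Proof.
rewrite /clU; case: clU_injP => // inj hF; apply/card_le1_eqP => x y xU yU; apply: inj => //.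
have hx : hasc U (col x) by apply/exists_inP; exists x.
have hy : hasc U (col y) by apply/exists_inP; exists y.
exact: (@hued_Free (hasc U) _ _ hF hy hx).
Qed.

(** The new edge joins the cone vertex of the colour of [a], through the component,
to that of the colour of [a']. *)
Lemma clU_add U a a' : a' \in U -> a \notin U ->
  clU (a |: U) = mulc (clU U) (link (col a') (col a)).
Proof.
move=> a'U aU; rewrite {2}/clU; case: clU_injP => [inj|ninj]; last first.
  rewrite /clU; case: clU_injP => [inj|_]; last by case: (link _ _).
  by case: ninj => x y xU yU; apply: inj; rewrite inE ?xU ?yU orbT.
have ex k : hasc (a |: U) k = (col a == k) || hasc U k.
  apply/exists_inP/orP => [[x]|[ca|/exists_inP[z xU cx]]].
  - by case/setU1P=> [->|xU] cx; [left | right; apply/exists_inP; exists x].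
  - by exists a; rewrite ?setU11.
  - by exists z; rewrite ?inE ?xU ?orbT.
have ha' : hasc U (col a') by apply/exists_inP; exists a'.
have [old|new] := boolP (hasc U (col a)).
  have [b bU /eqP cb] := exists_inP old.
  rewrite /clU; case: clU_injP => [inj'|_].
    have ba : b = a by apply: inj' => //; rewrite ?setU11 // inE bU orbT.
    by rewrite -ba bU in aU.
  by rewrite (hued_old ha' old).
have inj' : {in a |: U &, injective col}.
  move=> x y /setU1P[->|xU] /setU1P[->|yU] // eqc; last exact: inj.
    by case/negP: new; apply/exists_inP; exists y; rewrite ?eqc.
  by case/negP: new; apply/exists_inP; exists x; rewrite -?eqc.
rewrite /clU; case: clU_injP => // _; rewrite !ex.
exact: (hued_new (H := hasc U)).
Qed.

Lemma clU1 a : clU [set a] = Free. Proof. by apply: clU_small; rewrite cards1. Qed.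

Lemma clU2 s t : col s != col t -> clU [set s; t] = link (col s) (col t).
Proof.
move=> ne; rewrite setUC (@clU_add _ t s) ?inE // ?clU1 ?mul1c //.
by apply: contraNneq ne => ->.
Qed.

Lemma clU3 u v w : col u = Col0 -> col v = Col1 -> col w = Col2 -> clU [set u; v; w] = Full.
Proof.
move=> c0 c1 c2; rewrite setUC (@clU_add _ w u) ?inE ?eqxx //.
  by rewrite clU2 c0 c1 // c2.
by apply/norP; split; apply/eqP => e; move: c2; rewrite e (c0, c1).
Qed.

Lemma clU_link U z : rk z = 1 -> clU U = z ->
  exists s t, [/\ U = [set s; t], clt (col s) (col t) & link (col s) (col t) = z].
Proof.
move=> rz; rewrite /clU; case: clU_injP => [inj|_ zB]; last by rewrite -zB in rz.
have ex k : hasc U k -> exists2 x, x \in U & col x = k.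
  by case/exists_inP=> x xU /eqP; exists x.
have mk s t k : s \in U -> t \in U -> hasc U k = false ->
    (forall l, [|| l == col s, l == col t | l == k]) -> U = [set s; t].
  move=> sU tU nk all; apply/setP => x; rewrite !inE; apply/idP/orP.
    move=> xU; case/or3P: (all (col x)) => /eqP cx; [left|right|]; rewrite 1?(inj x _ xU _ cx) //.
    by case/negP: (negbT nk); apply/exists_inP; exists x; rewrite ?cx.
  by case=> /eqP->.
move=> zE; rewrite -zE in rz *; have [k [l [m [Hk Hl [lt eqb] [nm all]]]]] := hued_link rz.
have [s sU cs] := ex _ Hk; have [t tU ct] := ex _ Hl; exists s, t.
by rewrite cs ct; split=> //; apply: mk nm _; rewrite ?cs ?ct.
Qed.

Lemma clU_Full U : clU U = Full ->
  exists u v w, [/\ U = [set u; v; w], col u = Col0, col v = Col1 & col w = Col2].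
Proof.
rewrite /clU; case: clU_injP => // inj.
have ex k : hasc U k -> exists2 x, x \in U & col x = k.
  by case/exists_inP=> x xU /eqP; exists x.
move/hued_full=> H; have [u uU cu] := ex _ (H Col0); have [v vU cv] := ex _ (H Col1).
have [w wU cw] := ex _ (H Col2); exists u, v, w; split=> //.
apply/setP => x; rewrite !inE; apply/idP/idP => [xU|/orP[/orP[]|]/eqP-> //].
case cx: (col x).
- by rewrite (inj x u) ?eqxx // cx.
- by rewrite (inj x v) ?eqxx ?orbT // cx.
by rewrite (inj x w) ?eqxx ?orbT // cx.
Qed.

Lemma clU_rk U : clU U != Star.
Proof.
rewrite /clU; case: ifP => // _.
exact: (hued_star (hasc U)).
Qed.

(** The empty set has the class, and hence the rank, of a singleton. *)
Lemma clU_card U : clU U != Bad -> #|U| + (U == set0) = (rk (clU U)).+1.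
Proof.
move=> nb; have small0 : clU U != Free -> (U == set0) = false.
  by apply: contraNF => /eqP->; rewrite clU_small // cards0.
have lnk : rk (clU U) = 1 -> #|U| + (U == set0) = (rk (clU U)).+1.
  move=> r1; rewrite small0; last by apply: contra_eq_neq r1 => ->.
  rewrite r1 addn0; have [s [t [-> /clt_neq st _]]] := clU_link r1 erefl.
  by rewrite cards2; case: (eqVneq s t) st => // ->; rewrite eqxx.
have := clU_rk U; case ez: (clU U) nb lnk small0 => //= _ lnk small0 _; try by apply: lnk.
  have := clU_Free ez; rewrite -cards_eq0; by case: #|U| => [|[]].
have [u [v [w [eU c0 c1 c2]]]] := clU_Full ez.
rewrite small0 // addn0 eU -setUA cardsU1 cards2 !inE.
have ne x y : col x != col y -> x != y by apply: contraNneq => ->.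
by rewrite !(negbTE (ne _ _ _)) ?ne ?c0 ?c1 ?c2.
Qed.

Section Counts.
Variables (F : {set E}) (r : V) (q : nat).
Hypotheses (fF : forest F) (root : rt F r = r).

Definition pair_set z := [set p : V * V | [&& rt F p.1 == r, rt F p.2 == r,
  clt (col p.1) (col p.2) & link (col p.1) (col p.2) == z]].

Definition triple_set := [set p : V * V * V | [&& rt F p.1.1 == r, rt F p.1.2 == r, rt F p.2 == r,
  col p.1.1 == Col0, col p.1.2 == Col1 & col p.2 == Col2]].

Definition fibre := [set v | rt F v == r].
Definition efibre := [set e in F | rt F (src e) == r].

(** Sets of vertices are encoded as functions, as required by the assembly. *)
Definition setof (m : {ffun V -> bool}) : {set V} := [set x | m x].
Definition ffof U : {ffun V -> bool} := [ffun x => x \in U].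

Lemma setofK m : ffof (setof m) = m.
Proof. by apply/ffunP => x; rewrite ffunE inE. Qed.
Lemma ffofK U : setof (ffof U) = U.
Proof. by apply/setP => x; rewrite inE ffunE. Qed.

(** The factor [q] of the empty set accounts for the missing edge between the
component and the cone vertices. *)
Definition wU U := if clU U == Free then q ^ (1 - #|U|) else 1.

Definition lsumJ z := lsum false (rt F) (fun _ m => clU (setof m)) (fun _ m => wU (setof m)) r z.

Lemma lsumJE z : lsumJ z = \sum_(U : {set V} | (U \subset fibre) && (clU U == z)) wU U.
Proof.
rewrite /lsumJ /lsum (reindex ffof) /=; last first.
  by exists setof => m _; rewrite (setofK, ffofK).
rewrite (eq_bigr wU) => [|U _]; last by rewrite ffofK.
apply: eq_bigl => U; rewrite ffofK; congr andb; apply/supP/subsetP => h x.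
  by move=> xU; rewrite inE; apply: contraTT xU => nx; rewrite -[x \in U](ffunE (fun x => x \in U)) h ?inE.
by rewrite inE ffunE => nx; apply/negbTE; apply: contra nx => /h; rewrite inE.
Qed.

Lemma lsumJ_Free : lsumJ Free = q + #|fibre|.
Proof.
rewrite lsumJE (bigD1 set0) /=; last by rewrite sub0set clU_small ?cards0.
rewrite {1}/wU clU_small ?cards0 //= expn1; congr addn.
apply: (sum_image (h := @set1 V)) => [x y _ _ /set1_inj //|x|U].
  rewrite inE => xr; rewrite sub1set inE xr clU1 /=.
  by apply/eqP => /setP/(_ x); rewrite !inE eqxx.
case/andP=> /andP[sU /eqP cU] ne; rewrite /wU cU eqxx.
have U1 : #|U| == 1 by rewrite eqn_leq clU_Free // card_gt0.
rewrite (eqP U1) subnn expn0; case/cards1P: U1 => x xE.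
by rewrite xE in sU *; rewrite imset_f // -sub1set.
Qed.

Lemma clt_irr k : clt k k = false. Proof. by case: k. Qed.

Lemma lsumJ_link z : rk z = 1 -> lsumJ z = #|pair_set z|.
Proof.
move=> rz; have zF : z != Free by case: z rz.
rewrite lsumJE; apply: (sum_image (h := fun p => [set p.1; p.2])).
- move=> [s t] [s' t']; rewrite !inE /= => /and4P[_ _ lt _] /and4P[_ _ lt' _] eqs.
  have : s \in [set s'; t'] by rewrite -eqs !inE eqxx.
  have : t \in [set s'; t'] by rewrite -eqs !inE eqxx orbT.
  rewrite !inE => /orP[]/eqP tE /orP[]/eqP sE; subst s t => //.
  + by rewrite clt_irr in lt.
  + by rewrite (clt_asym lt) in lt'.
  by rewrite clt_irr in lt.
- move=> [s t]; rewrite inE /= => /and4P[rs rt_ lt /eqP eqz]; rewrite clU2 ?clt_neq // eqz eqxx andbT.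
  by apply/subsetP => x; rewrite !inE => /orP[]/eqP->.
move=> U /andP[sU /eqP cU]; rewrite /wU cU (negbTE zF).
have [s [t [eqU lt eql]]] := clU_link rz cU.
have sU' x : x \in U -> rt F x == r by move/(subsetP sU); rewrite inE.
rewrite eqU (imset_f (fun p => [set p.1; p.2]) (_ : (s, t) \in pair_set z)) //.
by rewrite inE /= lt eql eqxx !sU' // eqU !inE eqxx ?orbT.
Qed.

Lemma lsumJ_Full : lsumJ Full = #|triple_set|.
Proof.
rewrite lsumJE; apply: (sum_image (h := fun p => [set p.1.1; p.1.2; p.2])).
- move=> [[u v] w] [[u' v'] w']; rewrite !inE /=.
  case/and5P=> _ _ _ /eqP c0 /andP[/eqP c1 /eqP c2] /and5P[_ _ _ /eqP c0' /andP[/eqP c1' /eqP c2']] eqs.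
  have key x : x \in [set u'; v'; w'] -> match col x with Col0 => x = u' | Col1 => x = v' | Col2 => x = w' end.
    by rewrite !inE => /orP[/orP[]|]/eqP->; rewrite ?c0' ?c1' ?c2'.
  have := key u; have := key v; have := key w; rewrite c0 c1 c2 -eqs !inE !eqxx ?orbT.
  by move=> -> // -> // ->.
- move=> [[u v] w]; rewrite inE /= => /and5P[ru rv rw /eqP c0 /andP[/eqP c1 /eqP c2]].
  rewrite clU3 // eqxx andbT; apply/subsetP => x.
  by rewrite !inE => /orP[/orP[]|]/eqP->.
move=> U /andP[sU /eqP cU]; rewrite /wU cU /=.
have [u [v [w [eqU c0 c1 c2]]]] := clU_Full cU.
have sU' x : x \in U -> rt F x == r by move/(subsetP sU); rewrite inE.
rewrite eqU (imset_f (fun p => [set p.1.1; p.1.2; p.2]) (_ : (u, v, w) \in triple_set)) //.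
by rewrite inE /= c0 c1 c2 !eqxx !sU' // eqU !inE eqxx ?orbT.
Qed.

Lemma lsumJ_Star : lsumJ Star = 0.
Proof.
rewrite lsumJE big_pred0 // => U; apply/negbTE/negP => /andP[_ cU].
by have := clU_rk U; rewrite cU.
Qed.

(** No mark is repeated more than three times in a state that is not [Bad], so the
marks form a finite type. *)
Definition toN (m : {ffun E -> 'I_4}) : {ffun E -> nat} := [ffun e => m e : nat].
Definition ofN N : {ffun E -> 'I_4} := [ffun e => inord (N e)].

Lemma deg_ge N e : N e <= deg N. Proof. by rewrite /deg (bigD1 e) //= leq_addr. Qed.

Lemma ofNK N : deg N <= 3 -> toN (ofN N) = N.
Proof. by move=> d; apply/ffunP => e; rewrite !ffunE inordK // ltnS; apply: leq_trans d; apply: deg_ge. Qed.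

Lemma toNK m : ofN (toN m) = m.
Proof. by apply/ffunP => e; rewrite !ffunE; apply: val_inj; rewrite /= inordK. Qed.

Definition insupp N := [forall e, (0 < N e) ==> (e \in F)].

Definition wM N := if insupp N then if cl F N == Free then q.+1 ^ (1 - deg N) else 1 else 0.

Definition lsumM z := lsum ord0 (fun e => rt F (src e)) (fun _ m => cl F (toN m)) (fun _ m => wM (toN m)) r z.

Lemma supM m : reflect (forall e, 0 < toN m e -> rt F (src e) = r) (sup ord0 (fun e => rt F (src e)) [set r] m).
Proof.
apply: (iffP (supP _ _ _ _)) => h e.
  rewrite ffunE => pos; apply/eqP; apply: contraTT pos => ne.
  by rewrite h ?inE.
rewrite inE => ne; apply/val_inj/eqP; rewrite /= -leqn0 leqNgt; apply: contra ne => pos.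
by apply/eqP/h; rewrite ffunE.
Qed.

Lemma lsumM_Free : lsumM Free = q.+1 + #|efibre|.
Proof.
rewrite /lsumM /lsum (bigD1 (ofN (mset [::]))) /=; last first.
  rewrite ofNK ?deg_mset // cl_small ?deg_mset // andbT; apply/supM => e.
  by rewrite ofNK ?deg_mset // ffunE.
have sup0 : insupp (mset [::]) by apply/forallP => e; rewrite ffunE.
rewrite {1}/wM ofNK ?deg_mset // cl_small ?deg_mset // sup0 expn1; congr addn.
apply: (sum_image (h := fun e => ofN (mset [:: e]))).
- move=> e f _ _ /(congr1 toN); rewrite !ofNK ?deg_mset // => /eqP.
  by rewrite mset_perm => /perm_mem/(_ e); rewrite !inE eqxx => /esym/eqP.
- move=> e; rewrite inE => /andP[eF /eqP er]; rewrite ofNK ?deg_mset // cl_small ?deg_mset //=.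
  apply/andP; split; last first.
    apply/eqP => /(congr1 toN); rewrite !ofNK ?deg_mset // => /(congr1 (@deg _)).
    by rewrite !deg_mset.
  rewrite andbT; apply/supM => f; rewrite ofNK ?deg_mset // mset_in inE.
  by move/eqP->.
move=> m /andP[/andP[/supM sm /eqP cm] n0]; rewrite /wM cm eqxx.
have le1 : deg (toN m) <= 1.
  by apply: cl_Free cm.
have d1 : deg (toN m) = 1.
  apply/eqP; rewrite eqn_leq le1 lt0n; apply: contra n0 => /eqP/deg0 d0.
  by rewrite -(toNK m) d0.
rewrite d1 subnn expn0; have [l eql] := mset_exists (toN m).
move: d1; rewrite eql deg_mset; case: l eql => [|e []] // eql _.
have er : rt F (src e) = r by apply: sm; rewrite eql mset_in inE.
have -> : insupp (mset [:: e]) = (e \in F).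
  apply/forallP/idP => [/(_ e)|eF f]; first by rewrite mset_in inE eqxx.
  by apply/implyP; rewrite mset_in inE => /eqP->.
have mE : m = ofN (mset [:: e]) by rewrite -eql toNK.
rewrite mE; case: (boolP (e \in F)) => eF.
  by rewrite (imset_f (fun e => ofN (mset [:: e]))) // inE eF er /=.
case: imsetP => // -[f]; rewrite inE => /andP[fF' _] /(congr1 toN).
rewrite !ofNK ?deg_mset // => /eqP; rewrite mset_perm => /perm_mem/(_ e).
by rewrite !inE eqxx => /esym/eqP ef; rewrite ef fF' in eF.
Qed.

Lemma mark2_supp s t e : pair_data F s t -> 0 < mark2 F s t e -> e \in F /\ conn F s (src e).
Proof.
move=> d; have [e0 [f0 [fe ff ->]]] := pair_ex fF d; have [_ cst] := andP d.
have [se _] := andP fe; have [sf _] := andP ff.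
rewrite mset_in !inE => /orP[]/eqP->; split.
- exact: sep_in se.
- exact: sep_conn_src se.
- exact: sep_in sf.
exact: conn_trans cst (sep_conn_src sf).
Qed.

Lemma mark3p_supp s t v e : path_data F s t v -> 0 < mark3p F s t v e ->
  e \in F /\ conn F s (src e).
Proof.
move=> d; have [e0 [f0 [k0 [fe ff lk ->]]]] := path_ex fF d.
rewrite mset_in => /(path_sub d fe ff lk) se.
by split; [exact: sep_in se | exact: sep_conn_src se].
Qed.

Lemma mark3t_supp u v w e : tripod_data F u v w -> 0 < mark3t F u v w e ->
  e \in F /\ conn F u (src e).
Proof.
move=> d; have [e0 [f0 [k0 [[fe ff fk] _ _ _ ->]]]] := tripod_ex fF d.
have [_ cuv cuw _ _] := and5P d.
have [se _] := andP fe; have [sf _] := andP ff; have [sk _] := andP fk.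
rewrite mset_in !inE => /or3P[]/eqP->; split.
- exact: sep_in se.
- exact: sep_conn_src se.
- exact: sep_in sf.
- exact: conn_trans cuv (sep_conn_src sf).
- exact: sep_in sk.
exact: conn_trans cuw (sep_conn_src sk).
Qed.

Lemma mark_local m N s : toN m = N -> 0 < deg N ->
  (forall e, 0 < N e -> e \in F /\ conn F s (src e)) ->
  sup ord0 (fun e => rt F (src e)) [set r] m -> rt F s = r /\ insupp N.
Proof.
move=> eqN d sN /supM sm; split; last by apply/forallP => e; apply/implyP => /sN[].
have /existsP[e pos] : [exists e, 0 < N e].
  apply: contraTT d; rewrite negb_exists -leqNgt leqn0 sum_nat_eq0 => /forallP h.
  by apply/forall_inP => e _; have := h e; rewrite -leqNgt leqn0.
by have [_ /rtP->] := sN e pos; apply: sm; rewrite eqN.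
Qed.

Lemma local_mark N s : deg N <= 3 -> rt F s = r ->
  (forall e, 0 < N e -> e \in F /\ conn F s (src e)) ->
  sup ord0 (fun e => rt F (src e)) [set r] (ofN N).
Proof.
by move=> d rs sN; apply/supM => e; rewrite ofNK // => /sN[_ /rtP<-].
Qed.

Lemma D2_pair s t z : (s, t) \in pair_set z -> pair_data F s t /\ link (col s) (col t) = z.
Proof.
rewrite inE /= => /and4P[/eqP rs /eqP rt_ lt /eqP lz].
by rewrite /pair_data lt -rt_eq rs rt_ eqxx.
Qed.

Lemma pair_D2 s t : pair_data F s t -> rt F s = r -> (s, t) \in pair_set (link (col s) (col t)).
Proof.
by move=> /andP[lt cst] rs; rewrite inE /= -(rtP cst) rs lt !eqxx.
Qed.

Lemma lsumM_link z : rk z = 1 -> lsumM z = #|pair_set z|.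
Proof.
move=> rz; have zF : z != Free by case: z rz.
apply: (sum_image (h := fun p => ofN (mark2 F p.1 p.2))).
- move=> [s t] [s' t'] /D2_pair[d _] /D2_pair[d' _] /(congr1 toN) /=.
  by rewrite !ofNK ?(deg_mark2 fF d) ?(deg_mark2 fF d') // => /(mark2_inj fF d d')[-> ->].
- move=> [s t] st; have [d lz] := D2_pair st; have d2 := deg_mark2 fF d.
  rewrite /= ofNK ?d2 // cl_mark2 // lz eqxx andbT.
  apply: local_mark (fun e => @mark2_supp s t e d); first by rewrite d2.
  by move: st; rewrite inE => /and4P[/eqP].
move=> m /andP[sm /eqP cm]; rewrite /wM cm (negbTE zF).
case: (clP F (toN m)) cm rz => [_ <-|s t d eqN eqz _|s t v _ _|u v w _ _ <-|<-] //; last by case: ifP => _ <-.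
have [|rs sN] := mark_local eqN _ (fun e => @mark2_supp s t e d) sm; first by rewrite (deg_mark2 fF d).
rewrite eqN sN -(toNK m) eqN (imset_f (fun p => ofN (mark2 F p.1 p.2)) (_ : (s, t) \in _)) //.
by rewrite -eqz; apply: pair_D2.
Qed.

Lemma star_data s t : pair_data F s t -> link (col s) (col t) = L12 -> path_data F s t t.
Proof.
move=> d l; rewrite /path_data d eqxx l /= andbT; have [_ cst] := andP d.
by rewrite /onpath cst /=; apply/forallP => e; exact: implybb.
Qed.

(** One state for each pair of vertices of colours 1 and 2, from [v = t] in the
definition of the marks of a path. *)
Lemma lsumM_Star : lsumM Star = #|pair_set L12|.
Proof.
apply: (sum_image (h := fun p => ofN (mark3p F p.1 p.2 p.2))).
- move=> [s t] [s' t'] /D2_pair[d l] /D2_pair[d' l'] /(congr1 toN) /=.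
  have pd := star_data d l; have pd' := star_data d' l'.
  by rewrite !ofNK ?(deg_mark3p fF pd) ?(deg_mark3p fF pd') // => /(mark3p_inj fF pd pd')[-> ->].
- move=> [s t] st; have [d lz] := D2_pair st; have pd := star_data d lz.
  have d3 := deg_mark3p fF pd.
  rewrite /= ofNK ?d3 // cl_mark3p // !eqxx andbT.
  apply: local_mark (fun e => @mark3p_supp s t t e pd); first by rewrite d3.
  by move: st; rewrite inE => /and4P[/eqP].
move=> m /andP[sm /eqP cm]; rewrite /wM cm /=.
case: (clP F (toN m)) cm => // [s t d _|s t v d eqN].
  by case: (col s); case: (col t).
case: eqP => // vt _; rewrite vt in d eqN.
have [|rs sN] := mark_local eqN _ (fun e => @mark3p_supp s t t e d) sm; first by rewrite (deg_mark3p fF d).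
rewrite eqN sN -(toNK m) eqN (imset_f (fun p => ofN (mark3p F p.1 p.2 p.2)) (_ : (s, t) \in _)) //.
by case/and3P: d => pd _; rewrite eqxx => /eqP <-; apply: pair_D2.
Qed.

(** Three vertices of different colours form a tripod unless one of them lies between
the two others; the order of the colours then orients the path. *)
Definition fullmark u v w :=
  if onpath F u w v then mark3p F u w v else
  if onpath F u v w then mark3p F u v w else
  if onpath F v w u then mark3p F v w u else mark3t F u v w.

Variant fullmark_spec u v w : {ffun E -> nat} -> Prop :=
| Fm1 of path_data F u w v : fullmark_spec u v w (mark3p F u w v)
| Fm2 of path_data F u v w : fullmark_spec u v w (mark3p F u v w)
| Fm3 of path_data F v w u : fullmark_spec u v w (mark3p F v w u)
| Fm4 of tripod_data F u v w : fullmark_spec u v w (mark3t F u v w).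

Lemma D3P u v w : (u, v, w) \in triple_set -> [/\ col u = Col0, col v = Col1, col w = Col2, rt F u = r
  & conn F u v /\ conn F u w].
Proof.
rewrite inE /= => /and5P[/eqP ru /eqP rv /eqP rw /eqP c0 /andP[/eqP c1 /eqP c2]].
by split; rewrite // -!rt_eq ru rv rw !eqxx.
Qed.

Lemma fullmarkP u v w : (u, v, w) \in triple_set -> fullmark_spec u v w (fullmark u v w).
Proof.
case/D3P=> c0 c1 c2 _ [cuv cuw].
have nvw : (v == w) = false by apply/eqP => h; rewrite h c2 in c1.
have nuw : (u == w) = false by apply/eqP => h; rewrite h c2 in c0.
have cvw : conn F v w by apply: conn_trans cuw; rewrite conn_sym.
rewrite /fullmark; case: ifP => [o|n1].
  by constructor; rewrite /path_data /pair_data cuw o c0 c1 c2 nvw.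
case: ifP => [o|n2].
  by constructor; rewrite /path_data /pair_data cuv o c0 c1 c2 eq_sym nvw.
case: ifP => [o|n3].
  by constructor; rewrite /path_data /pair_data cvw o c0 c1 c2 nuw.
by constructor; rewrite /tripod_data cuv cuw n1 n2 n3 c0 c1 c2.
Qed.

Lemma fullmark_deg u v w : (u, v, w) \in triple_set -> deg (fullmark u v w) = 3.
Proof.
by move=> h; case: (fullmarkP h) => d; rewrite ?(deg_mark3p fF d) ?(deg_mark3t fF d).
Qed.

Lemma fullmark_inj u v w u' v' w' : (u, v, w) \in triple_set -> (u', v', w') \in triple_set ->
  fullmark u v w = fullmark u' v' w' -> (u, v, w) = (u', v', w').
Proof.
move=> h h'; have [c0 c1 c2 _ _] := D3P h; have [c0' c1' c2' _ _] := D3P h'.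
have clash a b : a = b -> col a = col b by move=> ->.
case: (fullmarkP h) => d; case: (fullmarkP h') => d' eqm;
first [by have [e1 e2 e3] := mark3p_inj fF d d' eqm; rewrite ?e1 ?e2 ?e3
  | by have [/clash e1 /clash e2 /clash e3] := mark3p_inj fF d d' eqm; rewrite ?c0 ?c1 ?c2 ?c0' ?c1' ?c2' in e1 e2 e3
  | by case: (mark3t_mark3p fF d' d)
  | by case: (mark3t_mark3p fF d d')
  | by have [-> -> ->] := mark3t_inj fF d d' eqm].
Qed.

Lemma lsumM_Full : lsumM Full = #|triple_set|.
Proof.
apply: (sum_image (h := fun p => ofN (fullmark p.1.1 p.1.2 p.2))).
- move=> [[u v] w] [[u' v'] w'] d d' /(congr1 toN) /=.
  by rewrite !ofNK ?fullmark_deg // => /(fullmark_inj d d').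
- move=> [[u v] w] d /=; have [c0 c1 c2 ru [cuv cuw]] := D3P d.
  have cc : conn F v u by rewrite conn_sym.
  rewrite ofNK ?fullmark_deg //; have := fullmark_deg d.
  have nvw : (v == w) = false by apply/eqP => h; rewrite h c2 in c1.
  have nuw : (u == w) = false by apply/eqP => h; rewrite h c2 in c0.
  case: (fullmarkP d) => dd dg.
  + rewrite cl_mark3p // nvw eqxx andbT.
    by apply: local_mark (fun e => @mark3p_supp _ _ _ e dd); rewrite // dg.
  + rewrite cl_mark3p // [w == v]eq_sym nvw eqxx andbT.
    by apply: local_mark (fun e => @mark3p_supp _ _ _ e dd); rewrite // dg.
  + rewrite cl_mark3p // nuw eqxx andbT.
    by apply: local_mark (fun e => @mark3p_supp _ _ _ e dd); rewrite ?dg // (rtP cc).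
  rewrite cl_mark3t // eqxx andbT.
  by apply: local_mark (fun e => @mark3t_supp _ _ _ e dd); rewrite // dg.
move=> m /andP[sm /eqP cm]; rewrite /wM cm /=.
have fin u v w : (u, v, w) \in triple_set -> fullmark u v w = toN m -> insupp (toN m) ->
    (if insupp (toN m) then 1 else 0) = (m \in [set ofN (fullmark x.1.1 x.1.2 x.2) | x in triple_set]).
  move=> d eqm ->; rewrite -(toNK m) -eqm.
  by rewrite (imset_f (fun p => ofN (fullmark p.1.1 p.1.2 p.2)) d).
case: (clP F (toN m)) cm => // [s t d _|s t v d eqN|u v w d eqN _].
- by case: (col s); case: (col t).
- case: eqP => // /eqP vt _.
  have [|rs sN] := mark_local eqN _ (fun e => @mark3p_supp s t v e d) sm; first by rewrite (deg_mark3p fF d).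
  rewrite -eqN in sN; have sv := path_data_neq d.
  case/and3P: (d) => /andP[lt cst] o; rewrite (negbTE vt) => /andP[vs' vt'].
  have csv := proj1 (andP o).
  have rt_ : rt F t = r by rewrite -(rtP cst).
  have rv : rt F v = r by rewrite -(rtP csv).
  have D3i u1 v1 w1 : rt F u1 = r -> rt F v1 = r -> rt F w1 = r -> col u1 = Col0 -> col v1 = Col1 ->
      col w1 = Col2 -> (u1, v1, w1) \in triple_set.
    by move=> h1 h2 h3 h4 h5 h6; rewrite inE /= h1 h2 h3 h4 h5 h6 !eqxx.
  have o' : onpath F t s v by rewrite -onpath_sym.
  have n1 : onpath F s v t = false.
    by apply/negP => h; case/negP: vt; rewrite (onpath_antisym fF o h).
  have n2 : onpath F v t s = false.
    apply/negP => h; case/negP: sv; rewrite (@onpath_antisym F fF t s v) // -onpath_sym //.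
    by apply: conn_trans cst; rewrite conn_sym.
  have n3 : onpath F v s t = false by rewrite onpath_sym // conn_sym.
  case cs: (col s) lt vs'; case ct: (col t) vt' => // vt' _; case cv: (col v) vt' => // _ _.
  + apply: (fin s t v); rewrite ?D3i // eqN /fullmark n1 o //.
  + apply: (fin s v t); rewrite ?D3i // eqN /fullmark o //.
  apply: (fin v s t); rewrite ?D3i // eqN /fullmark n2 n3 o //.
have [|rs sN] := mark_local eqN _ (fun e => @mark3t_supp u v w e d) sm; first by rewrite (deg_mark3t fF d).
rewrite -eqN in sN; case/and5P: (d) => /and3P[c0 c1 c2] cuv cuw n1 /andP[n2 n3].
apply: (fin u v w) => //; first by rewrite inE /= c0 c1 c2 -(rtP cuv) -(rtP cuw) rs !eqxx.
by rewrite /fullmark (negbTE n1) (negbTE n2) (negbTE n3).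
Qed.

(** A component with [n] vertices has [n - 1] edges, hence [q + n] is the weighted
number of free states on both sides; pairs and triples of vertices correspond to
marks of weight two and three. *)
Lemma local_matched : matched lsumJ lsumM.
Proof.
split; [split|split].
- rewrite lsumJ_Free lsumM_Free -[fibre]/[set v | rt F v == r] (comp_card fF root).
  by rewrite -/efibre addSnnS.
- by rewrite lsumJ_link // lsumM_link.
- by rewrite lsumJ_link // lsumM_link.
- by rewrite lsumJ_link // lsumM_link.
- by rewrite lsumJ_Full lsumM_Full.
- exact: lsumJ_Star.
by rewrite lsumM_Star lsumJ_link.
Qed.

End Counts.

(** The component standing for the edge joining the cone vertices of colours 1 and 2: an
edge [g] between a vertex [g1] of colour 1, always chosen, and a vertex [g2] of
colour 2; the edge [g] always carries a mark. *)
Section CountsApex.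
Variables (F : {set E}) (r g1 g2 : V) (g : E).
Hypotheses (fF : forest F) (fib : forall v, (rt F v == r) = (v == g1) || (v == g2))
  (efib : forall e, e \in F -> rt F (src e) = r -> e = g)
  (gF : g \in F) (sg : src g = g1) (tg : tgt g = g2) (cg1 : col g1 = Col1) (cg2 : col g2 = Col2).

Definition lsumJK z := lsum false (rt F) (fun _ m => clU (g1 |: setof m))
  (fun _ m => g1 \notin setof m : nat) r z.

Definition lsumMK z := lsum ord0 (fun e => rt F (src e)) (fun _ m => cl F (toN m))
  (fun _ m => if insupp F (toN m) then 0 < toN m g : nat else 0) r z.

Let g12 : g1 != g2. Proof. by apply/eqP => h; move: cg2; rewrite -h cg1. Qed.

Lemma lsumJKE z : lsumJK z = (z == Free) + (z == L12).
Proof.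
have -> : lsumJK z = \sum_(U : {set V} | (U \subset fibre F r) && (clU (g1 |: U) == z)) (g1 \notin U).
  rewrite /lsumJK /lsum (reindex ffof) /=; last first.
    by exists setof => m _; rewrite (setofK, ffofK).
  rewrite (eq_bigr (fun U => g1 \notin U : nat)) => [|U _]; last by rewrite ffofK.
  apply: eq_bigl => U; rewrite ffofK; congr andb; apply/supP/subsetP => h x.
    by move=> xU; rewrite inE; apply: contraTT xU => nx; rewrite -[x \in U](ffunE (fun x => x \in U)) h ?inE.
  by rewrite inE ffunE => nx; apply/negbTE; apply: contra nx => /h; rewrite inE.
have -> : \sum_(U : {set V} | (U \subset fibre F r) && (clU (g1 |: U) == z)) (g1 \notin U) =
    \sum_(U in [set set0; [set g2]]) (clU (g1 |: U) == z).
  rewrite big_mkcond [RHS]big_mkcond; apply: eq_bigr => U _; rewrite !inE.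
  case: (boolP ((U == set0) || (U == [set g2]))) => [|nU].
    case/orP=> /eqP->; rewrite ?sub0set ?inE ?sub1set ?inE ?fib ?eqxx ?orbT ?g12 /=; by case: eqP.
  case: ifP => // /andP[sU _]; case: (boolP (g1 \in U)) => // n1; case/negP: nU.
  rewrite orbC -subset1; apply/subsetP => x xU; rewrite inE.
  have := subsetP sU x xU; rewrite inE fib => /orP[/eqP xe|//].
  by rewrite -xe xU in n1.
rewrite big_setU1 ?big_set1 /=; last first.
  by rewrite inE eq_sym; apply/eqP => /setP/(_ g2); rewrite !inE eqxx.
by rewrite setU0 clU1 clU2 ?cg1 ?cg2 // ![_ == z]eq_sym.
Qed.

(** The path from [g1] to [g2] is a single edge, so all its marks are on [g]. *)
Lemma cl_apex : [/\ cl F (mset [::]) = Free, cl F (mset [:: g]) = Free,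
  cl F (mset [:: g; g]) = L12 & cl F (mset [:: g; g; g]) = Star].
Proof.
have s12 : sep F g g1 g2 by rewrite -sg -tg sep_edge.
have f1 : first F g1 g2 g by rewrite /first s12 /inc sg eqxx.
have f2 : first F g2 g1 g by rewrite /first sep_sym s12 /inc tg eqxx orbT.
have d : pair_data F g1 g2 by rewrite /pair_data cg1 cg2 (sep_conn s12).
have l12 : link (col g1) (col g2) = L12 by rewrite cg1 cg2.
have nr : col (near F g1 g) != col g2 by rewrite (first_near fF f1) cg1 cg2.
have l := last_adj fF f2 nr.
split; rewrite ?[cl F (mset [::])]cl_small ?[cl F (mset [:: g])]cl_small ?deg_mset //.
  by rewrite -(mark2E fF f1 f2) cl_mark2.
by rewrite -(mark3pE fF f1 f2 l) cl_mark3p ?eqxx //; apply: star_data.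
Qed.

Lemma lsumMKE z : lsumMK z = (z == Free) + (z == L12) + (z == Star).
Proof.
pose h (k : 'I_4) : {ffun E -> 'I_4} := [ffun e => if e == g then k else ord0].
have hinj : injective h by move=> k l /ffunP/(_ g); rewrite !ffunE eqxx.
have hN k : toN (h k) = mset (nseq k g).
  apply/ffunP => e; rewrite !ffunE count_nseq /= [g == e]eq_sym; case: eqP => _ /=.
    by rewrite mul1n.
  by rewrite mul0n.
have rg : rt F (src g) = r by apply/eqP; rewrite sg fib eqxx.
have -> : lsumMK z = \sum_(m in [set h k | k : 'I_4]) (if cl F (toN m) == z then 0 < toN m g : nat else 0).
  rewrite /lsumMK /lsum big_mkcond [RHS]big_mkcond; apply: eq_bigr => m _.
  case: imsetP => [[k _ ->]|nh].
    have -> : sup ord0 (fun e => rt F (src e)) [set r] (h k).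
      by apply/supM => e; rewrite hN mset_in => /nseqP[->].
    have -> : insupp F (toN (h k)) = true.
      by apply/forallP => e; apply/implyP; rewrite hN mset_in => /nseqP[->].
    by [].
  case: ifP => // /andP[/supM sm _]; case: ifP => // /forallP sF.
  case: nh; exists (m g) => //; apply/ffunP => e; rewrite ffunE; case: eqP => [->//|ne].
  apply/val_inj/eqP; rewrite /= -leqn0 leqNgt; apply/negP => pos.
  have pe : 0 < toN m e by rewrite ffunE.
  by apply: ne; apply: efib (implyP (sF e) pe) (sm e pe).
rewrite big_imset /=; last by move=> k l _ _; apply: hinj.
rewrite (eq_bigl xpredT) // !big_ord_recl big_ord0 !hN /=; have [-> -> -> ->] := cl_apex.
rewrite !mset_in !inE eqxx /=.
by case: z.
Qed.

Lemma apex_matched : matched lsumJK lsumMK.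
Proof. by split; [split|split]; rewrite ?lsumJKE ?lsumMKE. Qed.

End CountsApex.

End ColouredGraph.

(** * Bases and independent sets *)

(** A matroid given by its independent sets and its set of bases [Bs]. *)
Section Intervals.
Variables (disp : Order.disp_t) (E : finOrderType disp).
Variables (indep : pred {set E}) (Bs : {set {set E}}) (r : nat).
Hypotheses (indep_sub : forall I J : {set E}, I \subset J -> indep J -> indep I)
  (indep_aug : forall I J : {set E}, indep I -> indep J -> #|I| < #|J| ->
     exists2 e, e \in J :\: I & indep (e |: I))
  (basesP : forall B, (B \in Bs) = indep B && (#|B| == r))
  (indep_le : forall I : {set E}, indep I -> #|I| <= r)
  (bases_ex : exists B, B \in Bs).
Implicit Types (I J B X : {set E}) (e f i j : E).

Lemma base_extend X B' : indep X -> B' \in Bs ->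
  exists B, [/\ B \in Bs, X \subset B & B \subset X :|: B'].
Proof.
have [k] := ubnP (r - #|X|); elim: k X => // k IH X; rewrite ltnS => le iX B'b.
have := B'b; rewrite basesP => /andP[iB' /eqP cB'].
have [lt|ge] := ltnP #|X| #|B'|; last first.
  exists X; rewrite basesP iX eqn_leq indep_le // -cB' ge; split=> //; exact: subsetUl.
have [e] := indep_aug iX iB' lt; rewrite inE => /andP[eX eB'] iX'.
have [|B [Bb sB Bs']] := IH (e |: X) _ iX' B'b.
  by rewrite cardsU1 eX add1n subnS prednK // subn_gt0 -cB'.
exists B; split=> //; first by apply: subset_trans sB; apply: subsetUr.
apply: subset_trans Bs' _; apply/subsetP => x; rewrite !inE => /orP[/orP[/eqP->|->]|->] //;
  by rewrite ?eB' ?orbT.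
Qed.

Lemma base_exchange B B' e : B \in Bs -> B' \in Bs -> e \in B :\: B' ->
  exists2 f, f \in B' :\: B & (e |: (B' :\ f)) \in Bs.
Proof.
move=> Bb B'b; rewrite inE => /andP[eB' eB].
have iX : indep (e |: (B :&: B')).
  move: Bb; rewrite basesP => /andP[iB _]; apply: indep_sub iB.
  by apply/subsetP => x; rewrite !inE => /orP[/eqP->|/andP[]].
have [B2 [B2b sX sB2]] := base_extend iX B'b.
have cB2 : #|B2| = #|B'| by move: B2b B'b; rewrite !basesP => /andP[_ /eqP->] /andP[_ /eqP->].
have sB2' : B2 \subset e |: B'.
  apply: subset_trans sB2 _; apply/subsetP => x; rewrite !inE.
  by case/orP=> [/orP[->|/andP[_ ->]]|->]; rewrite ?orbT.
have /eqP/cards1P[f fE] : #|(e |: B') :\: B2| = 1.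
  have := cardsID B2 (e |: B'); rewrite (setIidPr sB2') cardsU1 eB' cB2 /= add1n.
  by lia.
have fin : f \in (e |: B') :\: B2 by rewrite fE inE.
have eB2 : e \in B2 by apply: (subsetP sX); rewrite setU11.
have nfe : f != e by move: fin; apply: contraTneq => ->; rewrite inE eB2.
have fB' : f \in B' by move: fin; rewrite !inE (negbTE nfe) => /andP[].
exists f; first rewrite inE fB' andbT.
  apply/negP => fB; move: fin; rewrite inE => /andP[/negP[]].
  by apply: (subsetP sX); rewrite !inE fB fB' orbT.
suff -> : e |: (B' :\ f) = B2 by [].
apply/setP => x; have := congr1 (fun S : {set E} => x \in S) fE; rewrite !inE.
case: (eqVneq x e) => [->|ne]; first by rewrite eB2.
have := subsetP sB2' x; rewrite !inE (negbTE ne) /=.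
case: (x \in B2) => /=; first by move=> /(_ isT) -> <-.
by case: (x \in B') => _ <-.
Qed.

(** The base containing [I] with the smallest elements: an element outside [I] cannot
be exchanged for a smaller one. *)
Lemma interval_ex I : indep I -> exists B, [/\ B \in Bs, passive Bs B \subset I & I \subset B].
Proof.
move=> iI; have [B0 B0b] := bases_ex; have [B1 [B1b sI _]] := base_extend iI B0b.
pose rank e := #|[set x : E | (x < e)%O]|; pose wt (B : {set E}) := \sum_(e in B) rank e.
have P1 : (B1 \in Bs) && (I \subset B1) by rewrite B1b.
case: (@arg_minnP _ B1 (fun B => (B \in Bs) && (I \subset B)) wt P1) => B /andP[Bb sB] minB.
exists B; split=> //; apply/subsetP => b; rewrite inE => /andP[bB].
rewrite /active bB /= => nact; apply: contraR nact => bI.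
apply/forallP => j; apply/implyP => /andP[jb jB]; apply/negP => B'b.
have := minB (j |: (B :\ b)); rewrite B'b /= => /(_ _).
have -> : I \subset j |: B :\ b.
  apply/subsetP => x xI; rewrite !inE (subsetP sB x xI) andbT orbC.
  by apply/orP; left; apply: contraNneq bI => <-.
move=> /(_ isT); rewrite leqNgt => /negP[].
have -> : wt (j |: B :\ b) = rank j + wt (B :\ b).
  by rewrite /wt big_setU1 // !inE (negbTE jB) andbF.
have -> : wt B = rank b + wt (B :\ b) by rewrite /wt (big_setD1 b).
rewrite ltn_add2r; apply/proper_card/properP; split.
  by apply/subsetP => x; rewrite !inE => /Order.POrderTheory.lt_trans; apply.
by exists j; rewrite inE // Order.POrderTheory.ltxx.
Qed.

(** The least element of the symmetric difference can be exchanged into the base which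
lacks it, against a larger element; that element is then passive there, so it
belongs to [I], yet it is not in the other base. *)
Lemma interval_uniq I B B' : B \in Bs -> B' \in Bs -> passive Bs B \subset I -> I \subset B ->
  passive Bs B' \subset I -> I \subset B' -> B = B'.
Proof.
move=> Bb B'b p s p' s'; apply/eqP; apply: contraT => ne.
pose S := (B :\: B') :|: (B' :\: B).
have [e0 e0S] : exists e, e \in S.
  apply/existsP; apply: contraT; rewrite negb_exists => /forallP h; case/eqP: ne.
  by apply/setP => x; have := h x; rewrite !inE; case: (x \in B); case: (x \in B').
case: (Order.TotalTheory.arg_minP (P := fun x => x \in S) id e0S) => e eS mine.
wlog eB : B B' Bb B'b p s p' s' ne @S e0S eS mine / e \in B :\: B'.
  move=> h; case/setUP: (eS) => [/h|eB']; first exact.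
  have SC : S = (B' :\: B) :|: (B :\: B') by rewrite /S setUC.
  apply: (h B' B B'b Bb p' s' p s _ _ _ _ eB'); first by rewrite eq_sym.
  - by rewrite -SC.
  - by rewrite -SC.
  by move=> x; rewrite -SC; apply: mine.
have [f fB' Xb] := base_exchange Bb B'b eB.
have ef : (e < f)%O.
  rewrite Order.POrderTheory.lt_neqAle mine ?andbT; last by rewrite inE fB' orbT.
  apply: contraTneq eB => ->; move: fB'; rewrite !inE => /andP[/negbTE-> _].
  by rewrite andbF.
move: fB' eB; rewrite !inE => /andP[fB fB'] /andP[eB' eB].
have fI : f \notin I by apply: contra fB; apply: (subsetP s).
have : f \notin passive Bs B' by apply: contra fI; apply: (subsetP p').
rewrite inE fB' negbK /active fB' /= => /forallP/(_ e).
by rewrite ef eB' /= Xb.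
Qed.

Lemma interval_sum (A B : {set E}) q : A \subset B ->
  \sum_(I : {set E} | (A \subset I) && (I \subset B)) q ^ (#|B| - #|I|) = q.+1 ^ (#|B| - #|A|).
Proof.
have [k] := ubnP #|B :\: A|; elim: k A B => // k IH A B; rewrite ltnS => le sAB.
have [/eqP|/set0Pn[b]] := eqVneq (B :\: A) set0.
  rewrite setD_eq0 => sBA; have -> : A = B by apply/eqP; rewrite eqEsubset sAB.
  rewrite (big_pred1 B) ?subnn ?expn0 // => I; rewrite andbC -eqEsubset //.
rewrite inE => /andP[bA bB].
rewrite (bigID (fun I : {set E} => b \in I)) /=.
have cB : #|B| = #|B :\ b|.+1 by rewrite (cardsD1 b) bB.
have sAB' : A \subset B :\ b by rewrite subsetD1 sAB.
have sbAB : b |: A \subset B by rewrite subUset sub1set bB.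
rewrite (eq_bigl (fun I : {set E} => (b |: A \subset I) && (I \subset B))); last first.
  by move=> I; rewrite subUset sub1set andbC andbA.
rewrite [X in _ + X](eq_bigl (fun I : {set E} => (A \subset I) && (I \subset B :\ b))); last first.
  by move=> I; rewrite subsetD1 andbA.
have lt : #|B :\: (b |: A)| < k.
  apply: leq_trans le; apply/proper_card/properP; split; first by rewrite setDS ?subsetUr.
  by exists b; rewrite !inE ?bA ?bB ?eqxx.
have lt' : #|(B :\ b) :\: A| < k.
  apply: leq_trans le; apply/proper_card/properP; split; first by rewrite setSD ?subD1set.
  by exists b; rewrite !inE ?bA ?bB ?eqxx ?andbF.
rewrite IH // (eq_bigr (fun I : {set E} => q * q ^ (#|B :\ b| - #|I|))); last first.
  by move=> I /andP[_ sI]; rewrite -expnS cB subSn // subset_leq_card.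
rewrite -big_distrr /= IH // cardsU1 bA add1n cB subSS subSn ?subset_leq_card //.
by rewrite expnS mulSn.
Qed.

(** The independent sets are partitioned into the intervals between the passive
part of a base and the base. *)
Lemma indep_sum q : \sum_(I : {set E} | indep I) q ^ (r - #|I|) =
  \sum_(B in Bs) q.+1 ^ (r - #|passive Bs B|).
Proof.
have cB B : B \in Bs -> #|B| = r by rewrite basesP => /andP[_ /eqP].
have sp B : passive Bs B \subset B by apply/subsetP => x; rewrite inE => /andP[].
rewrite [RHS](eq_bigr (fun B : {set E} => \sum_(I : {set E} | (passive Bs B \subset I) && (I \subset B)) q ^ (r - #|I|))); last first.
  by move=> B Bb; rewrite -(cB B Bb) interval_sum.
rewrite (exchange_big_dep indep) /=; last first.
  by move=> B I; rewrite basesP => /andP[iB _] /andP[_ sI]; apply: indep_sub iB.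
apply: eq_bigr => I iI; have [B [Bb pB sB]] := interval_ex iI.
rewrite (big_pred1 B) // => B'; apply/idP/eqP => [/andP[B'b /andP[p s]]|->].
  exact: interval_uniq B'b Bb p s pB sB.
by rewrite Bb pB.
Qed.

Lemma matroid_rankE : matroid_rank Bs = r.
Proof.
apply/eqP; rewrite eqn_leq; apply/andP; split.
  by apply/bigmax_leqP => B; rewrite basesP => /andP[_ /eqP->].
have [B Bb] := bases_ex; rewrite /matroid_rank (bigD1 B) //=.
by move: Bb; rewrite basesP => /andP[_ /eqP->]; rewrite leq_maxl.
Qed.

End Intervals.

(** * The graphic matroid *)

Lemma set2_eq (T : finType) (a b u v : T) : ([set a; b] == [set u; v]) =
  ((a == u) && (b == v)) || ((a == v) && (b == u)).
Proof.
apply/eqP/orP => [eqs|[]/andP[/eqP-> /eqP->]] //; last by rewrite setUC.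
have ha : a \in [set u; v] by rewrite -eqs !inE eqxx.
have hb : b \in [set u; v] by rewrite -eqs !inE eqxx orbT.
have hu : u \in [set a; b] by rewrite eqs !inE eqxx.
have hv : v \in [set a; b] by rewrite eqs !inE eqxx orbT.
move: ha hb hu hv; rewrite !inE ![_ == a]eq_sym ![_ == b]eq_sym.
by case: (a == u); case: (a == v); case: (b == u); case: (b == v) => //= *; auto.
Qed.

Section Multigraph.
Variables (V E : finType) (G : multigraph V E).
Implicit Types (e f : E) (F I J : {set E}) (x y : V).

Lemma ends_ex e : exists p : V * V, G e == [set p.1; p.2].
Proof.
have := ends_card G e; rewrite -[Defs.ends G e]/(G e).
case/andP=> /card_gt0P[x xG] le2.
have [/eqP e1|[y]] := set_0Vmem (G e :\ x).
  exists (x, x); rewrite /= setUid eqEsubset sub1set xG andbT -setD_eq0 //.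
rewrite !inE => /andP[ne yG]; exists (x, y); rewrite eq_sym eqEcard subUset !sub1set xG yG /=.
by rewrite cards2 eq_sym ne.
Qed.

(** An arbitrary orientation, in order to apply the theory of forests. *)
Definition gsrc e := (xchoose (ends_ex e)).1.
Definition gtgt e := (xchoose (ends_ex e)).2.

Lemma gendsE e : G e = [set gsrc e; gtgt e].
Proof. exact/eqP/(xchooseP (ends_ex e)). Qed.

Local Notation conn := (conn gsrc gtgt).
Local Notation forest := (forest gsrc gtgt).
Local Notation rt := (rt gsrc gtgt).

Lemma adjE I x y : adj gsrc gtgt I x y = [exists e in I, G e == [set x; y]].
Proof. by apply: eq_existsb => e; rewrite gendsE set2_eq. Qed.

Lemma connE I x y : conn I x y = connect [rel u v | [exists e in I, G e == [set u; v]]] x y.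
Proof. by apply: eq_connect => u v; rewrite adjE. Qed.

Lemma walk_conn I es s y : all (mem I) es ->
  [seq G e | e <- es] = pairmap (fun a b => [set a; b]) y s -> conn I y (last y s).
Proof.
elim: s es y => [|z s IH] [|e es] y //=; first by rewrite conn_refl.
case/andP=> eI esI [eqe eqs]; apply: conn_trans (IH _ _ esI eqs).
by apply: connect1; rewrite adjE; apply/exists_inP; exists e; rewrite ?eqe.
Qed.

Lemma path_edges I x p : path (adj gsrc gtgt I) x p -> exists es,
  all (mem I) es /\ [seq G e | e <- es] = pairmap (fun a b => [set a; b]) x p.
Proof.
elim: p x => [|y p IH] x /=; first by exists [::].
case/andP; rewrite adjE => /exists_inP[e eI /eqP eqe] /IH[es [esI eqs]].
by exists (e :: es); rewrite /= eI esI eqe eqs.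
Qed.

Definition sides (x : V) (s : seq V) : seq {set V} := pairmap (fun a b => [set a; b]) x s.

Lemma sides_sub x p (S : {set V}) z : S \in sides x p -> z \in S -> z \in x :: p.
Proof.
elim: p x => //= y p IH x; rewrite inE => /orP[/eqP->|/IH h zS].
  by rewrite !inE => /orP[]->; rewrite ?orbT.
by rewrite inE h ?orbT.
Qed.

Lemma sides_uniq x p : uniq (x :: p) -> uniq (sides x p).
Proof.
elim: p x => //= y p IH x; case/andP=> xyp u; rewrite IH // andbT.
apply: contra xyp => /sides_sub; apply; by rewrite !inE eqxx.
Qed.

Lemma cycle_sides x p : uniq (x :: p) ->
  [seq [set z; next (x :: p) z] | z <- x :: p] = sides x (rcons p x).
Proof.
move=> u; apply: (@eq_from_nth _ set0); first by rewrite size_map size_pairmap size_rcons.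
move=> i; rewrite size_map => lt; have lt' : i < size (rcons p x) by rewrite size_rcons.
rewrite (nth_map x) // (nth_pairmap x) // -rcons_cons [in RHS]nth_rcons lt.
rewrite next_nth mem_nth // index_uniq // nth_rcons; case: ltnP => // le.
rewrite (nth_default _ le); by case: eqP.
Qed.

(** A cycle through [e] is [e] together with a path between its ends that avoids it,
which exists exactly when [e] is not a bridge. *)
Lemma forest_acyclic F : acyclic G F = forest F.
Proof.
apply/acyclicP/forestP => [ac e eF|fF vs es cyc].
  apply/negP => c; have e_es := ac.
  have /connectP[p0 pth0 lst] : conn (F :\ e) (gtgt e) (gsrc e) by rewrite conn_sym.
  move: lst; case/shortenP: pth0 => p pth up _ lst.
  have [es [esI eqs]] := path_edges pth.
  have ues : uniq es by apply: (@map_uniq _ _ G); rewrite eqs; apply: sides_uniq.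
  have : cycle_along G (gtgt e :: p) (rcons es e).
    rewrite /cycle_along up rcons_uniq ues andbT /=; apply/andP; split.
      by apply/negP => /(allP esI); rewrite !inE eqxx.
    apply/eqP; apply: etrans (esym (cycle_sides up)).
    by rewrite map_rcons eqs /sides -[rcons p _]cats1 pairmap_cat /= cats1 -lst gendsE.
  move/ac/negP; apply; rewrite all_rcons inE eF /=; apply/allP => f /(allP esI).
  by rewrite !inE => /andP[].
apply/negP => al; case/and4P: cyc; case: vs => // x p _ up; case: es al => [|e es].
  by move=> _ _ /eqP/(congr1 size); rewrite !size_map.
move=> /= /andP[eF esF] /andP[ees ues] /eqP eqs; have := fF e eF; case/negP.
have esI : all (mem (F :\ e)) es.
  apply/allP => f fes; rewrite /= !inE (allP esF _ fes : f \in F) andbT.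
  by apply: contraNneq ees => <-.
have {eqs} := etrans eqs (cycle_sides up).
case: p up => [|y p] up /=.
  by case=> + _; rewrite gendsE => /eqP; rewrite set2_eq orbb => /andP[/eqP-> /eqP->]; exact: conn_refl.
case=> eqe eqs; have := walk_conn esI eqs; rewrite last_rcons => cyx.
move/eqP: eqe; rewrite gendsE set2_eq => /orP[]/andP[/eqP-> /eqP->] //.
by rewrite conn_sym.
Qed.

Hypothesis G_conn : forall x y, conn setT x y.
Hypothesis V_gt0 : 0 < #|V|.

(** If no edge of [J] extends [I], the components of [J] are contained in those of
[I], which are then at most as many; but the smaller forest has more components. *)
Lemma forest_aug I J : forest I -> forest J -> #|I| < #|J| ->
  exists2 e, e \in J :\: I & forest (e |: I).
Proof.
move=> fI fJ lt; apply/exists_inP; apply: contraT; rewrite negb_exists_in => /forall_inP no.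
have sub x y : conn J x y -> conn I x y.
  have cJ e : e \in J -> conn I (gsrc e) (gtgt e).
    move=> eJ; have [eI|eI] := boolP (e \in I); first exact: conn_edge.
    have := no e; rewrite inE eI eJ => /(_ isT); apply: contraR => nc.
    exact: forest_add.
  move=> c; apply: (conn_ind (P := conn I x)) c _; last exact: conn_refl.
  move=> e /cJ ce; split=> cx; apply: conn_trans cx _ => //; by rewrite conn_sym.
have := roots_card fI; have := roots_card fJ; move=> -> eq.
have : #|[set r | rt I r == r]| <= #|[set r | rt J r == r]|.
  rewrite -(@card_in_imset _ _ (rt J)) => [|r1 r2].
    by apply/subset_leq_card/subsetP => x /imsetP[r _ ->]; rewrite inE rt_id.
  rewrite !inE => /eqP e1 /eqP e2 e12; rewrite -e1 -e2.
  by apply/rtP/sub; rewrite -rt_eq e12.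
by lia.
Qed.

Lemma roots_gt0 I : 0 < #|[set r | rt I r == r]|.
Proof. by have /card_gt0P[x _] := V_gt0; apply/card_gt0P; exists (rt I x); rewrite inE rt_id. Qed.

Lemma forest_le I : forest I -> #|I| <= #|V|.-1.
Proof. by move=> /roots_card ->; have := roots_gt0 I; lia. Qed.

Lemma basesP B : (B \in graphic_matroid G) = forest B && (#|B| == #|V|.-1).
Proof.
rewrite inE /spanning_tree forest_acyclic andbC; have [fB|//] := boolP (forest B).
have r0 := roots_gt0 B; have eqV := roots_card fB.
have -> : (#|B| == #|V|.-1) = (#|[set r | rt B r == r]| == 1) by rewrite eqV; lia.
rewrite /=; apply/forallP/idP => [h|/cards1P[r rE] x].
  rewrite eqn_leq r0 andbT; apply/card_le1_eqP => x y; rewrite !inE => /eqP ex /eqP ey.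
  by rewrite -ex -ey; apply: rtP; rewrite connE; have /forallP := h y; apply.
apply/forallP => y; rewrite -connE -rt_eq.
have hx z : rt B z = r by apply/set1P; rewrite -rE inE rt_id.
by rewrite !hx.
Qed.

Lemma bases_ex : exists B, B \in graphic_matroid G.
Proof.
case: (@arg_maxnP _ set0 (fun B => forest B) (fun B => #|B|) (forest0 _ _)) => B fB maxB.
exists B; rewrite inE /spanning_tree forest_acyclic fB andbT.
apply/forallP => x; apply/forallP => y; rewrite -connE.
apply: (conn_ind (P := conn B x)) (G_conn x y) _; last exact: conn_refl.
have ce e : conn B (gsrc e) (gtgt e).
  apply: contraT => nc; have eB : e \notin B by apply: contra nc; apply: conn_edge.
  by have /= := maxB _ (forest_add fB nc); rewrite cardsU1 eB add1n leqNgt ltnS leqnn.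
move=> e _; split=> c; apply: conn_trans c _; rewrite ?ce // conn_sym; exact: ce.
Qed.

End Multigraph.

Section HSum.
Variables (V : finType) (disp : Order.disp_t) (E : finOrderType disp) (G : multigraph V E).
Hypothesis G_conn : forall x y, conn (gsrc G) (gtgt G) setT x y.
Hypothesis V_gt0 : 0 < #|V|.

Lemma forest_sum q :
  \sum_(I : {set E} | forest (gsrc G) (gtgt G) I) q ^ (#|V|.-1 - #|I|) =
  \sum_(B in graphic_matroid G) q.+1 ^ (#|V|.-1 - #|passive (graphic_matroid G) B|).
Proof.
apply: indep_sum.
- by move=> I J; apply: forest_sub.
- exact: forest_aug.
- exact: basesP.
- exact: forest_le.
exact: bases_ex.
Qed.

Lemma graphic_rank : matroid_rank (graphic_matroid G) = #|V|.-1.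
Proof.
apply: (matroid_rankE (indep := forest (gsrc G) (gtgt G))) => //; [exact: basesP | exact: bases_ex].
Qed.

End HSum.

(** * The auxiliary graph of a triconed graph *)

Section Partition.
Variable h : rel color.

Definition rel_cls :=
  if h Col0 Col1 then (if h Col0 Col2 then Full else L01)
  else if h Col0 Col2 then L02 else if h Col1 Col2 then L12 else Free.

Lemma rel_cls_nBad : rel_cls != Bad. Proof. by rewrite /rel_cls; do !case: ifP. Qed.

Definition join_rel k l : rel color := fun i j => [|| h i j, h i k && h l j | h i l && h k j].

End Partition.

Lemma rel_cls_join (h : rel color) k l : reflexive h -> symmetric h -> transitive h ->
  mulc (rel_cls h) (link k l) = if h k l then Bad else rel_cls (join_rel h k l).
Proof.
move=> hr hs ht; rewrite /rel_cls /join_rel.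
have h1 := hs Col1 Col0; have h2 := hs Col2 Col0; have h3 := hs Col2 Col1.
have t1 := ht Col1 Col0 Col2; have t2 := ht Col0 Col1 Col2; have t3 := ht Col2 Col0 Col1.
case: k; case: l; rewrite ?hr ?h1 ?h2 ?h3 /=;
move: t1 t2 t3; rewrite ?h1 ?h2 ?h3;
case: (h Col0 Col1); case: (h Col0 Col2); case: (h Col1 Col2) => //= t1 t2 t3;
by [have := t1 isT isT | have := t2 isT isT | have := t3 isT isT].
Qed.

Lemma eq_rel_cls (h h' : rel color) : (forall i j, h i j = h' i j) -> rel_cls h = rel_cls h'.
Proof. by move=> e; rewrite /rel_cls !e. Qed.
(** The cone vertices have colours 0, 1 and 2. The edges are sorted by the number of
their ends among these vertices: none ([real]), one ([cone]), or two ([both]). *)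
Section Triconed.
Variables (V E : finType) (G : multigraph V E) (v0 v1 v2 : V) (e01 e02 : E).
Hypotheses (uniqv : uniq [:: v0; v1; v2])
  (G01 : G e01 == [set v0; v1]) (G02 : G e02 == [set v0; v2])
  (nopar : forall e f, parallel G e f -> forall v, v \in [:: v0; v1; v2] -> v \notin G e)
  (cover : forall v, v \notin [:: v0; v1; v2] ->
     exists2 u, u \in [:: v0; v1; v2] & adjacent G v u).
Implicit Types (e f a b : E) (x y z v : V) (I J F : {set E}) (k l : color).

Local Notation gsrc := (gsrc G).
Local Notation gtgt := (gtgt G).
Local Notation gconn := (conn gsrc gtgt).
Local Notation gforest := (forest gsrc gtgt).

Definition apex k := match k with Col0 => v0 | Col1 => v1 | Col2 => v2 end.
Definition apexes := [:: v0; v1; v2].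
Definition colof x := if x == v0 then Col0 else if x == v1 then Col1 else Col2.

Lemma apexK k : colof (apex k) = k.
Proof.
move: uniqv; rewrite /= !inE negb_or andbT => /andP[/andP[n01 n02] n12]; rewrite /colof.
by case: k; rewrite /= ?eqxx // eq_sym ?(negbTE n01) ?(negbTE n02) ?eqxx // eq_sym (negbTE n12).
Qed.

Lemma apex_inj : injective apex. Proof. exact: can_inj apexK. Qed.

Lemma colofK x : x \in apexes -> apex (colof x) = x.
Proof. by rewrite !inE => /or3P[]/eqP->; [have := apexK Col0|have := apexK Col1|have := apexK Col2] => /= ->. Qed.

Lemma apex_in k : apex k \in apexes. Proof. by case: k; rewrite !inE eqxx ?orbT. Qed.

Definition both e := (gsrc e \in apexes) && (gtgt e \in apexes).
Definition real e := (gsrc e \notin apexes) && (gtgt e \notin apexes).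
Definition cone e := (gsrc e \in apexes) != (gtgt e \in apexes).
Definition out e := if gsrc e \in apexes then gtgt e else gsrc e.
Definition tip e := if gsrc e \in apexes then gsrc e else gtgt e.
Definition is12 e := G e == [set v1; v2].

Lemma kind e : [|| real e, cone e | both e].
Proof. by rewrite /real /cone /both; case: (_ \in _); case: (_ \in _). Qed.

Lemma realNcone e : real e -> cone e = false.
Proof. by rewrite /real /cone; case: (_ \in _); case: (_ \in _). Qed.
Lemma realNboth e : real e -> both e = false.
Proof. by rewrite /real /both; case: (_ \in _); case: (_ \in _). Qed.
Lemma coneNboth e : cone e -> both e = false.
Proof. by rewrite /cone /both; case: (_ \in _); case: (_ \in _). Qed.

Lemma out_notin e : cone e -> out e \notin apexes.
Proof. by rewrite /cone /out; case: (boolP (gsrc e \in _)) => //; case: (gtgt e \in _). Qed.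
Lemma tip_in e : cone e -> tip e \in apexes.
Proof. by rewrite /cone /tip; case: (boolP (gsrc e \in _)) => //; case: (gtgt e \in _). Qed.

Lemma both_apex e k l : G e == [set apex k; apex l] -> both e.
Proof.
rewrite gendsE set2_eq /both => /orP[]/andP[/eqP-> /eqP->]; by rewrite !apex_in.
Qed.

Lemma is12_both e : is12 e -> both e. Proof. exact: (@both_apex e Col1 Col2). Qed.
Lemma e01_both : both e01. Proof. exact: (@both_apex e01 Col0 Col1). Qed.
Lemma e02_both : both e02. Proof. exact: (@both_apex e02 Col0 Col2). Qed.

Lemma apex_uniq_edge e f k l : k != l -> G e == [set apex k; apex l] -> G f == [set apex k; apex l] -> e = f.
Proof.
move=> kl /eqP Ge /eqP Gf; apply/eqP; apply: contraT => ne.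
have par : parallel G e f.
  by rewrite /parallel ne -[Defs.ends G e]/(G e) Ge Gf eqxx cards2 (inj_eq apex_inj) kl.
have := nopar par (apex_in k); by rewrite -[Defs.ends G e]/(G e) Ge !inE eqxx.
Qed.

Lemma is12_uniq e f : is12 e -> is12 f -> e = f.
Proof. exact: (@apex_uniq_edge _ _ Col1 Col2). Qed.

Lemma cone_ex x : x \notin apexes -> exists e, cone e && (out e == x).
Proof.
move=> nx; have [u u_in /existsP[e /eqP Ge]] := cover nx; exists e.
have := esym Ge; rewrite gendsE => /eqP; rewrite set2_eq /cone /out.
have nux : (x \in apexes) = false by apply/negbTE.
by case/orP=> /andP[/eqP<- /eqP<-]; rewrite ?nux u_in ?eqxx.
Qed.

(** A cone edge chosen at each vertex which is not a cone vertex. *)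
Definition rep x := odflt e01 [pick e | cone e && (out e == x)].

Lemma repP x : x \notin apexes -> cone (rep x) /\ out (rep x) = x.
Proof.
move=> nx; rewrite /rep; case: pickP => [e /andP[ce /eqP oe] //|none].
by have [e] := cone_ex nx; rewrite none.
Qed.

(** The auxiliary coloured graph has the edges of the graph both as vertices and as
edges. A real edge joins the representatives of its ends; a cone edge, as an
edge, joins itself to the representative of the same vertex, so that the cone
edges at one vertex form a star. The edge between the cone vertices of
colours 1 and 2, if any, is a further vertex of colour 2, and as an edge ties this
vertex to [e01], of colour 1. The other edges are loops, which no forest contains. *)
Definition hs e := if real e then rep (gsrc e) else if is12 e then e01 else e.
Definition ht e := if real e then rep (gtgt e) else if cone e then rep (out e) else e.
Definition hc e := if cone e then colof (tip e) else if is12 e then Col2 else Col1.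

Local Notation hconn := (conn hs ht).
Local Notation hforest := (forest hs ht).
Local Notation hrt := (rt hs ht).

(** The forests of interest contain all edges of the stars, and [K12]. *)
Definition Z := [set e | cone e && (rep (out e) != e)].
Definition K12 := [set e | is12 e].
Definition ZK := Z :|: K12.

Lemma hs_real e : real e -> hs e = rep (gsrc e). Proof. by rewrite /hs => ->. Qed.
Lemma ht_real e : real e -> ht e = rep (gtgt e). Proof. by rewrite /ht => ->. Qed.

Lemma is12Nreal e : is12 e -> real e = false.
Proof. by move/is12_both; apply: contraTF => /realNboth ->. Qed.
Lemma is12Ncone e : is12 e -> cone e = false.
Proof. by move/is12_both; apply: contraTF => /coneNboth ->. Qed.

Lemma hs_cone e : cone e -> hs e = e.
Proof.
move=> ce; rewrite /hs; case: ifP => [/realNcone|_]; first by rewrite ce.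
by case: ifP => // /is12Ncone; rewrite ce.
Qed.
Lemma ht_cone e : cone e -> ht e = rep (out e).
Proof. by move=> ce; rewrite /ht ce; case: ifP => // /realNcone; rewrite ce. Qed.
Lemma hs_12 e : is12 e -> hs e = e01.
Proof. by move=> h; rewrite /hs is12Nreal // h. Qed.
Lemma ht_12 e : is12 e -> ht e = e.
Proof. by move=> h; rewrite /ht is12Nreal // is12Ncone. Qed.

Lemma e01_n12 : is12 e01 = false.
Proof.
move: uniqv; rewrite /= !inE negb_or => /andP[/andP[n01 n02] _].
by apply/negbTE; rewrite /is12 (eqP G01) set2_eq (negbTE n01) (negbTE n02).
Qed.
Lemma e02_n12 : is12 e02 = false.
Proof.
move: uniqv; rewrite /= !inE negb_or => /andP[/andP[n01 n02] _].
by apply/negbTE; rewrite /is12 (eqP G02) set2_eq (negbTE n01) (negbTE n02).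
Qed.

Lemma e01_ncone : cone e01 = false.
Proof. by case h: (cone e01) => //; have := coneNboth h; rewrite e01_both. Qed.

(** Contracting the stars gives back the graph without its cone vertices; the two
vertices joined by [K12] are sent to one of the latter. *)
Definition hmap a := if cone a then out a else v1.

Section Contract.
Variable F0 : {set E}.
Hypothesis F0real : forall e, e \in F0 -> real e.

Lemma hmap_conn (A : {set E}) a b : A \subset F0 :|: ZK ->
  hconn A a b -> gconn (A :&: F0) (hmap a) (hmap b).
Proof.
move=> sA c; apply: (conn_ind (P := fun b => gconn (A :&: F0) (hmap a) (hmap b))) c _; last exact: conn_refl.
move=> e eA; have := subsetP sA e eA; rewrite !inE => /or3P[eF|/andP[ce _]|e12].
- have re := F0real eF; have := realNcone re; move: (re) => /andP[/repP[c1 o1] /repP[c2 o2]] _.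
  rewrite hs_real // ht_real // /hmap c1 c2 o1 o2.
  have ce : gconn (A :&: F0) (gsrc e) (gtgt e) by apply: conn_edge; rewrite inE eA.
  split=> h; apply: conn_trans h _ => //; by rewrite conn_sym.
- by have [c1 o1] := repP (out_notin ce); rewrite hs_cone // ht_cone // /hmap ce c1 o1.
by rewrite hs_12 // ht_12 // /hmap (is12Ncone e12) e01_ncone.
Qed.

Lemma rep_conn (A : {set E}) x y : A \subset F0 -> x \notin apexes -> gconn A x y ->
  y \notin apexes /\ hconn (A :|: ZK) (rep x) (rep y).
Proof.
move=> sA nx c; apply: (conn_ind (P := fun y => y \notin apexes /\ hconn (A :|: ZK) (rep x) (rep y))) c _;
  last by rewrite conn_refl.
move=> e eA; have re := F0real (subsetP sA e eA); have /andP[n1 n2] := re.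
have ce : hconn (A :|: ZK) (hs e) (ht e) by apply: conn_edge; rewrite inE eA.
rewrite hs_real // ht_real // in ce.
by split=> -[_ h]; split=> //; apply: conn_trans h _ => //; rewrite conn_sym.
Qed.

Lemma cone_rep_conn (A : {set E}) a : cone a -> hconn (A :|: ZK) a (rep (out a)).
Proof.
move=> ca; have [->|ne] := eqVneq (rep (out a)) a; first exact: conn_refl.
have := @conn_edge _ _ hs ht (A :|: ZK) a; rewrite hs_cone // ht_cone //; apply.
by rewrite !inE ca ne orbT.
Qed.

Lemma cone_conn a b : cone a -> cone b ->
  hconn (F0 :|: ZK) a b = gconn F0 (out a) (out b).
Proof.
move=> ca cb; apply/idP/idP => [/(hmap_conn (subxx _))|c].
  rewrite /hmap ca cb; apply: conn_sub; exact: subsetIr.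
have [_ c'] := rep_conn (subxx _) (out_notin ca) c.
apply: conn_trans (cone_rep_conn _ ca) (conn_trans c' _).
by rewrite conn_sym cone_rep_conn.
Qed.

Lemma lone_conn (A : {set E}) a b : (forall e, e \in A -> a != hs e /\ a != ht e) ->
  hconn A a b -> a = b.
Proof.
move=> lone c; apply: (conn_ind (P := fun b => a = b)) c _ => // e /lone[n1 n2].
by split=> h; [move: n1 | move: n2]; rewrite h eqxx.
Qed.

Lemma hforestE : hforest (F0 :|: ZK) = gforest F0.
Proof.
apply/forestP/forestP => fF e eF.
  have re := F0real eF; have /andP[n1 n2] := re.
  have := fF e; rewrite inE eF hs_real // ht_real // => /(_ isT).
  apply: contra => c; have [_ c'] := rep_conn (subD1set _ _) n1 c.
  apply: conn_sub c'; apply/subsetP => f; rewrite !inE.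
  case/or3P=> [/andP[-> ->] //|/andP[cf ne]|f12].
    rewrite cf ne orbT andbT; apply: contraTneq cf => ->; by rewrite realNcone.
  by rewrite f12 !orbT andbT; apply: contraTneq f12 => ->; apply/negP => /is12Nreal; rewrite re.
move: eF; rewrite !inE => /or3P[eF|/andP[ce ne]|e12].
- have re := F0real eF; have /andP[/repP[c1 o1] /repP[c2 o2]] := re.
  rewrite hs_real // ht_real //; apply: contra (fF e eF) => /(hmap_conn (subD1set _ _)).
  rewrite /hmap c1 c2 o1 o2; apply: conn_sub; apply/subsetP => f.
  by rewrite !inE => /andP[/andP[-> _] ->].
- rewrite hs_cone // ht_cone //; apply/negP => /lone_conn h.
  have [c1 o1] := repP (out_notin ce).
  suff eqe : e = rep (out e) by move: ne; rewrite -eqe eqxx.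
  apply: h => f; rewrite !inE => /andP[nf /or3P[fF'|/andP[cf nf']|f12]].
  + have rf := F0real fF'; have /andP[/repP[c2 o2] /repP[c3 o3]] := rf.
    rewrite hs_real // ht_real //; split; apply: contraNneq ne => ->; [by rewrite o2 | by rewrite o3].
  + rewrite hs_cone // ht_cone // eq_sym nf; split=> //.
    have [c4 o4] := repP (out_notin cf); by apply: contraNneq ne => ->; rewrite o4.
  rewrite hs_12 // ht_12 //; split; last by rewrite eq_sym.
  by apply: contraTneq ce => ->; rewrite e01_ncone.
rewrite hs_12 // ht_12 // conn_sym; apply/negP => /lone_conn h.
have := e01_n12; rewrite -(h _) ?e12 // => f; rewrite !inE => /andP[nf].
have ne c : cone c -> e != c by move=> cc; apply: contraTneq cc => <-; rewrite is12Ncone.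
case/or3P=> [fF'|/andP[cf nf']|f12].
- have rf := F0real fF'; have /andP[/repP[c2 o2] /repP[c3 o3]] := rf.
  by rewrite hs_real // ht_real // !ne.
- have [c4 o4] := repP (out_notin cf).
  by rewrite hs_cone // ht_cone // !ne.
by rewrite (is12_uniq f12 e12) eqxx in nf.
Qed.

End Contract.

(** The edges that are neither real nor in [ZK] are loops. *)
Lemma hforest_split F : hforest F -> ZK \subset F -> F = [set e in F | real e] :|: ZK.
Proof.
move=> /forestP fF sF; apply/setP => e; rewrite !inE; apply/idP/idP => [eF|]; last first.
  case/orP=> [/andP[] //|h]; apply: (subsetP sF); by rewrite !inE.
rewrite eF /=; have := fF e eF; case: (boolP (real e)) => //= nr.
case: (boolP (is12 e)) => [_|n12]; first by rewrite orbT.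
case: (boolP (cone e)) => [ce|nc]; rewrite ?orbF /=.
  by rewrite hs_cone // ht_cone //; apply: contraR; rewrite negbK => /eqP->; exact: conn_refl.
by rewrite /hs /ht (negbTE nr) (negbTE n12) (negbTE nc) conn_refl.
Qed.

(** * Adding the edges at the cone vertices *)

(** An edge [a] whose ends are already connected to the cone vertices of colours [k]
and [l] closes a cycle or joins their components. *)
Section Join.
Variables (I : {set E}) (a : E) (k l : color).
Hypotheses (aI : a \notin I)
  (ends : (gconn I (gsrc a) (apex k) /\ gconn I (gtgt a) (apex l)) \/
          (gconn I (gsrc a) (apex l) /\ gconn I (gtgt a) (apex k))).

Definition apex_rel (I : {set E}) : rel color := fun i j => gconn I (apex i) (apex j).

Lemma join_forest : gforest (a |: I) = gforest I && ~~ apex_rel I k l.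
Proof.
rewrite forest_addE //; congr (_ && ~~ _); rewrite /apex_rel.
case: ends => -[c1 c2].
  by rewrite -!rt_eq (rtP c1) (rtP c2).
by rewrite -!rt_eq (rtP c1) (rtP c2) eq_sym.
Qed.

Lemma join_apex_rel i j : apex_rel (a |: I) i j = join_rel (apex_rel I) k l i j.
Proof.
have ain : a \in a |: I by apply: setU11.
have cl : gconn (a |: I) (apex k) (apex l).
  have ce := conn_edge gsrc gtgt ain.
  case: ends => -[/(conn_sub (subsetUr [set a] I)) c1 /(conn_sub (subsetUr [set a] I)) c2].
    by rewrite -rt_eq -(rtP c1) -(rtP c2) rt_eq.
  by rewrite -rt_eq -(rtP c1) -(rtP c2) rt_eq conn_sym.
have eqs x : gconn I (gsrc a) x = (rt gsrc gtgt I (gsrc a) == rt gsrc gtgt I x) by rewrite rt_eq.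
apply/idP/or3P => [/conn_add c|].
  move: c; rewrite -!rt_eq; case: ends => -[/rtP-> /rtP->];
  rewrite !rt_eq /apex_rel => -[?|[? ?]|[? ?]].
  - by constructor 1.
  - by constructor 2; apply/andP.
  - by constructor 3; apply/andP.
  - by constructor 1.
  - by constructor 3; apply/andP.
  - by constructor 2; apply/andP.
have sub x y : gconn I x y -> gconn (a |: I) x y by apply/conn_sub/subsetUr.
case=> [/sub //|/andP[/sub c1 /sub c2]|/andP[/sub c1 /sub c2]].
  exact: conn_trans c1 (conn_trans cl c2).
by apply: conn_trans c1 (conn_trans _ c2); rewrite conn_sym.
Qed.

End Join.

Lemma apex_rel_refl I : reflexive (apex_rel I). Proof. by move=> i; apply: conn_refl. Qed.
Lemma apex_rel_sym I : symmetric (apex_rel I). Proof. by move=> i j; apply: conn_sym. Qed.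
Lemma apex_rel_trans I : transitive (apex_rel I). Proof. by move=> i j m; apply: conn_trans. Qed.

(** The real part [F0] of a forest is fixed from here on; [F] is the corresponding
forest of the auxiliary graph. *)
Section Fixed.
Variable F0 : {set E}.
Hypotheses (F0real : forall e, e \in F0 -> real e) (fF0 : gforest F0).
Let F := F0 :|: ZK.

(** The edges that behave like cone edges, including one which joins the cone vertices
of colours 1 and 2. *)
Definition kcone a := cone a || is12 a.
Definition eps := [exists e, is12 e].

(** When there is an edge joining the cone vertices 1 and 2, it is treated as a second
cone edge of a component in which [e01] is always chosen as one of colour 1. *)
Definition chosen (J : {set E}) := [set a in J | kcone a] :|: (if eps then [set e01] else set0).
Definition comp r (S : {set E}) := [set a in S | hrt F a == r].
Definition apex_cls (J : {set E}) :=
  \big[mulc/Free]_(a in J | both a && ~~ is12 a) link (colof (gsrc a)) (colof (gtgt a)).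

(** The connection between the cone vertices which the edges [J], none of them real,
make together with [F0]. *)
Definition jcls J := mulc (apex_cls J) (\big[mulc/Free]_r clU hc (comp r (chosen J))).

Lemma hc_cone a : cone a -> hc a = colof (tip a). Proof. by rewrite /hc => ->. Qed.
Lemma hc_12 a : is12 a -> hc a = Col2.
Proof. by move=> h; rewrite /hc (is12Ncone h) h. Qed.
Lemma hc_01 : hc e01 = Col1.
Proof. by rewrite /hc e01_ncone e01_n12. Qed.

Lemma F0_apex x k : x \notin apexes -> ~~ gconn F0 x (apex k).
Proof.
move=> nx; apply/negP => /(rep_conn F0real (subxx _) nx)[].
by rewrite apex_in.
Qed.

Lemma cone_n01 a : cone a -> ~~ hconn F a e01.
Proof.
move=> ca; apply/negP => /(hmap_conn F0real (subxx _)).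
rewrite /hmap ca e01_ncone => /(conn_sub (subsetIr _ _)).
by apply/negP/(@F0_apex _ Col1)/out_notin.
Qed.

Lemma hc_apex a : cone a -> apex (hc a) = tip a.
Proof. by move=> ca; rewrite hc_cone // colofK // tip_in. Qed.

Lemma jcls_add (J : {set E}) a : a \notin J -> both a && ~~ is12 a ->
  jcls (a |: J) = mulc (jcls J) (link (colof (gsrc a)) (colof (gtgt a))).
Proof.
move=> aJ /andP[ba n12].
have WE : chosen (a |: J) = chosen J.
  rewrite /chosen; congr setU; apply/setP => b; rewrite !inE; case: eqP => // ->.
  by rewrite /kcone (negbTE n12) orbF; case ca: (cone a); rewrite ?andbF // (coneNboth ca) in ba *.
rewrite /jcls WE /apex_cls (bigD1 a) /=; last by rewrite setU11 ba n12.
rewrite (eq_bigl (fun b => (b \in J) && (both b && ~~ is12 b))); last first.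
  move=> b; rewrite !inE; case: eqP => [->|_]; last by rewrite andbT.
  by rewrite andbF (negbTE aJ).
by rewrite -/(apex_cls J) -mulcA [RHS]mulcC.
Qed.

(** The edges of [J] are added one by one. A first cone edge at a component of [F0]
attaches it and changes nothing else; any other edge joins two cone vertices,
namely those of its colour and of the colour of an edge chosen before in the same
component. *)
Lemma jcls_step (J : {set E}) a : a \notin J -> ~~ real a -> (forall e, e \in J -> ~~ real e) ->
  gforest (F0 :|: J) = (jcls J != Bad) /\ (gforest (F0 :|: J) -> rel_cls (apex_rel (F0 :|: J)) = jcls J) ->
  gforest (F0 :|: (a |: J)) = (jcls (a |: J) != Bad) /\
  (gforest (F0 :|: (a |: J)) -> rel_cls (apex_rel (F0 :|: (a |: J))) = jcls (a |: J)).
Proof.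
move=> aJ nra nrJ [IH1 IH2]; set I := F0 :|: J in IH1 IH2 *.
have aI : a \notin I.
  by rewrite inE negb_or aJ andbT; apply: contra nra => /F0real.
have eqI : F0 :|: (a |: J) = a |: I by rewrite setUCA.
rewrite eqI.
have join k l : (gconn I (gsrc a) (apex k) /\ gconn I (gtgt a) (apex l)) \/
          (gconn I (gsrc a) (apex l) /\ gconn I (gtgt a) (apex k)) ->
    jcls (a |: J) = mulc (jcls J) (link k l) ->
    gforest (a |: I) = (jcls (a |: J) != Bad) /\ (gforest (a |: I) -> rel_cls (apex_rel (a |: I)) = jcls (a |: J)).
  move=> ends eqst; rewrite (join_forest aI ends) IH1 eqst (eq_rel_cls (join_apex_rel ends)).
  case: (eqVneq (jcls J) Bad) => [->|nb] /=; first by case: (link k l).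
  have eqp := IH2 (etrans IH1 nb).
  have := rel_cls_join k l (@apex_rel_refl I) (@apex_rel_sym I) (@apex_rel_trans I); rewrite eqp => ->.
  by case: (apex_rel I k l) => //; rewrite rel_cls_nBad.
have [ka|nka] := boolP (kcone a); last first.
  move: nka; rewrite negb_or => /andP[nca n12].
  have ba : both a by have := kind a; rewrite (negbTE nca) (negbTE nra).
  have [b1 b2] := andP ba; apply: (join (colof (gsrc a)) (colof (gtgt a))).
    by left; rewrite !colofK // !conn_refl.
  by apply: jcls_add; rewrite ?ba ?n12.
have WE : chosen (a |: J) = a |: chosen J.
  by apply/setP => x; rewrite !inE; case: eqP => [->|] //=; rewrite ka.
have ne01 : a != e01.
  by apply: contraTneq ka => ->; rewrite /kcone e01_ncone e01_n12.
have aW : a \notin chosen J.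
  by rewrite /chosen !inE (negbTE aJ) /=; case: eps; rewrite !inE // (negbTE ne01).
have lkE : apex_cls (a |: J) = apex_cls J.
  apply: eq_bigl => x; rewrite !inE; case: eqP => [->|_] //.
  rewrite (negbTE aJ) /=; case/orP: ka => [/coneNboth->//|->]; by rewrite andbF.
have compE r : comp r (a |: chosen J) = if hrt F a == r then a |: comp r (chosen J) else comp r (chosen J).
  have [ar|ar] := ifPn (hrt F a == r); apply/setP => b; rewrite !inE; case: (eqVneq b a) => [->|_] //=.
  by rewrite (negbTE ar) ?andbF.
set r := hrt F a.
have stE : jcls (a |: J) = mulc (apex_cls J) (mulc (clU hc (a |: comp r (chosen J)))
    (\big[mulc/Free]_(i | i != r) clU hc (comp i (chosen J)))).
  rewrite /jcls lkE WE (bigD1 r) //= compE eqxx; congr (mulc _ (mulc _ _)).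
  by apply: eq_bigr => i ne; rewrite compE eq_sym (negbTE ne).
have stE0 : jcls J = mulc (apex_cls J) (mulc (clU hc (comp r (chosen J)))
    (\big[mulc/Free]_(i | i != r) clU hc (comp i (chosen J)))).
  by rewrite /jcls (bigD1 r).
have aC : a \notin comp r (chosen J) by rewrite inE (negbTE aW).
have [C0|[a' a'C]] := set_0Vmem (comp r (chosen J)).
  have ca : cone a.
    case/orP: ka => // a12; exfalso.
    have : e01 \in comp r (chosen J); last by rewrite C0 inE.
    have e : eps by apply/existsP; exists a.
    rewrite !inE e !inE eqxx orbT /= rt_eq.
    have := @conn_edge _ _ hs ht F a; rewrite (hs_12 a12) (ht_12 a12); apply.
    by rewrite !inE a12 !orbT.
  have eqst : jcls (a |: J) = jcls J by rewrite stE stE0 C0 setU0 clU1 (clU_small _ (_ : #|set0| <= 1)) ?cards0.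
  have iso y : gconn I (out a) y -> gconn F0 (out a) y.
    move=> c; apply: (conn_ind (P := gconn F0 (out a))) c _; last exact: conn_refl.
    move=> e; rewrite inE => /orP[eF|eJ].
      have ce := conn_edge gsrc gtgt eF.
      by split=> h; apply: conn_trans h _ => //; rewrite conn_sym.
    have nap x : x \in apexes -> ~ gconn F0 (out a) x.
      by move=> /colofK <-; apply/negP/F0_apex/out_notin.
    have nout : cone e -> ~ gconn F0 (out a) (out e).
      move=> ce; rewrite -(cone_conn F0real ca ce) => c.
      have : e \in comp r (chosen J); last by rewrite C0 inE.
      by rewrite !inE eJ /kcone ce /= rt_eq conn_sym.
    have := kind e; rewrite (negbTE (nrJ e eJ)) /= => /orP[ce|/andP[b1 b2]]; last first.
      by split=> /(nap _).
    have := nout ce; have := nap _ (tip_in ce).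
    by rewrite -[tip e]/(if gsrc e \in apexes then gsrc e else gtgt e)
      -[out e]/(if gsrc e \in apexes then gtgt e else gsrc e); case: (gsrc e \in apexes); split.
  have nap i : ~~ gconn I (out a) (apex i).
    by apply/negP => /iso; apply/negP/F0_apex/out_notin.
  have ends : (gsrc a = out a /\ gtgt a = tip a) \/ (gsrc a = tip a /\ gtgt a = out a).
    by rewrite /out /tip; case: ifP; auto.
  rewrite eqst; have -> : gforest (a |: I) = gforest I.
    rewrite forest_addE // -(hc_apex ca) in ends *; case: ends => -[-> ->];
    by rewrite ?nap ?andbT // conn_sym nap andbT.
  suff -> : rel_cls (apex_rel (a |: I)) = rel_cls (apex_rel I) by [].
  apply: eq_rel_cls => i j; apply/idP/idP; last exact/conn_sub/subsetUr.
  case/conn_add=> // -[c1 c2]; exfalso; case: ends c1 c2 => -[-> ->] c1 c2;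
  first [by move: (nap i); rewrite conn_sym c1 | by move: (nap j); rewrite c2].
have [a'W a'r] : a' \in chosen J /\ hconn F a' a.
  by move: a'C; rewrite inE => /andP[-> /=]; rewrite rt_eq.
have eqst : jcls (a |: J) = mulc (jcls J) (link (hc a') (hc a)).
  by rewrite stE stE0 (clU_add hc a'C aC) -!mulcA [mulc (link _ _) _]mulcC.
apply: join eqst; have [a12|n12] := boolP (is12 a).
  have a'01 : a' = e01.
    move: a'W; rewrite !inE => /orP[/andP[a'J /orP[ca'|a'12]]|]; last by case: eps; rewrite inE // => /eqP.
      have := cone_n01 ca'; have := @conn_edge _ _ hs ht F a.
      rewrite (hs_12 a12) (ht_12 a12) => ce.
      by rewrite (conn_trans a'r) // conn_sym; apply: ce; rewrite !inE a12 !orbT.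
    by move: aJ; rewrite -(is12_uniq a'12 a12) a'J.
  rewrite a'01 hc_01 hc_12 //=.
  have /eqP : G a = [set v1; v2] := eqP a12; rewrite gendsE set2_eq.
  by case/orP=> /andP[/eqP-> /eqP->]; [left|right]; rewrite !conn_refl.
have ca : cone a by move: ka; rewrite /kcone (negbTE n12) orbF.
have [ca' a'J] : cone a' /\ a' \in J.
  move: a'W; rewrite !inE => /orP[/andP[a'J /orP[ca'//|a'12]]|].
    case/negP: (cone_n01 ca); rewrite conn_sym; apply: conn_trans a'r.
    have := @conn_edge _ _ hs ht F a'; rewrite (hs_12 a'12) (ht_12 a'12); apply.
    by rewrite !inE a'12 !orbT.
  by case: eps; rewrite inE // => /eqP ea; move: a'r (cone_n01 ca); rewrite ea conn_sym => ->.
have co : gconn I (out a) (apex (hc a')).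
  rewrite hc_apex //; apply: (conn_trans (y := out a')).
    apply: conn_sub (subsetUl F0 J) _.
    by rewrite -(cone_conn F0real ca ca') conn_sym.
  have a'I : a' \in I by rewrite inE a'J orbT.
  have ce := conn_edge gsrc gtgt a'I; rewrite /out /tip.
  by case: ifP => _ //; rewrite conn_sym.
have ct : gconn I (tip a) (apex (hc a)) by rewrite hc_apex // conn_refl.
by move: co ct; rewrite {1}/out {1}/tip; case: ifP => _ co ct; [right|left].
Qed.

Lemma forest_jcls (J : {set E}) : (forall e, e \in J -> ~~ real e) ->
  gforest (F0 :|: J) = (jcls J != Bad).
Proof.
move=> nrJ; suff [] : gforest (F0 :|: J) = (jcls J != Bad) /\
  (gforest (F0 :|: J) -> rel_cls (apex_rel (F0 :|: J)) = jcls J) by [].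
have [n] := ubnP #|J|; elim: n J nrJ => // n IH J nrJ; rewrite ltnS => le.
have [J0|[a aJ]] := set_0Vmem J; last first.
  have eJ : J = a |: (J :\ a) by rewrite setD1K.
  have nrJ' e : e \in J :\ a -> ~~ real e by rewrite inE => /andP[_ /nrJ].
  rewrite eJ; apply: jcls_step => //; first by rewrite !inE eqxx.
    exact: nrJ.
  by apply: IH => //; move: le; rewrite (cardsD1 a J) aJ.
have st0 : jcls set0 = Free.
  rewrite /jcls /apex_cls big_pred0 => [|x]; last by rewrite inE.
  rewrite mul1c big1 // => r _; apply: clU_small.
  apply: (leq_trans (_ : _ <= #|[set e01]|)); last by rewrite cards1.
  apply/subset_leq_card/subsetP => x; rewrite !inE => /andP[+ _].
  by case: eps; rewrite ?inE.
rewrite J0 setU0 st0 fF0; split=> // _.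
have na k l : k != l -> apex_rel F0 k l = false.
  move=> kl; apply/negbTE/negP => c; case/eqP: kl; apply: apex_inj.
  apply: (conn_ind (P := fun y => apex k = y)) c _ => // e /F0real/andP[n1 n2].
  by split=> h; [move: n1|move: n2]; rewrite -h apex_in.
by rewrite /rel_cls !na.
Qed.

(** * The two sums over one forest *)

Lemma rt_inv (p : pred E) : (forall e, e \in F -> p (hs e) = p (ht e)) ->
  forall a b, hconn F a b -> p a = p b.
Proof.
move=> h a b c; apply: (conn_ind (P := fun b => p a = p b)) c _ => // e /h ->.
by split.
Qed.

Lemma FP e : e \in F -> [\/ real e /\ e \in F0, cone e /\ rep (out e) != e | is12 e].
Proof.
rewrite !inE => /or3P[eF|/andP[]|]; [constructor 1|constructor 2|constructor 3] => //.
by split=> //; apply: F0real.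
Qed.

(** The other vertices of the auxiliary graph only carry loops. *)
Definition core a := kcone a || (eps && (a == e01)).

Lemma cone_inv a b : hconn F a b -> cone a = cone b.
Proof.
apply: rt_inv => e /FP[[re _]|[ce _]|e12].
- by have /andP[/repP[c1 _] /repP[c2 _]] := re; rewrite hs_real // ht_real // c1 c2.
- by have [c1 _] := repP (out_notin ce); rewrite hs_cone // ht_cone // ce c1.
by rewrite hs_12 // ht_12 // e01_ncone is12Ncone.
Qed.

Lemma core_inv a b : hconn F a b -> core a = core b.
Proof.
apply: rt_inv => e /FP[[re _]|[ce _]|e12]; rewrite /core /kcone.
- by have /andP[/repP[c1 _] /repP[c2 _]] := re; rewrite hs_real // ht_real // c1 c2.
- by have [c1 _] := repP (out_notin ce); rewrite hs_cone // ht_cone // ce c1.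
have ep : eps by apply/existsP; exists e.
by rewrite hs_12 // ht_12 // e12 ep eqxx !orbT.
Qed.

Definition core_roots := [set r | core r && (hrt F r == r)].
Definition cone_roots := [set r | cone r && (hrt F r == r)].
Definition root12 := hrt F e01.

Lemma hrt_core a : (hrt F a \in core_roots) = core a.
Proof. by rewrite inE rt_id eqxx andbT -(core_inv (conn_rt _ _ F a)). Qed.

Lemma K_fib g : is12 g -> forall a, (hrt F a == root12) = (a == e01) || (a == g).
Proof.
move=> g12 a; have ep : eps by apply/existsP; exists g.
have cg : hconn F e01 g.
  have := @conn_edge _ _ hs ht F g; rewrite hs_12 // ht_12 //; apply.
  by rewrite !inE g12 !orbT.
rewrite rt_eq; apply/idP/orP => [c|[]/eqP->]; last by rewrite conn_sym.
  have := core_inv c; have := cone_inv c; rewrite e01_ncone => nc.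
  rewrite /core /kcone nc e01_ncone e01_n12 ep eqxx /= => /orP[a12|]; last by left.
  by right; rewrite (is12_uniq a12 g12).
exact: conn_refl.
Qed.

Lemma root12_ncone : eps -> root12 \notin cone_roots.
Proof.
by move=> _; rewrite inE negb_and -(cone_inv (conn_rt _ _ F e01)) e01_ncone.
Qed.

Lemma core_rootsE : core_roots = if eps then root12 |: cone_roots else cone_roots.
Proof.
apply/setP => r; rewrite inE; case ep: eps; rewrite !inE /core /kcone ep; last first.
  rewrite orbF; case r12: (is12 r); last by rewrite orbF.
  by move/existsP: ep => []; exists r.
have /existsP[g g12] := ep.
have -> : (r == root12) = ((r == e01) || is12 r) && (hrt F r == r).
  apply/eqP/andP => [->|[]].
    rewrite {2}/root12 rt_id -/root12 eqxx; split=> //.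
    have := K_fib g12 root12; rewrite {1}/root12 rt_id eqxx => /esym/orP[->//|/eqP->].
    by rewrite g12 orbT.
  move=> h /eqP <-; apply/eqP; rewrite (K_fib g12); case/orP: h => [->//|r12].
  by rewrite (is12_uniq r12 g12) eqxx orbT.
rewrite -andb_orl; congr andb; by case: (cone r); case: (is12 r); case: (r == e01).
Qed.

(** The components other than that of the edge joining the cone vertices 1 and 2. *)
Definition off12 r := ~~ (eps && (r == root12)).

Lemma sum_off12 : \sum_(r in core_roots) off12 r = #|cone_roots|.
Proof.
rewrite core_rootsE /off12 -sum1_card; case ep: eps; last by [].
rewrite big_setU1 ?root12_ncone //= eqxx add0n; apply: eq_bigr => r rA.
by have := root12_ncone ep; case: eqP => // <-; rewrite rA.
Qed.

(** The components of [F0] are the three cone vertices and those with a cone edge. *)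
Lemma card_components : #|V| = #|F0| + #|cone_roots| + 3.
Proof.
rewrite (roots_card fF0) -addnA; congr addn.
set R := [set r | _]; rewrite -(cardsID [set x in apexes] R) addnC; congr addn; last first.
  have -> : R :&: [set x in apexes] = [set x in apexes].
    apply/setIidPr/subsetP => x; rewrite inE => ax; rewrite inE; apply/eqP.
    have [k ->] : exists k, x = apex k by exists (colof x); rewrite colofK.
    apply: (conn_ind (P := fun y => y = apex k)) (conn_rt gsrc gtgt F0 (apex k)) _ => //.
    by move=> e /F0real/andP[n1 n2]; split=> h; [move: n1|move: n2]; rewrite h apex_in.
  by rewrite cardsE; apply/card_uniqP.
have inj : {in cone_roots &, injective (fun r => rt gsrc gtgt F0 (out r))}.
  move=> r r'; rewrite !inE => /andP[cr /eqP er] /andP[cr' /eqP er'] /eqP.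
  by rewrite rt_eq -cone_conn // -/F -rt_eq er er' => /eqP.
rewrite -(card_in_imset inj); apply: eq_card => x.
have -> : (x \in R :\: [set x in apexes]) = (x \notin apexes) && (rt gsrc gtgt F0 x == x).
  by rewrite in_setD !in_set.
apply/idP/imsetP => [/andP[nx /eqP rx]|[r]].
  have [cr ro] := repP nx; exists (hrt F (rep x)).
    by rewrite inE rt_id eqxx andbT -(cone_inv (conn_rt _ _ F _)).
  rewrite -{1}rx -{1}ro; apply/eqP; rewrite rt_eq -cone_conn //; first exact: conn_rt.
  by rewrite -(cone_inv (conn_rt _ _ F _)).
rewrite inE => /andP[cr _] ->; rewrite rt_id eqxx andbT.
apply/negP => ax; have := F0_apex (colof (rt gsrc gtgt F0 (out r))) (out_notin cr).
by rewrite colofK // conn_rt.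
Qed.

Section Weights.
Variable q : nat.

(** Local classes and weights: [gJ] and [wJ] for sets of cone edges, [gM] and [wM']
for marks. In the component of the exceptional edge, [e01] is present but not
counted as chosen, and the exceptional edge carries at least one mark. *)
Definition gJ r m := if off12 r then clU hc (setof m) else clU hc (e01 |: setof m).
Definition wJ r m := if off12 r then wU hc q (setof m) else (e01 \notin setof m).
Definition gM (r : E) m := cl hs ht hc F (toN m).
Definition wM' r m := if off12 r then wM hs ht hc F q (toN m) else
  if insupp F (toN m) then [forall e, is12 e ==> (0 < toN m e)] : nat else 0.
Definition SJ := gsum false (hrt F) gJ wJ core_roots.
Definition SM := gsum ord0 (fun e => hrt F (hs e)) gM wM' core_roots.

Lemma fF : hforest F. Proof. by rewrite hforestE. Qed.

Lemma sums_matched : matched SJ SM.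
Proof.
apply: gsum_matched => r; rewrite inE => /andP[_ /eqP root].
have [nr|] := boolP (off12 r).
  have := local_matched hc q fF root; rewrite /matched /lsumJ /lsumM /lsum /gJ /wJ /gM /wM' nr.
  by [].
rewrite negbK => /andP[ep /eqP er]; have /existsP[g g12] := ep.
have nr : off12 r = false by rewrite /off12 ep er eqxx.
have gF : g \in F by rewrite !inE g12 !orbT.
have efib e : e \in F -> hrt F (hs e) = root12 -> e = g.
  move=> eF eK; have ncone : cone (hs e) = false.
    by rewrite (cone_inv (conn_rt _ _ F _)) eK -(cone_inv (conn_rt _ _ F _)) e01_ncone.
  case: (FP eF) ncone => [[re _]|[ce _]|e12 _]; last exact: is12_uniq.
    by have /andP[/repP[c1 _] _] := re; rewrite hs_real // c1.
  by rewrite hs_cone // ce.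
have e12 (m : {ffun E -> 'I_4}) : [forall e, is12 e ==> (0 < toN m e)] = (0 < toN m g).
  apply/forallP/idP => [/(_ g)|h e]; first by rewrite g12.
  by apply/implyP => e12; rewrite (is12_uniq e12 g12).
have wE (z : cls) : lsum ord0 (fun e => hrt F (hs e)) gM wM' r z = lsumMK hs ht hc F root12 g z.
  by rewrite -er; apply: eq_bigr => m _; rewrite /wM' nr e12.
have jE (z : cls) : lsum false (hrt F) gJ wJ r z = lsumJK hs ht hc F root12 e01 z.
  by rewrite -er /lsumJK /lsum /gJ /wJ nr.
have := apex_matched fF (K_fib g12) efib gF (hs_12 g12) (ht_12 g12) hc_01 (hc_12 g12).
by rewrite /matched !wE !jE.
Qed.
Implicit Types U : {set E}.

Definition kset := [set a | kcone a].
Local Notation cutJ U r := (cut false (hrt F) (ffof U) r).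
Definition clJ U := \big[mulc/Free]_(r in core_roots) gJ r (cutJ U r).
Definition weJ U := \prod_(r in core_roots) wJ r (cutJ U r).

Lemma cutJE U r : setof (cutJ U r) = comp r U.
Proof. by apply/setP => a; rewrite !inE !ffunE; case: eqP; rewrite ?andbF ?andbT. Qed.

Lemma kset_core U a : U \subset kset -> a \in U -> hrt F a \in core_roots.
Proof. by move/subsetP=> s /s; rewrite hrt_core /core inE => ->. Qed.

Lemma e01_kset : e01 \notin kset.
Proof. by rewrite inE /kcone e01_ncone e01_n12. Qed.

Lemma kset_nboth U : U \subset kset -> apex_cls U = Free.
Proof.
move/subsetP=> s; rewrite /apex_cls big_pred0 // => a; apply/negbTE/negP => /andP[/s].
by rewrite inE => /orP[/coneNboth->|->]; rewrite ?andbF.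
Qed.

Lemma jcls_cone U : U \subset kset -> jcls U = clJ U.
Proof.
move=> sU; rewrite /jcls kset_nboth // mul1c /clJ [RHS]big_mkcond; apply: eq_bigr => r _.
have eW : chosen U = U :|: (if eps then [set e01] else set0).
  rewrite /chosen; congr setU; apply/setP => a; rewrite inE; case aU: (a \in U) => //.
  by have := subsetP sU a aU; rewrite inE.
case: ifPn => rA; last first.
  rewrite clU_small // (_ : comp r (chosen U) = set0) ?cards0 //; apply/setP => a.
  rewrite in_set0 inE eW; apply/negbTE/negP => /andP[aW /eqP ar].
  case/negP: rA; rewrite -ar; move: aW; rewrite inE => /orP[/(kset_core sU) //|].
  by case ep: eps; rewrite inE // => /eqP ->; rewrite hrt_core /core ep eqxx orbT.
rewrite /gJ cutJE /off12; case ep: eps => /=; last by rewrite eW ep setU0.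
rewrite eW ep; case: (eqVneq r root12) => /= [->|ne]; congr (clU hc _); apply/setP => a; rewrite !inE.
  by case: (eqVneq a e01) => [->|_]; rewrite ?eqxx ?orbT ?orbF.
case: (eqVneq a e01) => [->|_]; rewrite ?eqxx ?orbT ?orbF //= eq_sym (negbTE ne).
by case: (e01 \in U).
Qed.

Lemma card_comp U : U \subset kset -> \sum_(r in core_roots) #|comp r U| = #|U|.
Proof.
move=> sU; rewrite -[RHS]sum1_card [RHS](partition_big (hrt F) (mem core_roots)) /=; last first.
  by move=> a; apply: kset_core.
by apply: eq_bigr => r _; rewrite -sum1_card; apply: eq_bigl => a; rewrite inE.
Qed.

(** In each component the cone edges chosen, with [e01] in the exceptional one, are
one more than the rank unless there are none, which the weights account for. *)
Lemma weightJ U : U \subset kset -> clJ U != Bad ->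
  exists2 z, weJ U = q ^ z & #|cone_roots| + rk (clJ U) = #|U| + z.
Proof.
move=> sU nb; pose z r := if off12 r && (clU hc (comp r U) == Free) then 1 - #|comp r U| else 0.
exists (\sum_(r in core_roots) z r).
  rewrite expn_sum; apply: eq_bigr => r rA; rewrite /wJ cutJE /z /wU.
  case: (off12 r) => /=; first by case: ifP.
  by rewrite inE (negbTE (contra (subsetP sU e01) e01_kset)).
rewrite rk_big // -sum_off12 -(card_comp sU) -!big_split /=; apply: eq_bigr => r rA.
have := big_nBad nb rA; rewrite /gJ cutJE /z; set C := comp r U.
case: (off12 r) => /= nbr; have := clU_card nbr; last first.
  have -> : (e01 |: C == set0) = false by apply/negP => /eqP/setP/(_ e01); rewrite setU11 inE.
  have nC : e01 \notin C by rewrite inE (negbTE (contra (subsetP sU e01) e01_kset)).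
  by rewrite cardsU1 nC; lia.
case: (clU hc C =P Free) => [eF|nF].
  by have := clU_Free eF; rewrite -cards_eq0 eF; case: #|C| => [|[]].
have -> : (C == set0) = false.
  by apply: contra_notF nF => /eqP->; rewrite clU_small // cards0.
by rewrite !addn0 add1n => ->.
Qed.

(** The contribution of the two edges from the cone vertex 0, each of which may be
added when this closes no cycle. For a class [L12] both may, one at a time; for
[L01] and [L02] only the other one. *)
Definition thJ (t : cls) := match t with Free => q.+1 ^ 2 | L01 | L02 => q.+1 | L12 => q.+2
  | Star | Full => 1 | Bad => 0 end.

Lemma link_ends e k l : G e == [set apex k; apex l] ->
  link (colof (gsrc e)) (colof (gtgt e)) = link k l.
Proof.
by rewrite gendsE set2_eq => /orP[]/andP[/eqP-> /eqP->]; rewrite !apexK // linkC.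
Qed.

(** An edge between cone vertices that is not a loop is one of the three possible
ones, by the absence of parallel edges; a loop has class [Bad]. *)
Lemma jcls_sub J : (forall e, e \in J -> ~~ real e) -> jcls J != Bad -> J \subset e01 |: (e02 |: kset).
Proof.
move=> nrJ nb; apply/subsetP => a aJ; rewrite !inE /kcone.
have [//|nca] := boolP (cone a); rewrite ?orbT //.
have [//|n12] := boolP (is12 a); rewrite ?orbT // !orbF.
have ba : both a by have := kind a; rewrite (negbTE nca) (negbTE (nrJ _ aJ)).
move: nb; rewrite -(setD1K aJ) jcls_add ?inE ?eqxx ?ba // => /mulc_Bad[_].
have /andP[b1 b2] := ba.
have Ga : G a == [set apex (colof (gsrc a)); apex (colof (gtgt a))].
  by rewrite !colofK // gendsE set2_eq !eqxx.
have Ga' : G a == [set apex (colof (gtgt a)); apex (colof (gsrc a))] by rewrite setUC.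
case: (colof (gsrc a)) (colof (gtgt a)) Ga Ga' => -[] //= Ga Ga' _;
  do ?[by rewrite (@apex_uniq_edge a e01 Col0 Col1) ?eqxx
     | by rewrite (@apex_uniq_edge a e02 Col0 Col2) ?eqxx ?orbT
     | by rewrite /is12 ?Ga ?Ga' in n12].
Qed.

Definition fJ J := (jcls J != Bad) * q ^ (#|cone_roots|.+2 - #|J|).

Lemma e01_e02 : e01 != e02.
Proof.
apply/eqP => e; have := G02; rewrite -e (eqP G01) set2_eq.
move: uniqv; rewrite /= !inE negb_or => /andP[/andP[_ /negbTE->]].
by rewrite andbT => /negbTE ->; rewrite andbF.
Qed.

Lemma expo_arith (n rho u z k : nat) : k + rho <= 2 -> n + rho = u + z -> n.+2 - (k + u) = 2 - rho - k + z.
Proof. by lia. Qed.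

Lemma sum_over_apex_edges U : U \subset kset ->
  fJ U + fJ (e02 |: U) + (fJ (e01 |: U) + fJ (e01 |: (e02 |: U))) = thJ (clJ U) * weJ U.
Proof.
move=> sU; have n1 : e01 \notin U := contra (subsetP sU e01) e01_kset.
have n2 : e02 \notin U.
  apply: contra (subsetP sU e02) _; rewrite inE /kcone e02_n12 orbF.
  by apply/negP => /coneNboth; rewrite e02_both.
have n3 : e01 \notin e02 |: U by rewrite !inE negb_or e01_e02.
have b1 : both e01 && ~~ is12 e01 by rewrite e01_both e01_n12.
have b2 : both e02 && ~~ is12 e02 by rewrite e02_both e02_n12.
have l1 := @link_ends e01 Col0 Col1 G01; have l2 := @link_ends e02 Col0 Col2 G02.
rewrite /fJ !jcls_add // l1 l2 (jcls_cone sU) !cardsU1 n1 n2 n3.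
have := @weightJ U sU; case: (clJ U) => //=.
all: move=> /(_ isT)[z -> eqz]; rewrite ?mul0n ?mul1n ?addn0 ?add0n.
all: have := @expo_arith _ _ _ _ 0 _ eqz; rewrite add0n /= => -> //.
all: have ar := @expo_arith _ _ _ _ 1 _ eqz; rewrite ?{}ar //= ?(@expo_arith _ _ _ _ 2 _ eqz) //.
all: by rewrite ?expnD -?mulnDl ?expnS ?expn0; nia.
Qed.

Lemma sum_subU1 (T : finType) (a : T) (S : {set T}) (f : {set T} -> nat) : a \notin S ->
  \sum_(X : {set T} | X \subset a |: S) f X = \sum_(X : {set T} | X \subset S) (f X + f (a |: X)).
Proof.
move=> aS; rewrite (bigID (fun X : {set T} => a \in X)) /= addnC big_split /=; congr addn.
  apply: eq_bigl => X; have [aX|aX] := boolP (a \in X).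
    by rewrite andbF; apply/esym/negbTE; apply: contra aS => /subsetP->.
  by rewrite andbT -subDset (setDidPl _) // disjoint_sym disjoints1.
rewrite (reindex_onto (fun X => a |: X) (fun X => X :\ a)) /=; last first.
  by move=> X /andP[_ aX]; rewrite setD1K.
apply: eq_bigl => X; rewrite setU11 andbT.
have [aX|aX] := boolP (a \in X).
  have -> : (X \subset S) = false by apply: contraNF aS => /subsetP->.
  by apply/negbTE/negP => /andP[_ /eqP/setP/(_ a)]; rewrite aX !inE eqxx.
rewrite setU1K // eqxx andbT subUset sub1set setU11 -subDset (setDidPl _) //.
by rewrite disjoint_sym disjoints1.
Qed.

Lemma clJ_sum : \sum_(t : cls) thJ t * SJ t = \sum_(U : {set E} | U \subset kset) thJ (clJ U) * weJ U.
Proof.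
transitivity (\sum_(m | sup false (hrt F) core_roots m)
    thJ (\big[mulc/Free]_(r in core_roots) gJ r (cut false (hrt F) m r)) *
    \prod_(r in core_roots) wJ r (cut false (hrt F) m r)).
  rewrite [RHS](partition_big (fun m => \big[mulc/Free]_(r in core_roots) gJ r (cut false (hrt F) m r)) xpredT) //=.
  apply: eq_bigr => x _; rewrite /SJ /gsum big_distrr /=.
  by apply: eq_bigr => m /andP[_ /eqP->].
rewrite (reindex (@ffof E)) /=; last by exists (@setof E) => m _; rewrite (setofK, ffofK).
rewrite (bigID (fun U => U \subset kset)) /= [X in _ + X]big1 ?addn0.
  apply: eq_bigl => U; apply/andP/idP => [[]//|sU]; split=> //; apply/supP => a nA.
  by rewrite ffunE; apply/negbTE; apply: contra nA => /(kset_core sU).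
move=> U /andP[/supP su nU]; have e01U : (e01 \in U) && eps.
  case/subsetPn: nU => a aU; have : core a.
    by rewrite -hrt_core; apply: contraTT aU => /su; rewrite ffunE => ->.
  by rewrite /core inE => /orP[->//|/andP[-> /eqP <-]]; rewrite aU.
have [e1 ep] := andP e01U.
have rA : root12 \in core_roots by rewrite hrt_core /core ep eqxx orbT.
rewrite [X in _ * X](bigD1 root12) //= {1}/wJ /off12 ep eqxx /= cutJE inE e1 eqxx /=.
by rewrite mul0n muln0.
Qed.

Lemma forests_over : \sum_(J : {set E} | [forall e in J, ~~ real e] && gforest (F0 :|: J))
    q ^ (#|V|.-1 - #|F0 :|: J|) = \sum_(t : cls) thJ t * SJ t.
Proof.
rewrite clJ_sum.
have n2 : e02 \notin kset.
  rewrite inE /kcone e02_n12 orbF.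
  by apply/negP => /coneNboth; rewrite e02_both.
have n1 : e01 \notin e02 |: kset by rewrite in_setU1 negb_or e01_e02 e01_kset.
transitivity (\sum_(J : {set E} | J \subset e01 |: (e02 |: kset)) fJ J); last first.
  rewrite (sum_subU1 fJ n1) (sum_subU1 (fun J => fJ J + fJ (e01 |: J)) n2).
  apply: eq_bigr => U sU; rewrite -sum_over_apex_edges //; lia.
rewrite [RHS](bigID (fun J : {set E} => jcls J != Bad)) /= [X in _ = _ + X]big1 ?addn0; last first.
  by move=> J /andP[_ /negbTE nb]; rewrite /fJ nb mul0n.
have nr J : J \subset e01 |: (e02 |: kset) -> forall e, e \in J -> ~~ real e.
  move=> /subsetP s e /s; rewrite !inE.
  have br e' : both e' -> ~~ real e' by apply: contraL => /realNboth ->.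
  case/or3P=> [/eqP->|/eqP->|]; [exact: br e01_both | exact: br e02_both |].
  by rewrite /kcone => /orP[|/is12Nreal->//]; apply: contraL => /realNcone ->.
apply: eq_big => [J|J /andP[/forall_inP nrJ fJJ]].
  apply/andP/andP => [[/forall_inP nrJ]|[sJ nb]].
    by rewrite forest_jcls // => nb; rewrite jcls_sub.
  by have nrJ := nr _ sJ; split; [apply/forall_inP|rewrite forest_jcls].
rewrite /fJ -forest_jcls // fJJ mul1n card_components; congr (q ^ _).
have -> : #|F0 :|: J| = #|F0| + #|J|.
  rewrite cardsU (_ : F0 :&: J = set0) ?cards0 ?subn0 //; apply/setP => e; rewrite in_set0 inE.
  by apply/negbTE/negP => /andP[/F0real re /nrJ]; rewrite re.
by rewrite addnS /= -addnA subnDl addn2.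
Qed.

Implicit Types m : {ffun E -> 'I_4}.
Local Notation cutM m r := (cut ord0 (fun e => hrt F (hs e)) m r).
Local Notation inXF M := (inX hs ht hc F M).
Definition clM m := \big[mulc/Free]_(r in core_roots) gM r (cutM m r).
Definition weM m := \prod_(r in core_roots) wM' r (cutM m r).
(** The marks giving a monomial of the order ideal whose forest is [F]. *)
Definition marked m := inXF (toN m) && [forall e, is12 e ==> (0 < toN m e)].

Lemma cutME m r : toN (cutM m r) = restr hs ht F (toN m) r.
Proof. by apply/ffunP => e; rewrite !ffunE; case: eqP. Qed.

Lemma hs_core e : e \in F -> hrt F (hs e) \in core_roots.
Proof.
move=> /FP[[re _]|[ce _]|e12]; rewrite hrt_core /core /kcone.
- by have /andP[/repP[c1 _] _] := re; rewrite hs_real // c1.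
- by rewrite hs_cone // ce.
have ep : eps by apply/existsP; exists e.
by rewrite hs_12 // ep eqxx orbT.
Qed.

Lemma marked_sup m : marked m -> sup ord0 (fun e => hrt F (hs e)) core_roots m.
Proof.
case/andP=> /and3P[_ /forallP ins _] _; apply/supP => e nA; apply/val_inj/eqP.
rewrite /= -leqn0 leqNgt; apply: contra nA => pos; apply: hs_core.
by have := ins e; rewrite ffunE pos.
Qed.

Lemma clM_total m : sup ord0 (fun e => hrt F (hs e)) core_roots m -> clM m = total_cl hs ht hc F (toN m).
Proof.
move=> /supP sm; rewrite /clM /total_cl big_mkcond; apply: eq_bigr => r _; rewrite /gM cutME.
case: ifPn => // nA; rewrite cl_small // /deg big1 // => e _; rewrite !ffunE.
by case: eqP => // eqr; rewrite sm // eqr.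
Qed.

Lemma deg_cuts m : sup ord0 (fun e => hrt F (hs e)) core_roots m ->
  deg (toN m) = \sum_(r in core_roots) deg (restr hs ht F (toN m) r).
Proof.
move=> /supP sm; rewrite (deg_restr hs ht F) [RHS]big_mkcond; apply: eq_bigr => r _.
case: ifPn => // nA; rewrite /deg big1 // => e _; rewrite !ffunE.
by case: eqP => // eqr; rewrite sm // eqr.
Qed.

Lemma K12_eps : #|K12| = eps.
Proof.
case: (boolP eps) => [/existsP[g g12]|/existsPn none]; last first.
  by apply/eqP; rewrite cards_eq0; apply/eqP/setP => e; rewrite !inE (negbTE (none e)).
apply/eqP/cards1P; exists g; apply/setP => e; rewrite !inE.
by apply/idP/eqP => [e12|-> //]; apply: is12_uniq.
Qed.

Lemma card_core_roots : \sum_(r in core_roots) 1 = #|cone_roots| + eps.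
Proof.
rewrite core_rootsE; case ep: eps; last by rewrite addn0 sum1_card.
by rewrite big_setU1 ?root12_ncone //= sum1_card addnC.
Qed.

(** Each component has one mark more than its rank, or no mark at all. *)
Lemma weightM m : marked m -> exists2 z, weM m = q.+1 ^ z &
  #|cone_roots| + eps + rk (clM m) = deg (toN m) + z.
Proof.
move=> mm; have sm := marked_sup mm; have /andP[/and3P[_ /forallP ins nb] /forallP m12] := mm.
rewrite -(clM_total sm) in nb.
pose z r := (deg (restr hs ht F (toN m) r) == 0).
have dpos r : r \in core_roots -> ~~ off12 r -> (0 < deg (restr hs ht F (toN m) r)).
  rewrite negbK => _ /andP[/existsP[g g12] /eqP er].
  rewrite /deg (bigD1 g) //= ltn_addr // ffunE hs_12 // er eqxx.
  by have := m12 g; rewrite g12.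
have degE r : r \in core_roots -> 1 + rk (gM r (cutM m r)) = deg (restr hs ht F (toN m) r) + z r.
  move=> rA; have := big_nBad nb rA; rewrite /gM cutME /z.
  case: (posnP (deg _)) => [d0 _|dp nbr]; first by rewrite cl_small d0.
  by rewrite (deg_rk fF nbr dp) addn0.
exists (\sum_(r in core_roots) z r).
  rewrite expn_sum; apply: eq_bigr => r rA; rewrite /wM' cutME /wM.
  have -> : insupp F (restr hs ht F (toN m) r).
    by apply/forallP => e; rewrite [restr _ _ _ _ _ _]ffunE; case: ifP.
  have := degE r rA; rewrite /gM cutME /z; case nr: (off12 r).
    case: (posnP (deg _)) => [d0 _|dp]; first by rewrite cl_small d0 //= expn1.
    rewrite addn0 /= expn0; case: eqP => // -> /= <-; by rewrite subnn.
  have dp := dpos r rA (negbT nr); rewrite eqn0Ngt dp /= expn0 => _.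
  case: forallP => // -[] e; apply/implyP => e12; rewrite ffunE hs_12 //.
  have := nr; rewrite /off12 => /negbFE/andP[_ /eqP->]; rewrite eqxx.
  by have := m12 e; rewrite e12.
rewrite rk_big // -card_core_roots (deg_cuts sm) -!big_split /=; exact: eq_bigr.
Qed.

Lemma weM_marked m : sup ord0 (fun e => hrt F (hs e)) core_roots m -> clM m != Bad -> weM m != 0 -> marked m.
Proof.
move=> sm nb nz; have /supP sm' := sm.
have f r : r \in core_roots -> wM' r (cutM m r) != 0.
  by move=> rA; apply: contraNneq nz => w0; rewrite /weM (bigD1 r) //= w0.
have ins r : r \in core_roots -> insupp F (restr hs ht F (toN m) r).
  by move=> /f; rewrite /wM' cutME /wM; case: (off12 r); case: ifP.
apply/andP; split.
  apply/and3P; split; [exact: fF | | by rewrite -clM_total].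
  apply/forallP => e; apply/implyP => pos; have rA : hrt F (hs e) \in core_roots.
    by apply: contraTT pos => nA; rewrite ffunE sm'.
  by have /forallP/(_ e) := ins _ rA; rewrite [restr _ _ _ _ _ _]ffunE eqxx pos.
apply/forallP => e; apply/implyP => e12; have ep : eps by apply/existsP; exists e.
have rA : root12 \in core_roots by rewrite hrt_core /core ep eqxx orbT.
have := f root12 rA; rewrite /wM' /off12 ep eqxx cutME ins //=.
by case: forallP => // /(_ e); rewrite e12 ffunE hs_12 // eqxx.
Qed.

Definition thM (t : cls) := if t == Bad then 0 else q.+1 ^ (2 - rk t).

Lemma clM_sum : \sum_(t : cls) thM t * SM t = \sum_(m | marked m) thM (clM m) * weM m.
Proof.
transitivity (\sum_(m | sup ord0 (fun e => hrt F (hs e)) core_roots m) thM (clM m) * weM m).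
  rewrite [RHS](partition_big clM xpredT) //=.
  apply: eq_bigr => t _; rewrite /SM /gsum big_distrr /=.
  by apply: eq_big => [//|m /andP[_ /eqP eqt]]; rewrite -[clM m]/(\big[_/_]_(r in core_roots) _) eqt.
rewrite (bigID marked) /= [X in _ + X]big1 ?addn0.
  by apply: eq_bigl => m; apply: andb_idl; apply: marked_sup.
move=> m /andP[sm nm]; rewrite /thM; case: eqP => [//|/eqP nb].
by case: (eqVneq (weM m) 0) => [->|nz]; [rewrite muln0 | rewrite weM_marked in nm].
Qed.

Lemma marks_over : \sum_(m | marked m) q.+1 ^ (#|V|.-1 + #|K12| - #|F0| - deg (toN m)) =
  \sum_(t : cls) thM t * SM t.
Proof.
rewrite clM_sum; apply: eq_bigr => m mm; have [z -> eqz] := weightM mm.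
have nb : clM m != Bad by rewrite clM_total ?marked_sup //; case/andP: mm => /and3P[].
rewrite /thM (negbTE nb) -expnD K12_eps card_components; congr (_ ^ _).
have r2 : rk (clM m) <= 2 by case: (clM m) nb.
have ar (f a e r d w : nat) : r <= 2 -> a + e + r = d + w ->
  (f + a + 3).-1 + e - f - d = 2 - r + w by lia.
exact: ar.
Qed.

(** Both sides are sums over the classes, with equal counts except for [Star]. The
factors agree except for [L12], with [q + 2] against [q + 1]; the difference is
made up for by the states of class [Star], which have factor one. *)
Lemma sums_agree : \sum_(J : {set E} | [forall e in J, ~~ real e] && gforest (F0 :|: J))
    q ^ (#|V|.-1 - #|F0 :|: J|) =
  \sum_(m | marked m) q.+1 ^ (#|V|.-1 + #|K12| - #|F0| - deg (toN m)).
Proof.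
rewrite forests_over marks_over !sum_cls /thJ /thM /=.
have [[-> -> -> -> ->] [-> ->]] := sums_matched; rewrite !expnS expn0; lia.
Qed.

End Weights.
End Fixed.

(** * The order ideal of a triconed graph *)

Implicit Types m : {ffun E -> 'I_4}.
Local Notation inXh := (inX hs ht hc).

(** The order ideal is the link, in the complex of marked forests, of the monomial
which is the product of the edges of [Z] and of the squares of those of [K12]. *)
Definition state (p : {set E} * {ffun E -> 'I_4}) :=
  [&& inXh p.1 (toN p.2), ZK \subset p.1 & [forall e, is12 e ==> (0 < toN p.2 e)]].

(** The exponents of the monomial of which the link is taken. *)
Definition base e := (e \in Z) + (e \in K12).*2.
Definition expo (p : {set E} * {ffun E -> 'I_4}) e := (e \in p.1) + toN p.2 e - base e.

Lemma state_base p e : state p -> expo p e + base e = (e \in p.1) + toN p.2 e.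
Proof.
case/and3P=> /and3P[_ /forallP/(_ e) ins _] /subsetP sZ /forallP/(_ e) h12; apply: subnK.
have := sZ e; rewrite /base !inE; have [e12|n12] := boolP (is12 e).
  by rewrite (is12Ncone e12) /= => /(_ isT) ->; rewrite e12 in h12.
by rewrite orbF addn0; case: (_ && _) => //= /(_ isT)->.
Qed.

Lemma sum_expo p : state p -> \sum_e expo p e + (#|Z| + #|K12|.*2) = #|p.1| + deg (toN p.2).
Proof.
move=> sp; rewrite /deg -!sum1_card -muln2 big_distrl /= ![\sum_(i in _) _]big_mkcond -!big_split /=.
apply: eq_bigr => e _; have := state_base e sp; rewrite /base -muln2.
by case: (e \in Z); case: (e \in K12); case: (e \in p.1).
Qed.

Definition reals F := [set e in F | real e].

Lemma realsK F0 : (forall e, e \in F0 -> real e) -> reals (F0 :|: ZK) = F0.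
Proof.
move=> h; apply/setP => e; rewrite inE in_setU; apply/andP/idP => [[]|eF]; last by rewrite eF h.
case/orP=> //; rewrite !inE => /orP[/andP[ce _]|e12] re; first by rewrite realNcone in ce.
by rewrite is12Nreal in re.
Qed.

Lemma card_ZK F0 : (forall e, e \in F0 -> real e) -> #|F0 :|: ZK| = #|F0| + (#|Z| + #|K12|).
Proof.
move=> h; rewrite cardsU (_ : F0 :&: ZK = set0) ?cards0 ?subn0.
  congr addn; rewrite cardsU (_ : Z :&: K12 = set0) ?cards0 ?subn0 //.
  by apply/setP => e; rewrite !inE; case e12: (is12 e); rewrite ?andbF // is12Ncone.
apply/setP => e; rewrite in_set0 in_setI; apply/negbTE/negP => /andP[/h re].
rewrite !inE => /orP[/andP[ce _]|e12]; first by rewrite realNcone in ce.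
by rewrite is12Nreal in re.
Qed.

Lemma state_marked F0 m : (forall e, e \in F0 -> real e) ->
  state (F0 :|: ZK, m) = marked F0 m.
Proof. by move=> h; rewrite /state /marked /= subsetUr. Qed.

Lemma state_split p : state p ->
  [/\ p.1 = reals p.1 :|: ZK, forall e, e \in reals p.1 -> real e,
    gforest (reals p.1) & marked (reals p.1) p.2].
Proof.
case: p => F m sp; have /and3P[/and3P[fF _ _] sZ _] := sp; rewrite /=.
have eF : F = reals F :|: ZK by apply: hforest_split.
have rF e : e \in reals F -> real e by rewrite inE => /andP[].
split=> //; first by rewrite -(hforestE rF) -eF.
by rewrite -state_marked // -eF.
Qed.

Lemma deg_marked F0 m : (forall e, e \in F0 -> real e) -> gforest F0 -> marked F0 m ->
  #|K12| <= deg (toN m) /\ #|F0| + deg (toN m) <= #|V|.-1 + #|K12|.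
Proof.
move=> h f mm; split.
  have /andP[_ /forallP m12] := mm.
  rewrite -sum1_card big_mkcond; apply: leq_sum => e _; rewrite inE.
  by have := m12 e; case: (is12 e).
have [z _ eqz] := weightM h f 0 mm; rewrite (card_components h f) K12_eps.
have : rk (clM F0 m) <= 2.
  have := clM_total (marked_sup h mm).
  by case/andP: mm => /and3P[_ _ +] _ eqc; rewrite -eqc; case: (clM F0 m).
by move: eqz; lia.
Qed.

Lemma state_deg p : state p -> \sum_e expo p e <= #|V|.-1 /\
  #|V|.-1 - \sum_e expo p e = #|V|.-1 + #|K12| - #|reals p.1| - deg (toN p.2).
Proof.
move=> sp; have [eF rF fF0 mm] := state_split sp; have := sum_expo sp.
have := card_ZK rF; rewrite -eF => ->; have := deg_marked rF fF0 mm; set s := \sum_e _; set d := deg _.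
move: (#|Z|) (#|K12|) (#|reals p.1|) (#|V|.-1) s d => z k f n s d; lia.
Qed.

(** The forests are grouped by their real parts, and the states by the real parts of
their forests. *)
Lemma forest_states q : \sum_(I : {set E} | gforest I) q ^ (#|V|.-1 - #|I|) =
  \sum_(p | state p) q.+1 ^ (#|V|.-1 - \sum_e expo p e).
Proof.
pose good F0 := (F0 \subset [set e | real e]) && gforest F0.
have goodP F0 : good F0 -> (forall e, e \in F0 -> real e) /\ gforest F0.
  by case/andP=> /subsetP s f; split=> // e /s; rewrite inE.
have rr I : reals I \subset [set e | real e].
  by apply/subsetP => e; rewrite !inE => /andP[].
rewrite (partition_big reals good) /=; last first.
  move=> I fI; rewrite /good rr; apply: forest_sub fI.
  by apply/subsetP => e; rewrite inE => /andP[].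
rewrite [RHS](partition_big (fun p => reals p.1) good) /=; last first.
  by move=> p /state_split[_ _ f _]; rewrite /good rr.
apply: eq_bigr => F0 /goodP[rF fF0].
transitivity (\sum_(J : {set E} | [forall e in J, ~~ real e] && gforest (F0 :|: J))
    q ^ (#|V|.-1 - #|F0 :|: J|)).
  rewrite (reindex_onto (fun J => F0 :|: J) (fun I => [set e in I | ~~ real e])) /=; last first.
    move=> I /andP[_ /eqP <-]; apply/setP => e; rewrite !inE.
    by case: (real e); rewrite ?andbT ?andbF ?orbF.
  apply: eq_bigl => J; rewrite [RHS]andbC -andbA; congr andb.
  apply/andP/forall_inP => [[/eqP e1 /eqP e2] e|nr].
    by rewrite -e2 inE => /andP[].
  split; apply/eqP/setP => e; rewrite !inE.
    case eF: (e \in F0); first by rewrite rF.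
    by case eJ: (e \in J) => //=; apply/negbTE/nr.
  case eJ: (e \in J); first by rewrite orbT nr.
  by rewrite orbF; case eF: (e \in F0) => //=; rewrite rF.
rewrite (sums_agree rF fF0); apply/esym.
rewrite (reindex_onto (fun m => (F0 :|: ZK, m)) snd) /=; last first.
  by move=> [F m] /= /andP[/state_split/= [eF _ _ _] /eqP <-]; rewrite -eF.
apply: eq_big => [m|m /andP[/andP[sp _] _]].
  by rewrite eqxx andbT realsK // eqxx andbT state_marked.
by have [_ ->] := state_deg sp; rewrite /= realsK.
Qed.

Lemma state_in p e : state p -> (e \in p.1) = (0 < expo p e + base e) /\
  toN p.2 e = (expo p e + base e).-1.
Proof.
move=> sp; rewrite (state_base e sp).
have /and3P[/and3P[_ /forallP/(_ e) ins _] _ _] := sp.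
by case: (e \in p.1) ins => //=; rewrite implybF -eqn0Ngt => /eqP->.
Qed.

Lemma expo_inj p p' : state p -> state p' -> (forall e, expo p e = expo p' e) -> p = p'.
Proof.
move=> sp sp' eqe; case: p p' sp sp' eqe => [F m] [F' m'] sp sp' eqe.
congr pair; first by apply/setP => e; rewrite (state_in e sp).1 (state_in e sp').1 eqe.
apply: (can_inj (@toNK _)); apply/ffunP => e.
by rewrite (state_in e sp).2 (state_in e sp').2 eqe.
Qed.

(** The forest and the marks of a divisor are read off its exponents; edges removed from
the forest have no marks left. *)
Lemma state_ideal p (f : E -> nat) : state p -> (forall e, f e <= expo p e) ->
  exists2 p', state p' & forall e, expo p' e = f e.
Proof.
move=> sp le; pose F' := [set e | 0 < f e + base e].
pose M' : {ffun E -> nat} := [ffun e => (f e + base e).-1].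
have eM e : toN p.2 e = (expo p e + base e).-1 by case: (state_in e sp).
have eF e : (e \in p.1) = (0 < expo p e + base e) by case: (state_in e sp).
have leM e : M' e <= toN p.2 e by rewrite eM ffunE -!subn1 leq_sub2r // leq_add2r.
have /and3P[X sZ m12] := sp.
have X' : inXh F' M'.
  apply: (inX_subset (inX_sub X leM)) => [|e].
    by apply/subsetP => e; rewrite inE eF => /leq_trans->//; rewrite leq_add2r.
  by rewrite !inE ffunE -leqNgt leqn0 => /andP[/eqP-> _].
have M3 : toN (ofN M') = M'.
  by apply/ffunP => e; rewrite !ffunE inordK // ltnS; have := inX_le3 e X'; rewrite ffunE.
exists (F', ofN M').
  rewrite /state /= M3 X' /=; apply/andP; split.
    apply/subsetP => e; rewrite !inE addn_gt0 /base => eZ; apply/orP; right.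
    by move: eZ; rewrite !inE; case: (_ && _); case: (is12 e).
  apply/forallP => e; apply/implyP => e12; rewrite ffunE.
  by rewrite /base !inE e12 /= !addnS.
move=> e; rewrite /expo /= M3 ffunE inE; case: (posnP (f e + base e)) => [f0|pos].
  by rewrite f0 /=; move: f0 => /eqP; rewrite addn_eq0 => /andP[/eqP->].
by rewrite add1n prednK // addnK.
Qed.

Definition maximal_state p := state p /\
  forall p', state p' -> (forall e, expo p e <= expo p' e) -> forall e, expo p' e = expo p e.

Lemma maximal_stateX p : maximal_state p -> maximalX hs ht hc p.1 (toN p.2).
Proof.
case: p => F m [sp mx]; have /and3P[X sZ m12] := sp; rewrite /=; split=> // [g gF|e eF]; apply/negP => Xg.
  have sg : state (g |: F, m).
    by rewrite /state /= Xg m12 andbT (subset_trans sZ) ?subsetUr.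
  have le e : expo (F, m) e <= expo (g |: F, m) e.
    by rewrite leq_sub2r // leq_add2r !inE; case: (e \in F); rewrite ?orbT.
  have eq e := mx _ sg le e; have [/=] := expo_inj sg sp eq.
  by move/setP/(_ g); rewrite setU11 (negbTE gF).
have M3 : toN (ofN (addm (toN m) e)) = addm (toN m) e.
  by apply/ffunP => f; rewrite !ffunE inordK // ltnS; have := inX_le3 f Xg; rewrite !ffunE.
have sg : state (F, ofN (addm (toN m) e)).
  rewrite /state /= M3 Xg sZ /=; apply/forallP => f; apply/implyP => f12.
  by rewrite ffunE ltn_addr //; have /forallP/(_ f) := m12; rewrite f12.
have le f : expo (F, m) f <= expo (F, ofN (addm (toN m) e)) f.
  by rewrite leq_sub2r // leq_add2l M3 [addm _ _ _]ffunE leq_addr.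
have eq f := mx _ sg le f; have := congr1 (fun p => toN p.2 e) (expo_inj sg sp eq).
by rewrite /= M3 [addm _ _ _]ffunE eqxx addn1 => /eqP; rewrite eqn_leq ltnn.
Qed.

Lemma state_pure p p' : maximal_state p -> maximal_state p' ->
  \sum_e expo p e = \sum_e expo p' e.
Proof.
move=> mp mp'; have := maximal_deg (maximal_stateX mp) (maximal_stateX mp').
have [sp _] := mp; have [sp' _] := mp'; rewrite -!sum_expo //.
by move=> /addIn.
Qed.

Lemma G_conn x y : gconn setT x y.
Proof.
have ce e : gconn setT (gsrc e) (gtgt e) by apply: conn_edge; rewrite inE.
have edge u v e : G e == [set u; v] -> gconn setT u v.
  rewrite gendsE set2_eq => /orP[]/andP[/eqP<- /eqP<-] //; by rewrite conn_sym.
have to0 v : v \in apexes -> gconn setT v v0.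
  rewrite !inE => /or3P[]/eqP->; first exact: conn_refl.
    by rewrite conn_sym; apply: edge G01.
  by rewrite conn_sym; apply: edge G02.
have all0 v : gconn setT v v0.
  have [|nv] := boolP (v \in apexes); first exact: to0.
  have [u u_in /existsP[e Ge]] := cover nv.
  exact: conn_trans (edge _ _ _ Ge) (to0 _ u_in).
by apply: conn_trans (all0 x) _; rewrite conn_sym.
Qed.

End Triconed.

From mathcomp Require Import finmap mpoly.

(** * From sums to degree sequences *)

(** The numbers [a i] and [b i] are digits in a base that may be taken as large as
desired. *)
Lemma digits_eq (n : nat) (a b : nat -> nat) :
  (forall q, \sum_(i < n) a i * q.+1 ^ i = \sum_(i < n) b i * q.+1 ^ i) ->
  forall i, i < n -> a i = b i.
Proof.
elim: n a b => // n IH a b eqs.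
have low (c : nat -> nat) q : \sum_(i < n.+1) c i * q.+1 ^ i =
    c 0 + (\sum_(i < n) c i.+1 * q.+1 ^ i) * q.+1.
  rewrite big_ord_recl expn0 muln1 big_distrl; congr addn.
  by apply: eq_bigr => i _; rewrite /= expnSr mulnA.
have eq0 : a 0 = b 0.
  have := congr1 (modn^~ (a 0 + b 0).+1) (eqs (a 0 + b 0)).
  by rewrite !low /= [a 0 + _]addnC [b 0 + _]addnC !modnMDl !modn_small ?ltnS ?leq_addr ?leq_addl.
case=> [//|i]; rewrite ltnS; apply: (IH (a \o succn) (b \o succn)) => q.
by apply/eqP; rewrite -(eqn_pmul2r (ltn0Sn q)) -(eqn_add2l (a 0)) {2}eq0 -!low eqs.
Qed.

Lemma sum_by_value (T : finType) (P : pred T) (d : T -> nat) n (f : nat -> nat) :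
  (forall x, P x -> d x <= n) ->
  \sum_(x | P x) f (d x) = \sum_(i < n.+1) #|[set x | P x & d x == i]| * f i.
Proof.
move=> le; rewrite (partition_big (fun x => inord (d x) : 'I_n.+1) xpredT) //=.
apply: eq_bigr => i _; rewrite -sum1_card big_distrl /=; under [RHS]eq_bigl do rewrite inE.
apply: eq_big => x; last by move=> /andP[/le dn /eqP <-]; rewrite mul1n inordK.
by case: (boolP (P x)) => //= /le dn; rewrite -val_eqE /= inordK.
Qed.

(** The monomials are given by states [s] and exponent functions [expo s], on which
being an order ideal, purity and the degree count are expressed directly. *)
Section Monomials.
Variables (disp : Order.disp_t) (E : finOrderType disp) (Bs : {set {set E}}).
Variables (S : finType) (state : pred S) (expo : S -> E -> nat).
Let deg s := \sum_e expo s e.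
Hypotheses
  (inj : forall s s', state s -> state s' -> (forall e, expo s e = expo s' e) -> s = s')
  (ideal : forall s (f : E -> nat), state s -> (forall e, f e <= expo s e) ->
     exists2 s', state s' & forall e, expo s' e = f e)
  (pure : forall s s',
     (state s /\ forall t, state t -> (forall e, expo s e <= expo t e) ->
        forall e, expo t e = expo s e) ->
     (state s' /\ forall t, state t -> (forall e, expo s' e <= expo t e) ->
        forall e, expo t e = expo s' e) -> deg s = deg s')
  (bases_le : forall B, B \in Bs -> #|passive Bs B| <= matroid_rank Bs)
  (deg_le : forall s, state s -> deg s <= matroid_rank Bs)
  (sums : forall q, \sum_(B in Bs) q.+1 ^ (matroid_rank Bs - #|passive Bs B|) =
     \sum_(s | state s) q.+1 ^ (matroid_rank Bs - deg s)).

Let n := #|E|.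
Let mon s : 'X_{1..n} := [multinom expo s (enum_val i) | i < n].
Let X : {fset 'X_{1..n}} := [fset mon s | s in [set s | state s]]%fset.

Lemma h_count i : nth 0 (h_vector Bs) i = #|[set s | state s & deg s == i]|.
Proof.
rewrite /h_vector; set r := matroid_rank Bs.
have [ir|ri] := leqP i r; last first.
  rewrite nth_default ?size_mkseq //; apply/esym/eqP; rewrite cards_eq0; apply/eqP/setP => s.
  rewrite !inE; apply/negbTE/negP => /andP[/deg_le + /eqP eqi]; rewrite eqi.
  by rewrite leqNgt ri.
rewrite nth_mkseq // -[i in LHS](subKn ir) -[i in RHS](subKn ir).
pose a k := #|[set B in Bs | #|passive Bs B| == r - k]|.
pose b k := #|[set s | state s & deg s == r - k]|.
rewrite -[LHS]/(a (r - i)) -[RHS]/(b (r - i)).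
apply: (@digits_eq r.+1); last by rewrite ltnS leq_subr.
move=> q; have flip (F : nat -> nat) : \sum_(j < r.+1) F j = \sum_(j < r.+1) F (r - j).
  by rewrite (reindex_inj rev_ord_inj); apply: eq_bigr => j _; rewrite /= subSS.
rewrite (flip (fun j => a j * q.+1 ^ j)) (flip (fun j => b j * q.+1 ^ j)).
have := sums q; rewrite (sum_by_value (fun k => q.+1 ^ (r - k)) bases_le).
rewrite (sum_by_value (fun k => q.+1 ^ (r - k)) deg_le) => eqs.
transitivity (\sum_(j < r.+1) #|[set B in Bs | #|passive Bs B| == j]| * q.+1 ^ (r - j)).
  by apply: eq_bigr => j _; rewrite /a subKn // -ltnS.
rewrite eqs; apply: eq_bigr => j _; rewrite /b subKn // -ltnS //.
Qed.

Lemma monE s e : mon s (enum_rank e) = expo s e.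
Proof. by rewrite mnmE enum_rankK. Qed.

Lemma mdeg_mon s : mdeg (mon s) = deg s.
Proof.
rewrite mdegE /deg (reindex (@enum_val _ E)) /=; last exact: onW_bij (@enum_val_bij E).
by apply: eq_bigr => i _; rewrite mnmE.
Qed.

Lemma monP m : reflect (exists2 s, state s & m = mon s) (m \in X).
Proof.
apply: (iffP (imfsetP _ _ _ _)) => [[s /=]|[s ss ->]]; first by rewrite inE; exists s.
by exists s => //=; rewrite inE.
Qed.

Lemma mon_inj s s' : state s -> state s' -> mon s = mon s' -> s = s'.
Proof. by move=> ss ss' eqm; apply: inj => // e; rewrite -!monE eqm. Qed.

Lemma pure_O_of_states : pure_O_sequence (h_vector Bs).
Proof.
exists n, X; split.
- move=> m m' /monP[s ss ->] /mnm_lepP le.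
  have [e|s' ss' eqs] := @ideal s (fun e => m' (enum_rank e)) ss.
    by have := le (enum_rank e); rewrite monE.
  by apply/monP; exists s' => //; apply/mnmP => i; rewrite mnmE eqs enum_valK.
- have mx s : state s -> maximal_monomial X (mon s) ->
    state s /\ forall t, state t -> (forall e, expo s e <= expo t e) ->
        forall e, expo t e = expo s e.
    move=> ss [_ mx]; split=> // t st le e; rewrite -!monE; congr (fun_of_multinom _ _).
    apply: mx; first by apply/monP; exists t.
    by apply/mnm_lepP => i; rewrite !mnmE.
  move=> m m' mm mm'; have [/monP[s ss es] _] := mm; have [/monP[s' ss' es'] _] := mm'.
  by rewrite es es' !mdeg_mon; apply: pure; apply: mx; rewrite -?es -?es'.
move=> i; rewrite h_count.
have -> : [fset m in X | mdeg m == i]%fset = [fset mon s | s in [set s | state s & deg s == i]]%fset.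
  apply/fsetP => m; rewrite !inE /=; apply/andP/imfsetP => [[/monP[s ss ->]]|[s /=]].
    by rewrite mdeg_mon => ds; exists s => //=; rewrite inE ss.
  by rewrite inE => /andP[ss ds] ->; rewrite mdeg_mon; split=> //; apply/monP; exists s.
rewrite card_in_imfset /=; last first.
  by move=> s s'; rewrite !inE => /andP[ss _] /andP[ss' _]; apply: mon_inj.
by rewrite cardE; apply/esym/perm_size.
Qed.

End Monomials.

Theorem corollary4p4 (V : finType) (disp : Order.disp_t)
    (E : finOrderType disp) (G : multigraph V E) :
  triconed G -> pure_O_sequence (h_vector (graphic_matroid G)).
Proof.
case=> v0 [v1 [v2 [uniqv [/existsP[e01 a01] /existsP[e02 a02]] nopar cover]]].
have G01 : G e01 == [set v0; v1] by rewrite setUC.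
have G02 : G e02 == [set v0; v2] by rewrite setUC.
have conn := G_conn G01 G02 cover.
have V0 : 0 < #|V| by apply/card_gt0P; exists v0.
have rank := graphic_rank conn V0.
apply: (@pure_O_of_states _ _ _ _ (state G v0 v1 v2 e01) (expo G v0 v1 v2 e01)).
- exact: expo_inj.
- exact: state_ideal.
- exact: state_pure.
- move=> B; rewrite rank basesP // => /andP[_ /eqP <-].
  by apply/subset_leq_card/subsetP => e; rewrite inE => /andP[].
- by move=> s ss; rewrite rank; case: (state_deg uniqv G01 G02 nopar cover ss).
move=> q; rewrite rank -forest_sum //.
by rewrite (forest_states uniqv G01 G02 nopar cover).
Qed.
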